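(* Let $\Omega\subset\mathbb{R}^N$ ($N\ge 1$) be a bounded convex domain with smooth boundary, and let $p(\cdot):\Omega\to[1,+\infty[$ be a measurable function. Then $W_{p(\cdot)}$ is a distance on the set $P(\Omega)$ of probability measures on $\Omega$. Furthermore, if $(\rho_n)_n\subset P(\Omega)$ is a sequence and $\rho\in P(\Omega)$, then $$W_{p(\cdot)}(\rho_n,\rho)\xrightarrow[n\to\infty]{}0\quad\Longleftrightarrow\quad \rho_n\rightharpoonup\rho\ \text{ narrowly as } n\to\infty .$$
   Context: $P(\Omega)$ is the set of probability measures on $\Omega$; integration against $\rho\in P(\Omega)$ is written $\rho(x)dx$. For $\rho_0,\rho_1\in P(\Omega)$, define $$W_{p(\cdot)}(\rho_0,\rho_1):=\inf\Big\{\|v\|_{L^{p(\cdot)}_{\rho}([0,1]\times\Omega)}\;:\; \frac{\partial\rho(t,x)}{\partial t}+\mathrm{div}_x(\rho(t,x)v(t,x))=0,\ \rho(0)=\rho_0,\ \rho(1)=\rho_1\Big\},$$ the infimum being over curves $t\in[0,1]\mapsto\rho(t,\cdot)\in P(\Omega)$ and velocity fields $v:[0,1]\times\mathbb{R}^N\to\mathbb{R}^N$, where $$\|v\|_{L^{p(\cdot)}_{\rho}([0,1]\times\Omega)}:=\inf\Big\{\lambda>0:\ \int_{[0,1]\times\Omega}\Big|\frac{v(t,x)}{\lambda}\Big|^{p(x)}\rho(t,x)\,dt\,dx\le 1\Big\}.$$ Narrow convergence means convergence of integrals against bounded continuous functions. *)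

(* Defs.v *)
From HB Require Import structures.
From mathcomp Require Export all_boot all_order all_algebra.
From mathcomp Require Export all_classical all_reals all_analysis.
From mathcomp Require Export giry.

Set Implicit Arguments.
Unset Strict Implicit.
Unset Printing Implicit Defensive.

Import Order.TTheory GRing.Theory Num.Theory.
Import numFieldNormedType.Exports.

Local Open Scope classical_set_scope.
Local Open Scope ring_scope.

(** R^N with its Borel sigma-algebra: the library puts no measurable structure
    on row vectors, so it is generated here by the open sets. *)
Notation borelRn R N := (g_sigma_algebraType (@open 'rV[R]_N)).

(** The norm of ['rV[R]_N] in the library is the sup norm. *)
Definition enorm (R : realType) (N : nat) (u : 'rV[R]_N) : R :=
  Num.sqrt (\sum_(i < N) u 0 i ^+ 2).

(** [V] is finite dimensional in all uses below; there, being C^k on an open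
    set [U] amounts to existence and continuity on [U] of all iterated
    directional derivatives of order at most [k]. *)
Fixpoint Ck_on (R : realType) (V : normedModType R) (U : set V) (k : nat)
    (f : V -> R) : Prop :=
  (forall x, U x -> {for x, continuous f}) /\
  (if k is k'.+1 then
     forall u, (forall x, U x -> derivable f x u) /\ Ck_on U k' (fun x => 'D_u f x)
   else True).

Definition smooth_on (R : realType) (V : normedModType R) (U : set V)
    (f : V -> R) : Prop :=
  forall k, Ck_on U k f.

(** Near each boundary point, [Omega] is the strict sublevel set of a smooth
    function whose differential does not vanish at that point. *)
Definition smooth_boundary (R : realType) (N : nat) (Omega : set 'rV[R]_N) :
    Prop :=
  forall x, (closure Omega `\` interior Omega) x ->
    exists (U : set 'rV[R]_N) (phi : 'rV[R]_N -> R),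
      [/\ open U, U x, smooth_on U phi, (exists u, 'D_u phi x != 0) &
          Omega `&` U = [set y | U y /\ phi y < 0]].

(** P(Omega), seen as the Borel probability measures on R^N carried by
    [Omega]. *)
Definition prob_on (R : realType) (N : nat) (Omega : set 'rV[R]_N) :
    set (probability (borelRn R N) R) :=
  [set mu | mu Omega = 1%E].

Definition narrow_cvg (R : realType) (N : nat) (Omega : set 'rV[R]_N)
    (I : Type) (F : set_system I) (mu_ : I -> probability (borelRn R N) R)
    (mu : probability (borelRn R N) R) : Prop :=
  forall f : 'rV[R]_N -> R,
    {within Omega, continuous f} ->
    (exists M : R, forall x, Omega x -> `|f x| <= M) ->
    (\int[mu_ i]_(x in Omega) (f x)%:E)%E @[i --> F] -->
      (\int[mu]_(x in Omega) (f x)%:E)%E.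

(** Only the values of a curve on [0, 1] matter. Narrow continuity is what gives
    a meaning to the endpoint conditions of a distributional solution. *)
Definition narrow_curve (R : realType) (N : nat) (Omega : set 'rV[R]_N)
    (rho : R -> probability (borelRn R N) R) : Prop :=
  forall t : R, `[0, 1]%classic t ->
    prob_on Omega (rho t) /\
    narrow_cvg Omega (within `[0, 1]%classic (nbhs t)) rho (rho t).

(** C^infinity functions of (t, x) with compact support in ]0, 1[ * R^N. *)
Definition test_function (R : realType) (N : nat) (phi : R * 'rV[R]_N -> R) :
    Prop :=
  smooth_on [set: R * 'rV[R]_N] phi /\
  exists K : set (R * 'rV[R]_N),
    [/\ compact K, K `<=` `]0, 1[%classic `*` [set: 'rV[R]_N] &
        forall z, ~ K z -> phi z = 0].

(** d_t rho + div_x (rho v) = 0 in the distributions of ]0, 1[ * R^N, for a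
    Borel field [v] with rho v a finite measure. Integrals against
    rho(t, x) dt dx are iterated, the inner one being against [rho t]. The test
    functions need not vanish near the boundary of [Omega], so no mass crosses
    it. *)
Definition continuity_equation (R : realType) (N : nat) (Omega : set 'rV[R]_N)
    (rho : R -> probability (borelRn R N) R)
    (v : R * 'rV[R]_N -> 'rV[R]_N) : Prop :=
  [/\ measurable_fun (`[0, 1]%classic `*` setT : set (R * borelRn R N))
        (v : R * borelRn R N -> borelRn R N),
      (\int[lebesgue_measure]_(t in `[0%R, 1%R])
         \int[rho t]_(x in Omega) (enorm (v (t, x)))%:E < +oo)%E &
      forall phi, test_function phi ->
        (\int[lebesgue_measure]_(t in `[0%R, 1%R])
           \int[rho t]_(x in Omega)
             ('D_((1, 0) : R * 'rV[R]_N) phi (t, x) +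
              \sum_(i < N) v (t, x) 0 i *
                'D_((0, delta_mx 0 i) : R * 'rV[R]_N) phi (t, x))%:E = 0)%E].

(** The norm of L^{p(.)}_rho([0,1] * Omega), [+oo] outside of that space. *)
Definition Lp_norm (R : realType) (N : nat) (Omega : set 'rV[R]_N)
    (p : 'rV[R]_N -> R) (rho : R -> probability (borelRn R N) R)
    (v : R * 'rV[R]_N -> 'rV[R]_N) : \bar R :=
  ereal_inf [set lambda%:E | lambda in [set lambda : R |
    0 < lambda /\
    (\int[lebesgue_measure]_(t in `[0%R, 1%R])
       \int[rho t]_(x in Omega)
         (enorm (lambda^-1 *: v (t, x)) `^ p x)%:E <= 1)%E]].

Definition Wp (R : realType) (N : nat) (Omega : set 'rV[R]_N)
    (p : 'rV[R]_N -> R) (rho0 rho1 : probability (borelRn R N) R) : \bar R :=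
  ereal_inf [set c | exists (rho : R -> probability (borelRn R N) R)
                            (v : R * 'rV[R]_N -> 'rV[R]_N),
    [/\ narrow_curve Omega rho, continuity_equation Omega rho v,
        measure_eq (rho 0) rho0, measure_eq (rho 1) rho1 & c = Lp_norm Omega p rho v]].

(** Distance on [E], for an equality [eqv]. The latter is needed because measures
    are functions on all sets, with irrelevant values on nonmeasurable ones. *)
Definition is_distance_on (R : realType) (T : Type) (E : set T)
    (eqv : T -> T -> Prop) (d : T -> T -> \bar R) : Prop :=
  [/\ forall x y, E x -> E y -> (0 <= d x y < +oo)%E,
      forall x y, E x -> E y -> (d x y = 0%E <-> eqv x y),
      forall x y, E x -> E y -> d x y = d y x &
      forall x y z, E x -> E y -> E z -> (d x z <= d x y + d y z)%E].

(* Main.v *)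
Require Import Defs.
From mathcomp Require Import all_boot all_order all_algebra.
From mathcomp Require Import all_classical all_reals all_analysis.
From mathcomp Require Import measurable_realfun.
From mathcomp Require Import ring lra.
Set Implicit Arguments.
Unset Strict Implicit.
Unset Printing Implicit Defensive.
Import Order.TTheory GRing.Theory Num.Theory.
Import numFieldNormedType.Exports.
Local Open Scope classical_set_scope.
Local Open Scope ring_scope.

(** Write [adm lam mu nu] when some curve from [mu] to [nu] has modular at most 1
    at [lam], so that [Wp mu nu] is the infimum of these [lam]. Reversing curves
    makes [adm] symmetric and running two curves one after the other makes it
    additive in [lam], whence symmetry and the triangle inequality.

    As p >= 1, |v| / lam <= 1 + (|v| / lam)^p, so the modular controls the mass of
    rho v and the continuity equation tested against a smooth psi gives
    |int psi dmu - int psi dnu| <= C(psi) lam. Exhausting open sets by such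
    functions, Wp(mu_n, mu) -> 0 implies liminf mu_n(U) >= mu(U) for every open U,
    that is narrow convergence; likewise Wp(mu, nu) = 0 implies mu = nu.

    Conversely fix lam > 0. A displacement of length at most lam at constant speed
    has modular at most 1 at lam, whatever p is: every measure can be collapsed,
    cell by cell, on finitely many points attached to a fine grid, and the grid can
    be chosen with mu-null walls. By narrow convergence mu_n and mu then give
    nearly the same masses to the cells, and a small mass has to be carried over a
    long distance between finitely many fixed points. As p is finite, {p > M} has
    small length on each of the segments for M large: the mass travels at speed at
    most lam there and fast elsewhere, where the integrand is bounded because
    p <= M; the modular is then small with the mass. *)

(** * Smooth functions *)

(** The velocity is a function of time and place, so particles that meet must share their velocity.
    Hence only two kinds of flow are used: collapses along segments, where a position determines its
    target, and journeys of a single point mass, which meets each particle at rest at one instant at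
    most.

    As [p] may be unbounded, a speed above [lam] where [p] is large can make the modular infinite,
    whatever small mass is moved. Long distances are therefore covered only along finitely many
    segments fixed in advance, on which the exponent can be truncated; the price is a change of time
    that is merely Lipschitz.

    The continuity equation is tested on functions supported away from the times 0 and 1, while
    lower bounds and concatenation need values at the endpoints. Cutoffs in time and narrow
    continuity restore them, for smooth functions with bounded support in space.

    Narrow convergence bounds the masses of open sets from below only. So [mu_n] is not sent to [mu]
    directly: both are sent to a third measure, made of mass that they have in common and of one
    atom for the remainder. *)

Section smooth_algebra.
Context {R : realType} {V : normedModType R}.
Implicit Types (f g : V -> R) (k : nat).

Lemma Ck_continuous k f : Ck_on setT k f -> continuous f.
Proof. by case: k => [|k] [cf _] x; exact: cf. Qed.

Lemma Ck_derivable k f x u : Ck_on setT k.+1 f -> derivable f x u.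
Proof. by move=> [_ /(_ u)[df _]]; exact: df. Qed.

Lemma Ck_derive k f u : Ck_on setT k.+1 f -> Ck_on setT k (fun x => 'D_u f x).
Proof. by move=> [_ /(_ u)[_]]. Qed.

Lemma CkS k f : Ck_on setT k.+1 f -> Ck_on setT k f.
Proof.
elim: k f => [|k IH] f; first by move=> [cf _]; split.
move=> [cf df]; split => // u; have [d1 d2] := df u.
by split => //; apply: IH.
Qed.

(** Lets an induction on the order exhibit a formula for each directional derivative instead of
    computing with ['D_u f]. *)
Lemma CkP k f : continuous f ->
  (forall u, exists2 g, Ck_on setT k g & forall x, is_derive x u f (g x)) ->
  Ck_on setT k.+1 f.
Proof.
move=> cf df; split => [x _|u]; first exact: cf.
have [g Cg dg] := df u; split => [x _|]; first by have [] := dg x.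
by rewrite (_ : (fun x => 'D_u f x) = g)//; apply/funext => x; apply: derive_val.
Qed.

Lemma Ck_is_derive k f x u : Ck_on setT k.+1 f -> is_derive x u f ('D_u f x).
Proof. by move=> Cf; apply/derivableP; apply: Ck_derivable Cf. Qed.

Lemma Ck_cst k (c : R) : Ck_on [set: V] k (fun=> c).
Proof.
elim: k c => [|k IH] c; first by split => // x _; exact: cvg_cst.
by apply: CkP => [x|u]; [exact: cvg_cst|exists (fun=> 0); [exact: IH|move=> x; exact: is_derive_cst]].
Qed.

Lemma CkD k f g : Ck_on setT k f -> Ck_on setT k g ->
  Ck_on setT k (fun x => f x + g x).
Proof.
elim: k f g => [|k IH] f g Cf Cg.
  split => // x _.
  by apply: cvgD; [exact: (Ck_continuous Cf)|exact: (Ck_continuous Cg)].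
apply: CkP => [x|u].
  by apply: cvgD; [exact: (Ck_continuous Cf)|exact: (Ck_continuous Cg)].
exists (fun x => 'D_u f x + 'D_u g x).
  by apply: IH; exact: Ck_derive.
move=> x; have := Ck_is_derive x u Cf; have := Ck_is_derive x u Cg.
by move=> ? ?; exact: is_deriveD.
Qed.

Lemma CkM k f g : Ck_on setT k f -> Ck_on setT k g ->
  Ck_on setT k (fun x => f x * g x).
Proof.
elim: k f g => [|k IH] f g Cf Cg.
  split => // x _.
  by apply: cvgM; [exact: (Ck_continuous Cf)|exact: (Ck_continuous Cg)].
apply: CkP => [x|u].
  by apply: cvgM; [exact: (Ck_continuous Cf)|exact: (Ck_continuous Cg)].
exists (fun x => f x * 'D_u g x + g x * 'D_u f x).
  by apply: CkD; apply: IH => //; by [exact: Ck_derive|exact: CkS].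
move=> x; have := Ck_is_derive x u Cf; have := Ck_is_derive x u Cg.
by move=> ? ?; exact: is_deriveM.
Qed.

Lemma CkZ k (c : R) f : Ck_on setT k f -> Ck_on setT k (fun x => c * f x).
Proof. by move=> Cf; apply: CkM => //; exact: Ck_cst. Qed.

Lemma CkB k f g : Ck_on setT k f -> Ck_on setT k g ->
  Ck_on setT k (fun x => f x - g x).
Proof.
move=> Cf Cg; rewrite (_ : (fun _ => _) = (fun x => f x + -1 * g x)).
  by apply: CkD => //; exact: CkZ.
by apply/funext => x; rewrite mulN1r.
Qed.

Lemma CkV k f : (forall x, f x != 0) -> Ck_on setT k f ->
  Ck_on setT k (fun x => (f x)^-1).
Proof.
move=> f0; elim: k => [|k IH] Cf.
  by split => // x _; apply: cvgV => //; exact: (Ck_continuous Cf).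
apply: CkP => [x|u].
  by apply: cvgV => //; exact: (Ck_continuous Cf).
have CV := IH (CkS Cf).
exists (fun x => -1 * ((f x)^-1 * (f x)^-1) * 'D_u f x).
  by apply: CkM; [apply: CkZ; exact: CkM|exact: Ck_derive].
move=> x; have df := Ck_is_derive x u Cf.
have -> : -1 * ((f x)^-1 * (f x)^-1) * 'D_u f x = - (f x) ^- 2 *: 'D_u f x.
  by rewrite mulN1r -expr2 exprVn.
apply: DeriveDef; first by apply: derivableV => //; exact: ex_derive.
by rewrite deriveV.
Qed.

Lemma Ck_prod k (I : Type) (s : seq I) (F : I -> V -> R) :
  (forall i, Ck_on setT k (F i)) ->
  Ck_on setT k (fun x => \prod_(i <- s) F i x).
Proof.
move=> CF; elim: s => [|i s IH].
  by under eq_fun do rewrite big_nil; exact: Ck_cst.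
by under eq_fun do rewrite big_cons; exact: CkM.
Qed.

End smooth_algebra.

(** * Composition with affine maps *)

Section smooth_affine.
Context {R : realType} {V W : normedModType R}.
Variables (A dA : V -> W).
Hypothesis cA : continuous A.
Hypothesis AE : forall x u (h : R), A (h *: u + x) = h *: dA u + A x.

(** Directional derivatives alone obey no chain rule in general. Along an affine map the difference
    quotients of [f \o A] at [x] are literally those of [f] at [A x]. *)
Lemma is_derive_affine (f : W -> R) x u :
  derivable f (A x) (dA u) -> is_derive x u (f \o A) ('D_(dA u) f (A x)).
Proof.
move=> df.
have E : (fun h : R => h^-1 *: (((f \o A) \o shift x) (h *: u) - (f \o A) x)) =
    (fun h : R => h^-1 *: ((f \o shift (A x)) (h *: dA u) - f (A x))).
  by apply/funext => h /=; rewrite AE.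
apply: DeriveDef; first by rewrite /derivable E.
by rewrite /derive E.
Qed.

Lemma Ck_affine k (f : W -> R) : Ck_on setT k f -> Ck_on setT k (f \o A).
Proof.
elim: k f => [|k IH] f Cf.
  by split => // x _; apply: continuous_comp; [exact: cA|exact: (Ck_continuous Cf)].
apply: CkP => [x|u].
  by apply: continuous_comp; [exact: cA|exact: (Ck_continuous Cf)].
exists ((fun y => 'D_(dA u) f y) \o A).
  exact/IH/Ck_derive.
by move=> x; apply: is_derive_affine; apply: Ck_derivable Cf.
Qed.

End smooth_affine.

(** * A smooth step function on the line *)

Section smooth_step.
Context {R : realType}.

(** [Ck_on] tests every direction of the normed space [R^o], whereas calculus in one variable uses
    the direction 1. *)
Lemma is_derive_dir (f : R -> R) (x u d : R) :
  is_derive x 1 f d -> is_derive (x : R^o) (u : R^o) (f : R^o -> R) (u * d).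
Proof.
move=> df; have dxf : differentiable (f : R^o -> R) x.
  by apply/derivable1_diffP; exact: ex_derive.
apply: DeriveDef; first exact: diff_derivable.
rewrite deriveE//.
have df1 : derivable f x 1 by exact: ex_derive.
by rewrite deriv1E// derive1E derive_val.
Qed.

Lemma is_derive_continuous (f : R -> R) (x d : R) :
  is_derive x 1 f d -> {for x, continuous f}.
Proof.
by move=> df; apply: differentiable_continuous; apply/derivable1_diffP; exact: ex_derive.
Qed.

(** For positive [n], raise [expR (y / n) >= y / n] to the power [n]. *)
Lemma pow_expRN_bounded (n : nat) (y : R) : 0 < y -> y ^+ n * expR (- y) <= n%:R ^+ n.
Proof.
case: n => [|n] y0.
  by rewrite !expr0 mul1r; rewrite -expR0 ler_expR; lra.
have n0 : 0 < n.+1%:R :> R by rewrite ltr0n.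
rewrite expRN -/(_ / _) ler_pdivrMr ?expR_gt0//.
have -> : expR y = expR (y / n.+1%:R) ^+ n.+1.
  by rewrite -expRM_natl mulrC divfK// gt_eqF.
rewrite -exprMn lerXn2r// ?nnegrE ?mulr_ge0 ?expR_ge0// ?(ltW y0)//.
rewrite mulrC -ler_pdivrMr//.
by apply: le_trans (expR_ge1Dx _); rewrite lerDr.
Qed.

Lemma poly_expRN_bounded (P : {poly R}) :
  exists2 C : R, 0 <= C & forall y, 0 < y -> `|P.[y] * expR (- y)| <= C.
Proof.
exists (\sum_(i < size P) `|P`_i| * i%:R ^+ i).
  by apply: sumr_ge0 => i _; rewrite mulr_ge0// exprn_ge0.
move=> y y0; rewrite horner_coef mulr_suml.
apply: (le_trans (ler_norm_sum _ _ _)); apply: ler_sum => i _.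
rewrite -mulrA normrM ler_wpM2l// ger0_norm ?pow_expRN_bounded//.
by rewrite mulr_ge0 ?expR_ge0// exprn_ge0// ltW.
Qed.

(** The classical flat function is [flat 1]. Polynomial factors in [x^-1] make the family stable
    under derivation, which turns smoothness into an induction on the order. *)
Definition flat (P : {poly R}) (x : R) : R :=
  if 0 < x then P.[x^-1] * expR (- x^-1) else 0.

(** The exponential bound applied to ['X^2 * P] yields two powers of [h], so that difference
    quotients at 0 tend to 0. *)
Lemma flat_bound (P : {poly R}) :
  exists2 C : R, 0 <= C & forall h, `|flat P h| <= C * h ^+ 2.
Proof.
have [C C0 PC] := poly_expRN_bounded ('X^2 * P).
exists C => // h; rewrite /flat; case: ifPn => [h0|_]; last first.
  by rewrite normr0 mulr_ge0// sqr_ge0.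
have := PC h^-1; rewrite invr_gt0 => /(_ h0).
rewrite hornerM hornerXn -mulrA normrM ger0_norm ?exprn_ge0 ?invr_ge0 ?(ltW h0)//.
by rewrite exprVn mulrC ler_pdivrMr// exprn_gt0.
Qed.

Lemma is_derive_flat0 (P : {poly R}) : is_derive (0 : R) 1 (flat P) 0.
Proof.
have [C C0 PC] := flat_bound P.
have F0 : flat P 0 = 0 by rewrite /flat ltxx.
have lim0 : (fun h : R => h^-1 *: ((flat P \o shift 0) (h *: 1) - flat P 0)) @ 0^' --> (0:R).
  apply/cvgrPdist_le => /= e e0.
  near=> h.
  have h0 : h != 0 by near: h; exact: nbhs_dnbhs_neq.
  rewrite F0 subr0 addr0 sub0r normrN [h *: 1]mulr1 normrM normfV.
  rewrite mulrC ler_pdivrMr ?normr_gt0//.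
  apply: (le_trans (PC h)).
  rewrite -[h ^+ 2]ger0_norm ?sqr_ge0// normrX expr2 mulrA ler_wpM2r//.
  have : `|h| <= e / (C + 1).
    near: h; apply: dnbhs0_le; rewrite divr_gt0//; lra.
  rewrite ler_pdivlMr; last by lra.
  move=> Ch; apply: le_trans Ch; rewrite mulrC ler_wpM2l//; lra.
apply: DeriveDef; first by apply/cvg_ex; exists 0.
exact: cvg_lim.
Unshelve. all: by end_near. Qed.

(** With [y = x^-1], whose derivative is [- y^2], the derivative of [P(y) exp(-y)] is
    [y^2 (P(y) - P'(y)) exp(-y)]. *)
Definition flat_next (P : {poly R}) : {poly R} := 'X^2 * (P - P^`()).

Lemma is_derive_flat (P : {poly R}) (x : R) :
  is_derive x 1 (flat P) (flat (flat_next P) x).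
Proof.
have [x0|x0|->] := ltgtP x 0.
- rewrite {2}/flat ltNge ltW//=.
  apply: (@near_eq_is_derive R R R (fun=> 0)).
    near=> y; rewrite /flat; case: ifPn => // y0; exfalso.
    have : y < 0 by near: y; exact: lt_nbhsl.
    lra.
- rewrite {2}/flat x0.
  have -> : (flat_next P).[x^-1] * expR (- x^-1) =
     P.[x^-1] * (x ^- 2 * expR (- x^-1)) + expR (- x^-1) * (- x ^- 2 * P^`().[x^-1]).
    by rewrite /flat_next hornerM hornerXn hornerD hornerN exprVn; ring.
  apply: (@near_eq_is_derive R R R (fun y => P.[y^-1] * expR (- y^-1))).
    near=> y; rewrite /flat ifT//; near: y; exact: lt_nbhsr.
  have dV : is_derive x 1 (fun y : R => y^-1) (- x ^- 2).
    have := @is_deriveV R id x 1 1; rewrite [_ *: _]mulr1; apply; first by rewrite gt_eqF.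
  have dP : is_derive x 1 (fun y : R => P.[y^-1]) (- x ^- 2 * P^`().[x^-1]).
    have := @is_derive1_comp R (horner P) (fun y => y^-1) x (P^`().[x^-1]) (- x ^- 2).
    rewrite mulrC; apply => //.
  have dE : is_derive x 1 (fun y : R => expR (- y^-1)) (x ^- 2 * expR (- x^-1)).
    have dN : is_derive x 1 (fun y : R => - y^-1) (x ^- 2).
      by rewrite -[x ^- 2]opprK; exact: is_deriveN.
    have := @is_derive1_comp R expR (fun y => - y^-1) x (expR (- x^-1)) (x ^- 2).
    rewrite mulrC; apply => //; exact: is_derive_expR.
  exact: is_deriveM.
- rewrite {2}/flat ltxx; exact: is_derive_flat0.
Unshelve. all: by end_near. Qed.

Lemma Ck_flat k (P : {poly R}) : Ck_on [set: R^o] k (flat P : R^o -> R).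
Proof.
elim: k P => [|k IH] P.
  by split => // x _; apply: is_derive_continuous; exact: is_derive_flat.
apply: CkP => [x|u].
  by apply: is_derive_continuous; exact: is_derive_flat.
exists (fun x => u * flat (flat_next P) x); first by apply: CkZ; exact: IH.
by move=> x; apply: is_derive_dir; exact: is_derive_flat.
Qed.

Definition step (x : R) : R := flat 1 x / (flat 1 x + flat 1 (1 - x)).

Lemma flat1_ge0 x : 0 <= flat 1 x.
Proof.
by rewrite /flat; case: ifPn => // _; rewrite hornerC mul1r expR_ge0.
Qed.

Lemma flat1_gt0 x : 0 < x -> 0 < flat 1 x.
Proof. by move=> x0; rewrite /flat x0 hornerC mul1r expR_gt0. Qed.

Lemma step_den_gt0 x : 0 < flat 1 x + flat 1 (1 - x).
Proof.
have [x0|x0] := ltP 0 x.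
  by rewrite ltr_pwDl ?flat1_gt0 ?flat1_ge0.
by rewrite ltr_pwDr ?flat1_ge0// flat1_gt0//; lra.
Qed.

Lemma step_le0 x : x <= 0 -> step x = 0.
Proof. by move=> x0; rewrite /step /flat ltNge x0/= mul0r. Qed.

Lemma step_ge1 x : 1 <= x -> step x = 1.
Proof.
move=> x1; rewrite /step [flat 1 (1 - x)]/flat ltNge (_ : 1 - x <= 0) /=; last lra.
by rewrite addr0 divff// gt_eqF// flat1_gt0//; lra.
Qed.

Lemma step_ge0 x : 0 <= step x.
Proof. by rewrite divr_ge0 ?flat1_ge0// ltW// step_den_gt0. Qed.

Lemma step_le1 x : step x <= 1.
Proof.
by rewrite /step ler_pdivrMr ?step_den_gt0// mul1r lerDl flat1_ge0.
Qed.

Lemma Ck_step k : Ck_on [set: R^o] k (step : R^o -> R).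
Proof.
have C1 : Ck_on [set: R^o] k (fun x : R^o => flat 1 (1 - x)).
  apply: (@Ck_affine R R^o R^o (fun x => 1 - x) (fun u => - u) _ _ k (flat 1)).
  - by move=> x; apply: cvgB; [exact: cvg_cst|exact: cvg_id].
  - by move=> x u h; rewrite /GRing.scale/=; ring.
  - exact: Ck_flat.
apply: CkM; first exact: Ck_flat.
apply: CkV; first by move=> x; rewrite gt_eqF// step_den_gt0.
by apply: CkD => //; exact: Ck_flat.
Qed.

End smooth_step.

(** * First order calculus from directional derivatives *)

Section C1_calculus.
Context {R : realType} {V : normedModType R}.
Variable f : V -> R.
Hypothesis C1f : Ck_on setT 1 f.

Lemma is_derive_line (x u : V) (s : R) :
  is_derive s 1 (fun h : R => f (x + h *: u)) ('D_u f (x + s *: u)).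
Proof.
have cA : continuous (fun h : R^o => x + h *: u : V).
  by move=> h; apply: cvgD; [exact: cvg_cst|apply: cvgZr_tmp; exact: cvg_id].
have AE (y w : R^o) (h : R) : x + (h *: w + y) *: u = h *: (w *: u) + (x + y *: u).
  by rewrite scalerDl addrCA scalerA.
have := @is_derive_affine R R^o V _ (fun w => w *: u) AE f s 1.
by rewrite scale1r; apply; apply: Ck_derivable C1f.
Qed.

Lemma line_MVT (x u : V) (h : R) :
  exists2 xi, `|xi| <= `|h| & f (x + h *: u) - f x = h * 'D_u f (x + xi *: u).
Proof.
have E0 : f x = f (x + 0 *: u) by rewrite scale0r addr0.
have cl a b : {within `[a, b], continuous (fun h : R => f (x + h *: u))}.
  apply: continuous_subspaceT => s.
  by apply: is_derive_continuous; exact: is_derive_line.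
have [h0|h0|->] := ltgtP h 0.
- have [|c] := @MVT R (fun h : R => f (x + h *: u)) (fun s => 'D_u f (x + s *: u)) h 0 h0 _ (cl _ _).
    by move=> s _; exact: is_derive_line.
  rewrite in_itv/= => /andP[hc c0] E; exists c.
    by rewrite !ltr0_norm// lerN2 ltW.
  by rewrite E0 -opprB E sub0r mulrN opprK mulrC.
- have [|c] := @MVT R (fun h : R => f (x + h *: u)) (fun s => 'D_u f (x + s *: u)) 0 h h0 _ (cl _ _).
    by move=> s _; exact: is_derive_line.
  rewrite in_itv/= => /andP[c0 ch] E; exists c.
    by rewrite !gtr0_norm// ltW.
  by rewrite E0 E subr0 mulrC.
- by exists 0; rewrite // scale0r addr0 subrr mul0r.
Qed.

(** [Ck_on] treats one direction at a time, so additivity of ['D_u f x] in [u] has to come from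
    continuity of the derivatives. Moving along [a], then along [b], gives a joint expansion; it
    serves again where the increment [al] comes from a function that is only Lipschitz. *)
Lemma C1_twodir (x a b : V) (e : R) : 0 < e ->
  exists2 d, 0 < d & forall al be : R, `|al| < d -> `|be| < d ->
    `|f (x + al *: a + be *: b) - f x - al * 'D_a f x - be * 'D_b f x|
      <= e * (`|al| + `|be|).
Proof.
move=> e0.
have near_cont (w : V) : exists2 r, 0 < r &
    forall y, `|y| < r -> `|'D_w f (x + y) - 'D_w f x| <= e.
  have /= := @Ck_continuous _ _ _ _ (Ck_derive w C1f) x.
  move=> /cvgrPdist_le /(_ e e0) /nbhs_ballP[r/= r0 H]; exists r => // y yr.
  rewrite distrC; apply: H; rewrite -ball_normE/= opprD addNKr normrN //.
have [r1 r10 H1] := near_cont a; have [r2 r20 H2] := near_cont b.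
pose r := Num.min r1 r2.
have r0 : 0 < r by rewrite lt_min r10 r20.
pose d := r / (`|a| + `|b| + 1).
have D0 : 0 < `|a| + `|b| + 1 by rewrite ltr_wpDl// addr_ge0.
have d0 : 0 < d by rewrite divr_gt0.
have small (xi eta : R) : `|xi| < d -> `|eta| < d -> `|xi *: a + eta *: b| < r.
  move=> xd ed; apply: (le_lt_trans (ler_normD _ _)); rewrite !normrZ.
  have -> : r = d * (`|a| + `|b| + 1) by rewrite /d divfK// gt_eqF.
  rewrite !mulrDr mulr1 ltr_pwDr//.
  by rewrite lerD// ler_wpM2r// ltW.
exists d => // al be ald bed.
have [xi xile E1] := line_MVT x a al.
have [eta etale E2] := line_MVT (x + al *: a) b be.
rewrite (_ : f (x + al *: a + be *: b) - f x - al * 'D_a f x - be * 'D_b f x =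
  al * ('D_a f (x + xi *: a) - 'D_a f x) +
  be * ('D_b f (x + al *: a + eta *: b) - 'D_b f x)); last first.
  by rewrite !mulrBr -E1 -E2; ring.
apply: (le_trans (ler_normD _ _)); rewrite !normrM (mulrDr e).
apply: lerD; rewrite mulrC ler_wpM2r//.
- apply: H1; have := small xi 0; rewrite scale0r addr0 normr0 => /(_ (le_lt_trans xile ald) d0).
  by rewrite /r lt_min => /andP[].
- rewrite -addrA; apply: H2.
  by have := small al eta ald (le_lt_trans etale bed); rewrite /r lt_min => /andP[].
Qed.

Lemma is_derive_lincomb (x a b : V) (c d : R) :
  is_derive x (c *: a + d *: b) f (c * 'D_a f x + d * 'D_b f x).
Proof.
have lim : (fun h : R => h^-1 *: ((f \o shift x) (h *: (c *: a + d *: b)) - f x)) @ 0^'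
    --> c * 'D_a f x + d * 'D_b f x.
  apply/cvgrPdist_le => /= e e0.
  pose K := `|c| + `|d| + 1.
  have K0 : 0 < K by rewrite ltr_wpDl// addr_ge0.
  have [r r0 H] := C1_twodir x a b (divr_gt0 e0 K0).
  near=> h.
  have h0 : h != 0 by near: h; exact: nbhs_dnbhs_neq.
  have hr : `|h| < r / K.
    by near: h; apply: dnbhs0_lt; rewrite divr_gt0.
  have hK (k : R) : `|k| <= K -> `|h * k| < r.
    move=> kK; rewrite normrM.
    apply: (@le_lt_trans _ _ (`|h| * K)); first by rewrite ler_wpM2l.
    by rewrite -ltr_pdivlMr.
  have := H (h * c) (h * d).
  have cK : `|c| <= K by rewrite /K -addrA lerDl addr_ge0.
  have dK : `|d| <= K by rewrite /K -addrA addrCA lerDl addr_ge0.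
  move=> /(_ (hK _ cK) (hK _ dK)) B.
  rewrite distrC addrC.
  rewrite (_ : h^-1 *: _ = h^-1 * (f (x + (h * c) *: a + (h * d) *: b) - f x)); last first.
    by congr (_ * (f _ - _)); rewrite /= scalerDr !scalerA addrC addrA.
  rewrite (_ : _ + _ = h^-1 * (f (x + (h * c) *: a + (h * d) *: b) - f x
    - h * c * 'D_a f x - h * d * 'D_b f x)); last by field.
  rewrite normrM normfV mulrC ler_pdivrMr ?normr_gt0//.
  apply: (le_trans B); rewrite !normrM -mulrDr mulrAC -mulrA.
  rewrite ler_wpM2l ?(ltW e0)// ler_pdivrMr// ler_wpM2l//.
  by rewrite /K lerDl.
by apply: DeriveDef; [apply/cvg_ex; exists (c * 'D_a f x + d * 'D_b f x)|exact: cvg_lim].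
Unshelve. all: by end_near. Qed.

Lemma derive_lincomb (x a b : V) (c d : R) :
  'D_(c *: a + d *: b) f x = c * 'D_a f x + d * 'D_b f x.
Proof. by have dl := is_derive_lincomb x a b c d; rewrite derive_val. Qed.

Lemma derive_scale_dir (x a : V) (c : R) : 'D_(c *: a) f x = c * 'D_a f x.
Proof. by have := derive_lincomb x a 0 c 0; rewrite scale0r addr0 mul0r addr0. Qed.

Lemma derive_add_dir (x a b : V) : 'D_(a + b) f x = 'D_a f x + 'D_b f x.
Proof. by have := derive_lincomb x a b 1 1; rewrite !scale1r !mul1r. Qed.

Lemma derive_sum_dir (x : V) (I : Type) (s : seq I) (e : I -> V) (c : I -> R) :
  'D_(\sum_(i <- s) c i *: e i) f x = \sum_(i <- s) c i * 'D_(e i) f x.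
Proof.
elim: s => [|i s IH]; first by rewrite !big_nil derive0.
by rewrite !big_cons derive_add_dir derive_scale_dir IH.
Qed.

End C1_calculus.

Section spacetime_derivatives.
Context {R : realType} {N : nat}.
Notation V := (R * 'rV[R]_N)%type.
Variable phi : V -> R.
Hypothesis C1phi : Ck_on setT 1 phi.

Lemma derive_spacetime (z : V) (t : R) (u : 'rV[R]_N) :
  'D_((t, u) : V) phi z = t * 'D_((1, 0) : V) phi z +
    \sum_(i < N) u 0 i * 'D_((0, delta_mx 0 i) : V) phi z.
Proof.
rewrite -(derive_sum_dir C1phi) -(derive_scale_dir C1phi) -(derive_add_dir C1phi).
congr ('D_ _ phi z).
have addE (a b : R) (x y : 'rV[R]_N) : ((a, x) : V) + (b, y) = (a + b, x + y) by [].
have scaleE (a b : R) (x : 'rV[R]_N) : a *: ((b, x) : V) = (a * b, a *: x) by [].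
have sumE (s : seq 'I_N) : \sum_(i <- s) (u 0 i) *: ((0, delta_mx 0 i) : V) =
    (0, \sum_(i <- s) u 0 i *: delta_mx 0 i).
  elim: s => [|i s IH]; first by rewrite !big_nil.
  by rewrite !big_cons IH scaleE addE mulr0 addr0.
by rewrite sumE scaleE addE mulr1 scaler0 addr0 add0r -row_sum_delta.
Qed.

End spacetime_derivatives.

(** * Borel structure of R^N *)

Section borel.
Context {R : realType} {N : nat}.
Local Notation T := (borelRn R N).

Lemma open_measurable_Rn (U : set 'rV[R]_N) : open U -> measurable (U : set T).
Proof. by move=> oU; apply: sub_sigma_algebra. Qed.

Lemma measurable_fun_open_preimage d (X : measurableType d) (f : X -> R) :
  (forall O : set R, open O -> measurable (f @^-1` O)) -> measurable_fun setT f.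
Proof.
move=> H; apply: (measurability (@RGenOInfty.G R)); first exact: RGenOInfty.measurableE.
by move=> _ [_ [x ->] <-]; rewrite setTI; apply: H; exact: interval_open.
Qed.

Lemma continuous_measurable_Rn (f : 'rV[R]_N -> R) : continuous f ->
  measurable_fun setT (f : T -> R).
Proof.
move=> cf; apply: measurable_fun_open_preimage => O oO.
apply: open_measurable_Rn; apply: open_comp => // x _; exact: cf.
Qed.

Lemma within_continuous_measurable_Rn (D : set 'rV[R]_N) (f : 'rV[R]_N -> R) :
  open D -> {within D, continuous f} -> measurable_fun (D : set T) (f : T -> R).
Proof.
move=> oD; rewrite continuous_open_subspace// => cf.
apply: (measurability (@RGenOInfty.G R)); first exact: RGenOInfty.measurableE.
move=> _ [_ [x ->] <-].
have -> : D `&` f @^-1` `]x, +oo[ = (D `&` f @^-1` `]x, +oo[)^°%classic.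
  apply/seteqP; split; last exact: interior_subset.
  move=> y [Dy fy].
  have := cf y (mem_set Dy); move=> /(_ `]x, +oo[%classic) H.
  rewrite /interior; apply: filterI; first exact: open_nbhs_nbhs.
  by apply: H; apply: open_nbhs_nbhs; split => //; exact: interval_open.
by apply: open_measurable_Rn; exact: open_interior.
Qed.

Lemma measurable_coord (i : 'I_N) : measurable_fun setT (fun x : T => (x : 'rV[R]_N) 0 i).
Proof. by apply: continuous_measurable_Rn; exact: coord_continuous. Qed.

Definition obox (a b : 'rV[R]_N) : set 'rV[R]_N :=
  [set x | forall i, a 0 i < x 0 i < b 0 i].

Lemma mx_norm_lt (x : 'rV[R]_N) e : 0 < e -> (forall i, `|x 0 i| < e) -> `|x| < e.
Proof.
move=> e0 H; rewrite [`|x|]mx_normrE bigmax_lt// => -[i j] _ /=.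
by rewrite (ord1 i); exact: H.
Qed.

Lemma coord_le_norm (x : 'rV[R]_N) i : `|x 0 i| <= `|x|.
Proof. by rewrite [`|x|]mx_normrE; exact: (le_bigmax _ (fun ij => `|x ij.1 ij.2|) (0, i)). Qed.

(** Boxes with rational centre and half-width [1 / (k + 1)] are countably many. Boxes are seen by
    the coordinates, so this reduces measurability of maps into R^N to that of their coordinates. *)
Lemma open_bigcup_obox (U : set 'rV[R]_N) : open U -> U !=set0 ->
  exists ab : nat -> 'rV[R]_N * 'rV[R]_N, U = \bigcup_n obox (ab n).1 (ab n).2.
Proof.
move=> oU [x0 Ux0].
pose cbox (q : 'rV[rat]_N * nat) : 'rV[R]_N * 'rV[R]_N :=
  (\row_i (ratr (q.1 0 i) - q.2.+1%:R^-1), \row_i (ratr (q.1 0 i) + q.2.+1%:R^-1)).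
have key x : U x -> exists2 q, obox (cbox q).1 (cbox q).2 x &
    obox (cbox q).1 (cbox q).2 `<=` U.
  move=> Ux; have /nbhs_ballP[e /= e0 He] : nbhs x U by exact: open_nbhs_nbhs.
  have [k kP] : exists k : nat, k.+1%:R^-1 < e / 2.
    have e20 : 0 < e / 2 by rewrite divr_gt0.
    have [k _ kP] := near_infty_natSinv_lt (PosNum e20).
    by exists k; exact: kP (leqnn k).
  have k0 : 0 < k.+1%:R^-1 :> R by rewrite invr_gt0.
  have : forall i, exists r : rat, x 0 i - k.+1%:R^-1 < ratr r < x 0 i + k.+1%:R^-1.
    move=> i; have /rat_in_itvoo[r] : x 0 i - k.+1%:R^-1 < x 0 i + k.+1%:R^-1.
      by rewrite ltrD2l; apply: lt_trans k0; rewrite oppr_lt0.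
    by rewrite in_itv/= => ?; exists r.
  move=> /choice[r rP].
  exists (\row_i r i, k) => /=.
    move=> i /=; rewrite !mxE; have /andP[] := rP i.
    by set dl := (k.+1%:R^-1 : R); move=> ? ?; lra.
  move=> y /= H; apply: He; rewrite -ball_normE/=; apply: mx_norm_lt => // i.
  rewrite !mxE; have := H i; rewrite /= !mxE => /andP[h1 h2].
  have /andP[] := rP i; rewrite ltr_norml; move: h1 h2 kP.
  by set dl := (k.+1%:R^-1 : R) => *; lra.
have [q0 _ q0U] := key _ Ux0.
(* Integers that code no box, or a box not contained in [U], are sent to a fixed box inside [U]. *)
pose ab n := if unpickle n is Some q then
   if pselect (obox (cbox q).1 (cbox q).2 `<=` U) then cbox q else cbox q0 else cbox q0.
exists ab; apply/seteqP; split => x.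
  move=> /key[q xq qU]; exists (pickle q) => //.
  by rewrite /ab pickleK; case: pselect.
move=> [n _]; rewrite /ab; case: unpickle => [q|]; last by move=> /q0U.
by case: pselect => [qU /qU|_ /q0U].
Qed.

Lemma measurable_fun_Rn d (X : measurableType d) (D : set X) (f : X -> T) :
  measurable D ->
  (forall i : 'I_N, measurable_fun D (fun x => (f x : 'rV[R]_N) 0 i)) -> measurable_fun D f.
Proof.
move=> mD H; apply: (@measurability _ _ X T D f (@open 'rV[R]_N)) => //.
move=> _ [U oU <-].
have [->|/set0P U0] := eqVneq U set0; first by rewrite preimage_set0 setI0.
have [ab ->] := open_bigcup_obox oU U0.
rewrite preimage_bigcup setI_bigcupr; apply: bigcupT_measurable => n.
have -> : D `&` f @^-1` (obox (ab n).1 (ab n).2) =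
   D `&` \bigcap_(i in [set: 'I_N]) (D `&` (fun x => (f x : 'rV[R]_N) 0 i) @^-1` `](ab n).1 0 i, (ab n).2 0 i[).
  apply/seteqP; split => x [Dx fx]; split => // i; last by have := fx i I; rewrite /= in_itv/= => -[].
  by move=> _ /=; split => //; have := fx i; rewrite in_itv/=.
apply: measurableI => //; apply: fin_bigcap_measurable; first exact: finite_finset.
by move=> i _; apply: H.
Qed.

(** The product sigma-algebra is generated by rectangles, so an open set of R x R^N has to be
    written as a countable union of them. *)
Lemma continuous_measurable_spacetime (f : R * 'rV[R]_N -> R) : continuous f ->
  measurable_fun setT (f : R * T -> R).
Proof.
move=> cf; apply: measurable_fun_open_preimage => O oO.
pose W : set (R * 'rV[R]_N) := f @^-1` O.
have oW : open W by apply: open_comp => // x _; exact: cf.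
pose I0 (q : rat * nat) : set R := ball (ratr q.1 : R) (q.2.+1%:R^-1).
(* Taking the interior makes [A q] open, hence measurable. No point of [W] is lost: a product
   neighbourhood of it contains a small rational time interval times a neighbourhood in space. *)
pose A (q : rat * nat) : set 'rV[R]_N := [set x | forall t, I0 q t -> W (t, x)]^°.
have -> : f @^-1` O = \bigcup_n (if unpickle n is Some q then I0 q `*` A q else set0).
  apply/seteqP; split => [[t x] Wtx|[t x] [n _]].
    have : nbhs (t, x) W by exact: open_nbhs_nbhs.
    move=> [[B1 B2] /= [B1t B2x] BW].
    have [e /= e0 He] := B1t.
    have [k kP] : exists k : nat, k.+1%:R^-1 < e / 2.
      have e20 : 0 < e / 2 by rewrite divr_gt0.
      have [k _ kP] := near_infty_natSinv_lt (PosNum e20).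
      by exists k; exact: kP (leqnn k).
    have k0 : 0 < k.+1%:R^-1 :> R by rewrite invr_gt0.
    have /rat_in_itvoo[r] : t - k.+1%:R^-1 < t + k.+1%:R^-1.
      by rewrite ltrD2l; apply: lt_trans k0; rewrite oppr_lt0.
    rewrite in_itv/= => /andP[].
    move: kP k0; set dl := (k.+1%:R^-1 : R) => kP k0 r1 r2.
    exists (pickle (r, k)); first exact: I.
    rewrite pickleK; split.
      by rewrite /I0 /ball/= /ball_/= -/dl ltr_norml; lra.
    apply: filterS B2x => y B2y s; rewrite /I0 /ball/= /ball_/= ltr_norml => /andP[].
    rewrite -/dl => s1 s2.
    apply: BW; split => //=; apply: He; rewrite /= /ball_/= ltr_norml; lra.
  case: unpickle => [q|//] [/= I0t] /interior_subset; exact.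
apply: bigcupT_measurable => n; case: unpickle => [q|//].
apply: measurableX; first exact: measurable_ball.
by apply: open_measurable_Rn; exact: open_interior.
Qed.

Lemma measurable_fun_powR2 d (X : measurableType d) (D : set X) (f g : X -> R) :
  measurable D ->
  measurable_fun D f -> measurable_fun D g -> measurable_fun D (fun x => f x `^ g x).
Proof.
move=> mD mf mg.
rewrite (_ : (fun _ => _) = (fun x => if f x == 0 then (if g x == 0 then 1 else 0)
    else expR (g x * ln (f x)))); last first.
  by apply/funext => x; rewrite /powR; case: ifPn => // _; case: ifPn.
apply: measurable_fun_if => //.
- by apply: measurable_fun_eqr => //; exact: measurable_cst.
- have mD' : measurable (D `&` (fun t => f t == 0) @^-1` [set true]).
    by apply: (measurable_fun_eqr mf (@measurable_cst _ _ X R D 0) mD).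
  apply: measurable_fun_if => //.
  apply: measurable_fun_eqr; last exact: measurable_cst.
  by apply: measurable_funS mg => //; exact: subIsetl.
- apply: (@measurable_funS _ _ _ _ D) => //.
  apply: measurableT_comp; first exact: measurable_expR.
  apply: measurable_funM => //; apply: measurableT_comp => //; exact: measurable_ln.
Qed.

Lemma prob_eq_open (mu nu : probability T R) :
  (forall U, open U -> mu U = nu U) -> measure_eq mu nu.
Proof.
move=> H A mA.
apply: (@measure_unique _ R T (@open 'rV[R]_N) (fun=> setT) _ _ _ _ mu nu) => //.
- move=> B C oB oC; exact: openI.
- by move=> _; exact: openT.
- by rewrite bigcup_const//; exists 0%N.
- by move=> k; rewrite (@le_lt_trans _ _ 1%E)// ?probability_le1// ltry.
Qed.

Lemma continuous_bigsum (V : topologicalType) (I : Type) (s : seq I) (F : I -> V -> R) :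
  (forall i, continuous (F i)) -> continuous (fun x => \sum_(i <- s) F i x).
Proof.
move=> cF; elim: s => [|i s IH] x.
  by under eq_fun do rewrite big_nil; exact: cvg_cst.
rewrite (_ : (fun _ => _) = (fun x => F i x + \sum_(i <- s) F i x)).
  by apply: cvgD; [exact: cF|exact: IH].
by apply/funext => y; rewrite big_cons.
Qed.

Lemma continuous_enorm : continuous (@enorm R N).
Proof.
move=> x; rewrite /enorm; apply: continuous_comp; last exact: sqrt_continuous.
apply: continuous_bigsum => i y.
apply: (@continuous_comp _ _ _ (fun x : 'rV[R]_N => x 0 i) (fun r => r ^+ 2)).
  exact: coord_continuous.
exact: exprn_continuous.
Qed.

Lemma enorm_ge0 (u : 'rV[R]_N) : 0 <= enorm u.
Proof. exact: sqrtr_ge0. Qed.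

Lemma enormZ (c : R) (u : 'rV[R]_N) : enorm (c *: u) = `|c| * enorm u.
Proof.
rewrite /enorm -sqrtr_sqr -sqrtrM ?sqr_ge0//; congr Num.sqrt.
by rewrite mulr_sumr; apply: eq_bigr => i _; rewrite mxE exprMn.
Qed.

Lemma enorm0 : enorm (0 : 'rV[R]_N) = 0.
Proof. by rewrite -[0 in LHS](scale0r 0) enormZ normr0 mul0r. Qed.

Lemma coord_le_enorm (u : 'rV[R]_N) i : `|u 0 i| <= enorm u.
Proof.
rewrite -sqrtr_sqr /enorm ler_wsqrtr// (bigD1 i)//= lerDl.
by apply: sumr_ge0 => j _; rewrite sqr_ge0.
Qed.

Lemma enorm_le_norm (u : 'rV[R]_N) : enorm u <= N%:R * `|u|.
Proof.
rewrite -[leRHS]ger0_norm ?mulr_ge0// -sqrtr_sqr /enorm ler_wsqrtr//.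
apply: (@le_trans _ _ (\sum_(i < N) `|u| ^+ 2)).
  by apply: ler_sum => i _; rewrite -real_normK ?num_real// lerXn2r ?nnegrE ?coord_le_norm.
rewrite sumr_const card_ord -[_ *+ N]mulr_natl exprMn ler_wpM2r ?sqr_ge0//.
rewrite -natrX ler_nat; case: (N) => // n; by rewrite leq_pmulr.
Qed.

End borel.

(** * Bounded functions and finite measures *)

Section measure_utilities.
Context d (X : measurableType d) {R : realType}.
Variable mu : {measure set X -> \bar R}.
Local Open Scope ereal_scope.

Lemma integrable_bounded (D : set X) (f : X -> R) (M : R) :
  measurable D -> mu D < +oo -> measurable_fun D f ->
  (forall x, D x -> `|f x| <= M)%R -> mu.-integrable D (EFin \o f).
Proof.
move=> mD fD mf fM; apply: measurable_bounded_integrable => //.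
by exists M; split; [exact: num_real|move=> N MN x Dx; apply: le_trans (ltW MN); exact: fM].
Qed.

Lemma bounded_convergence (D : set X) (f_ : nat -> X -> R) (f : X -> R) (M : R) :
  measurable D -> mu D < +oo -> (forall n, measurable_fun D (f_ n)) ->
  (forall n x, D x -> `|f_ n x| <= M)%R ->
  (forall x, D x -> f_ n x @[n --> \oo] --> f x) ->
  \int[mu]_(x in D) (f_ n x)%:E @[n --> \oo] --> \int[mu]_(x in D) (f x)%:E.
Proof.
move=> mD fD mf fM cf.
have mf' : measurable_fun D f by exact: measurable_fun_cvg cf.
have [] := @dominated_convergence _ _ _ mu D mD (fun n x => (f_ n x)%:E)
  (fun x => (f x)%:E) (cst M%:E) _ _ _ _ _ => //.
- by move=> n; exact/measurable_EFinP.
- exact/measurable_EFinP.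
- by apply/aeW => x Dx; apply/cvg_EFin; [exact: nearW|exact: cf].
- apply: (@integrable_bounded _ (fun=> M) `|M|) => //.
- by apply/aeW => n x Dx; rewrite lee_fin; exact: fM.
Qed.

Lemma measure_setI1 (D A : set X) : measurable D -> measurable A ->
  mu (~` D) = 0 -> mu (A `&` D) = mu A.
Proof.
move=> mD mA D0; apply/eqP; rewrite eq_le; apply/andP; split.
  by apply: le_measure; rewrite ?inE//; exact: measurableI.
rewrite -[X in X <= _](_ : mu (A `&` D `|` A `&` ~` D) = _); last first.
  by rewrite -setIUr setUv setIT.
apply: (le_trans (measureU2 _ _ _)).
- exact: measurableI.
- by apply: measurableI => //; exact: measurableC.
- rewrite -[leRHS]adde0; apply: leeD => //; rewrite -D0.
  apply: le_measure; rewrite ?inE//.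
  + by apply: measurableI => //; exact: measurableC.
  + exact: measurableC.
Qed.

End measure_utilities.

Lemma prob_setC0 d (X : measurableType d) (R : realType) (P : probability X R) (D : set X) :
  measurable D -> (P D = 1 -> P (~` D) = 0)%E.
Proof. by move=> mD PD; rewrite probability_setC// PD subee. Qed.

Lemma prob_lty d (X : measurableType d) (R : realType) (P : probability X R) (D : set X) :
  measurable D -> (P D < +oo)%E.
Proof. by move=> mD; rewrite (le_lt_trans (probability_le1 _ _))// ltry. Qed.

(** * Smooth approximation of open sets from inside *)

Section box_approximation.
Context {R : realType} {N : nat}.
Implicit Types (a b x : 'rV[R]_N).

Definition boxfun (k : nat) a b x : R :=
  \prod_(i < N) (step (k%:R * (x 0 i - a 0 i)) * step (k%:R * (b 0 i - x 0 i))).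

Lemma boxfun01 k a b x : 0 <= boxfun k a b x <= 1.
Proof.
rewrite /boxfun; elim/big_ind: _ => [|u v /andP[u0 u1] /andP[v0 v1]|i _].
- by rewrite ler01 lexx.
- by rewrite mulr_ge0//= mulr_ile1.
- by rewrite mulr_ge0 ?step_ge0//= mulr_ile1 ?step_ge0 ?step_le1.
Qed.

Lemma boxfun_out k a b x : ~ obox a b x -> boxfun k a b x = 0.
Proof.
move=> /existsNP[i /negP]; rewrite negb_and -!leNgt => xi.
rewrite /boxfun (bigD1 i)//=.
have -> : step (k%:R * (x 0 i - a 0 i)) * step (k%:R * (b 0 i - x 0 i)) = 0; last by rewrite mul0r.
case/orP: xi => xi.
  by rewrite [step (_ * (x 0 i - _))]step_le0 ?mul0r// mulr_ge0_le0// subr_le0.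
by rewrite mulrC step_le0 ?mul0r// mulr_ge0_le0// subr_le0.
Qed.

Lemma boxfun_in a b x : obox a b x -> \forall k \near \oo, boxfun k a b x = 1.
Proof.
move=> xab.
have step1 (r : R) : 0 < r -> \forall k \near \oo, step (k%:R * r) = 1.
  move=> r0; near=> k; apply: step_ge1; rewrite -ler_pdivrMr// mul1r.
  by near: k; exact: nbhs_infty_ger.
have : \forall k \near \oo, forall i : 'I_N,
    step (k%:R * (x 0 i - a 0 i)) * step (k%:R * (b 0 i - x 0 i)) = 1.
  apply: filter_forall => i; have /andP[ai bi] := xab i.
  have s1 := step1 _ (etrans (subr_gt0 _ _) ai).
  have s2 := step1 _ (etrans (subr_gt0 _ _) bi).
  by apply: filterS2 s1 s2 => k -> ->; rewrite mulr1.
by apply: filterS => k kP; rewrite /boxfun big1.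
Unshelve. all: by end_near. Qed.

Lemma Ck_boxfun k m a b : Ck_on [set: 'rV[R]_N] m (boxfun k a b).
Proof.
have aff (c d : R) (i : 'I_N) : Ck_on [set: 'rV[R]_N] m (fun x => step (c * x 0 i + d)).
  apply: (@Ck_affine R 'rV[R]_N R^o (fun x => c * x 0 i + d) (fun u => c * u 0 i) _ _ m step).
  - move=> x; apply: (@continuous_comp _ _ _ (fun x : 'rV[R]_N => x 0 i) (fun r => c * r + d)).
      exact: coord_continuous.
    by apply: cvgD; [apply: cvgM; [exact: cvg_cst|exact: cvg_id]|exact: cvg_cst].
  - by move=> x u h; rewrite !mxE /GRing.scale/=; ring.
  - exact: Ck_step.
rewrite (_ : boxfun k a b = fun x => \prod_(i < N) (step (k%:R * x 0 i + - (k%:R * a 0 i)) *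
    step (- k%:R * x 0 i + k%:R * b 0 i))).
  by apply: Ck_prod => i; apply: CkM; exact: aff.
by apply/funext => x; apply: eq_bigr => i _; congr (step _ * step _); ring.
Qed.

(** One minus the product of the complements acts as a smooth union of the first [n] boxes: it is 1
    as soon as one box function is 1, it is 0 off the boxes, and finitely many boxes keep the
    support bounded. *)
Lemma open_smooth_approx (U : set 'rV[R]_N) : open U ->
  exists psi : nat -> 'rV[R]_N -> R,
    [/\ forall n, smooth_on setT (psi n),
        forall n, exists B : R, forall x, B < `|x| -> psi n x = 0,
        forall n x, 0 <= psi n x <= 1,
        forall n x, ~ U x -> psi n x = 0 &
        forall x, U x -> \forall n \near \oo, psi n x = 1].
Proof.
move=> oU; have [->|/set0P U0] := eqVneq U set0.
  exists (fun _ _ => 0); split => // [n k|n|n x].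
  - exact: Ck_cst.
  - by exists 0.
  - by rewrite lexx ler01.
have [ab Uab] := open_bigcup_obox oU U0.
pose psi n x : R := 1 - \prod_(j < n) (1 - boxfun n (ab j).1 (ab j).2 x).
exists psi; split.
- move=> n k; apply: CkB; first exact: Ck_cst.
  by apply: Ck_prod => j; apply: CkB; [exact: Ck_cst|exact: Ck_boxfun].
- move=> n; exists (\sum_(j < n) (`|(ab j).1| + `|(ab j).2|)) => x xB.
  rewrite /psi big1 ?subrr// => j _; rewrite boxfun_out ?subr0// => xj.
  suff : `|x| <= `|(ab j).1| + `|(ab j).2|.
    apply/negP; rewrite -ltNge; apply: le_lt_trans xB.
    by rewrite (bigD1 j)//= lerDl sumr_ge0.
  rewrite [`|x|]mx_normrE; apply/bigmax_leP; split => [|[i' i] _ /=]; first exact: addr_ge0.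
  rewrite (ord1 i'); have /andP[x1 x2] := xj i.
  have c1 := coord_le_norm (ab j).1 i; have c2 := coord_le_norm (ab j).2 i.
  rewrite ler_norml.
  move: c1 c2; rewrite !ler_norml => /andP[? ?] /andP[? ?].
  have n1 : 0 <= `|(ab j).1| by [].
  have n2 : 0 <= `|(ab j).2| by [].
  by apply/andP; split; lra.
- move=> n x.
  have /andP[h0 h1] : 0 <= \prod_(j < n) (1 - boxfun n (ab j).1 (ab j).2 x) <= 1.
    elim/big_ind: _ => [|u v /andP[u0 u1] /andP[v0 v1]|i _].
    - by rewrite ler01 lexx.
    - by rewrite mulr_ge0//= mulr_ile1.
    - by have /andP[] := boxfun01 n (ab i).1 (ab i).2 x; lra.
  by rewrite /psi; lra.
- move=> n x Ux; rewrite /psi big1 ?subrr// => j _; rewrite boxfun_out ?subr0// => xj.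
  by apply: Ux; rewrite Uab; exists j.
- move=> x; rewrite Uab => -[j _ xj]; near=> n.
  have jn : (j < n)%N by near: n; exact: nbhs_infty_gt.
  rewrite /psi (bigD1 (Ordinal jn))//= (near (boxfun_in xj) n) ?subrr ?mul0r ?subr0//.
Unshelve. all: by end_near. Qed.

End box_approximation.

(** * The measure rho(t, x) dt dx *)

Section spacetime_measure.
Context {R : realType} {N : nat}.
Local Notation T := (borelRn R N).
Local Open Scope ereal_scope.

(** Curves matter on [0, 1] only; clamping the time turns their measurability into a statement on
    the whole line. *)
Definition clamp (t : R) : R := Num.max 0%R (Num.min t 1%R).

Lemma clamp_id t : `[0%R, 1%R]%classic t -> clamp t = t.
Proof. by rewrite /= in_itv/= => /andP[t0 t1]; rewrite /clamp min_l// max_r. Qed.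

Lemma clamp_itv t : `[0%R, 1%R]%classic (clamp t).
Proof. by rewrite /= in_itv/= /clamp le_max lexx ge_max ler01 ge_min lexx orbT. Qed.

Lemma measurable_clamp : measurable_fun setT clamp.
Proof. by apply: measurable_maxr => //; exact: measurable_minr. Qed.

Definition mcurve (rho : R -> probability T R) :=
  measurable_fun setT (fun t => (rho (clamp t) : giry T R)).

(** The value on an open set is a limit of integrals of smooth functions, which are continuous in
    time by narrow continuity. The sets with measurable value form a Dynkin system, whence all Borel
    sets. *)
Lemma narrow_curve_measurable (Omega : set 'rV[R]_N) (rho : R -> probability T R) :
  open Omega -> narrow_curve Omega rho -> mcurve rho.
Proof.
move=> oO nrho; apply: measurable_giry_codensity => //.
suff H A : measurable A -> measurable_fun setT (fun t => rho (clamp t) A) by exact: H.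
have mO : measurable (Omega : set T) by exact: open_measurable_Rn.
rewrite -[measurable A]/(<<s @open 'rV[R]_N >> A); move: A.
apply: dynkin_induction => //.
- by move=> A B; exact: openI.
- rewrite (_ : (fun _ => _) = cst 1); first exact: measurable_cst.
  by apply/funext => t; exact: probability_setT.
- move=> U oU.
  have mU : measurable (U : set T) by exact: open_measurable_Rn.
  have [psi [spsi _ psi01 psi0 psi1]] := open_smooth_approx oU.
  have cpsi n : continuous (psi n) by exact: (Ck_continuous (spsi n 0%N)).
  have mpsi n : measurable_fun setT (psi n : T -> R) by exact: continuous_measurable_Rn.
  pose F n t := \int[rho t]_(x in Omega) (psi n x)%:E.
  have bpsi n x : (`|psi n x| <= 1)%R by have /andP[p0 p1] := psi01 n x; rewrite ger0_norm.
  have ipsi n t : (rho t).-integrable (Omega : set T) (EFin \o psi n).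
    apply: (@integrable_bounded _ _ _ (rho t) (Omega : set T) (psi n) 1%R) => //.
    - exact: prob_lty.
    - exact: measurable_funS (mpsi n).
  have Ffin n t : F n t \is a fin_num by apply: integrable_fin_num => //; exact: ipsi.
  have mF n : measurable_fun setT (fun t => F n (clamp t)).
    apply: (@eq_measurable_fun _ _ _ _ _ (EFin \o (fine \o F n) \o clamp)).
      by move=> t _ /=; rewrite fineK.
    apply/measurable_EFinP.
    rewrite -[X in measurable_fun _ X]/((fine \o F n) \o clamp).
    apply: (@measurable_comp _ _ _ R R R (`[0%R, 1%R]%classic : set R)) => //.
    - by move=> _ [t _ <-]; exact: clamp_itv.
    - apply: subspace_continuous_measurable_fun => //.
      apply/subspace_continuousP => t t01; apply: fine_cvg; rewrite fineK//.
      have [_ /(_ (psi n))] := nrho t t01; apply.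
        by apply: continuous_subspaceT => x; exact: cpsi.
      by exists 1%R => x _; exact: bpsi.
    - exact: measurable_clamp.
  apply: (emeasurable_fun_cvg _ _ mF) => t _.
  have -> : rho (clamp t) U = \int[rho (clamp t)]_(x in Omega) (\1_U x)%:E.
    rewrite integral_indic// measure_setI1//; apply: prob_setC0 => //.
    by have [] := nrho _ (clamp_itv t).
  apply: (@bounded_convergence _ _ _ (rho (clamp t)) (Omega : set T) _ _ 1%R) => //.
  - exact: prob_lty.
  - by move=> n; exact: measurable_funS (mpsi n).
  - move=> x _; apply: cvg_near_cst.
    have [Ux|Ux] := pselect (U x).
      by have := psi1 x Ux; apply: filterS => n ->; rewrite indicE mem_set.
    by apply: nearW => n; rewrite psi0// indicE memNset.
- move=> A mA mrA.
  apply: (@eq_measurable_fun _ _ _ _ _ (fun t => 1 - rho (clamp t) A)).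
    by move=> t _; rewrite probability_setC.
  by apply: emeasurable_funB => //; exact: measurable_cst.
- move=> F mF tF mrF.
  apply: (@eq_measurable_fun _ _ _ _ _ (fun t => \sum_(0 <= k <oo) rho (clamp t) (F k))).
    by move=> t _; rewrite measure_semi_bigcup//; exact: bigcup_measurable.
  exact: ge0_emeasurable_sum.
Qed.

End spacetime_measure.

Section spacetime_integral.
Context {R : realType} {N : nat}.
Local Notation T := (borelRn R N).
Local Open Scope ereal_scope.

Section spacetime_def.
Variable rho : R -> probability T R.
Hypothesis mrho : mcurve rho.

Definition slice (t : R) : giry (R * T)%type R :=
  giry_prod (giry_ret t, (rho (clamp t) : giry T R)).

Lemma measurable_slice : measurable_fun setT slice.
Proof.
apply: (@measurableT_comp _ _ _ _ _ _ (@giry_prod _ _ R T R)); first exact: measurable_giry_prod.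
by apply: measurable_fun_pair; [exact: measurable_giry_ret|exact: mrho].
Qed.

Lemma measurable_slice_lebesgue :
  measurable_fun (setT : set (measurableTypeR R)) slice.
Proof. exact: measurable_slice. Qed.

Definition unif01 : giry (measurableTypeR R) R :=
  (uniform_prob (@ltr01 R) : subprobability (measurableTypeR R) R).

(** The measure rho(t, x) dt dx, as the mean of the slices [Dirac t x rho t] over a uniform time.
    Having a single measure gives additivity and dominated convergence for the iterated integrals of
    the definitions. *)
Definition spacetime : giry (R * T)%type R :=
  giry_bind unif01 measurable_slice_lebesgue.

Lemma giry_int_slice t (h : R * T -> \bar R) : measurable_fun setT h ->
  (forall z, 0 <= h z) -> giry_int (slice t) h = \int[rho (clamp t)]_x h (t, x).
Proof.
move=> mh h0; rewrite /slice giry_int_prod1// giry_int_ret//.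
exact: (@measurable_fun_fubini_tonelli_F _ _ _ _ _ (rho (clamp t))).
Qed.

Lemma measurable_inner (h : R * T -> \bar R) : measurable_fun setT h ->
  (forall z, 0 <= h z) -> measurable_fun setT (fun t => \int[rho (clamp t)]_x h (t, x)).
Proof.
move=> mh h0; rewrite (_ : (fun _ => _) = (fun t => giry_int (slice t) h)).
  apply: (@measurableT_comp _ _ _ _ _ _ (giry_int ^~ h)).
    exact: measurable_giry_int.
  exact: measurable_slice.
by apply/funext => t; rewrite giry_int_slice.
Qed.

Lemma spacetime_ge0 (h : R * T -> \bar R) : measurable_fun setT h ->
  (forall z, 0 <= h z) ->
  \int[spacetime]_z h z =
    \int[lebesgue_measure]_(t in `[0%R, 1%R]) \int[rho (clamp t)]_x h (t, x).
Proof.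
move=> mh h0; rewrite -[LHS]/(giry_int _ _) /spacetime giry_int_bind//.
have E t : giry_int (slice t) h = \int[rho (clamp t)]_x h (t, x) by exact: giry_int_slice.
rewrite [LHS](_ : _ = \int[uniform_prob (@ltr01 R)]_t \int[rho (clamp t)]_x h (t, x)); last first.
  by apply: eq_integral => t _; exact: E.
rewrite integral_uniform ?subr0 ?invr1 ?mul1e//.
- exact: measurable_inner.
- by move=> t; exact: integral_ge0.
Qed.

End spacetime_def.

Section spacetime_Omega.
Variables (Omega : set 'rV[R]_N) (rho : R -> probability T R).
Hypotheses (mO : measurable (Omega : set T)) (mrho : mcurve rho).

Definition cyl : set (R * T) := `[0%R, 1%R]%classic `*` (Omega : set T).

Lemma measurable_cyl : measurable cyl.
Proof. by apply: measurableX. Qed.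

Lemma inner_cyl (h : R * T -> \bar R) t : `[0%R, 1%R]%classic t ->
  \int[rho t]_(x in Omega) h (t, x) = \int[rho (clamp t)]_x (h \_ cyl) (t, x).
Proof.
move=> t01; rewrite clamp_id// [LHS]integral_mkcond; apply: eq_integral => x _.
rewrite !patchE; congr (if _ then _ else _).
by apply/idP/idP; rewrite !inE => // -[].
Qed.

Lemma measurable_inner_cyl (h : R * T -> \bar R) :
  measurable_fun cyl h -> (forall z, cyl z -> 0 <= h z) ->
  measurable_fun (`[0%R, 1%R]%classic : set R) (fun t => \int[rho t]_(x in Omega) h (t, x)).
Proof.
move=> mh h0.
apply: (@eq_measurable_fun _ _ _ _ _ (fun t => \int[rho (clamp t)]_x (h \_ cyl) (t, x))).
  by move=> t /set_mem t01; rewrite inner_cyl.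
apply: measurable_funTS; apply: measurable_inner => //.
  by apply/(measurable_restrictT _ measurable_cyl).
by move=> z; rewrite patchE; case: ifPn => // /set_mem; exact: h0.
Qed.

Lemma spacetime_cyl_ge0 (h : R * T -> \bar R) :
  measurable_fun cyl h -> (forall z, cyl z -> 0 <= h z) ->
  \int[lebesgue_measure]_(t in `[0%R, 1%R]) \int[rho t]_(x in Omega) h (t, x) =
  \int[spacetime mrho]_(z in cyl) h z.
Proof.
move=> mh h0; rewrite [RHS]integral_mkcond spacetime_ge0.
- by apply: eq_integral => t /set_mem t01; rewrite inner_cyl.
- by apply/(measurable_restrictT _ measurable_cyl).
- by move=> z; rewrite patchE; case: ifPn => // /set_mem; exact: h0.
Qed.

(** At each time the inner integral is by definition the difference of its positive and negative
    parts. Only the outer subtraction asks for finiteness, which integrability for the joint measure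
    provides. *)
Lemma spacetime_cyl (h : R * T -> \bar R) :
  (spacetime mrho).-integrable cyl h ->
  \int[lebesgue_measure]_(t in `[0%R, 1%R]) \int[rho t]_(x in Omega) h (t, x) =
  \int[spacetime mrho]_(z in cyl) h z.
Proof.
move=> ih; have mh := measurable_int _ ih.
have mhp : measurable_fun cyl h^\+ by exact: measurable_funepos.
have mhn : measurable_fun cyl h^\- by exact: measurable_funeneg.
have Ep := spacetime_cyl_ge0 mhp (fun z _ => funepos_ge0 _ z).
have En := spacetime_cyl_ge0 mhn (fun z _ => funeneg_ge0 _ z).
rewrite [RHS]integralE -Ep -En.
have Fp := integral_funepos_lt_pinfty measurable_cyl ih.
have Fn := integral_funeneg_lt_pinfty measurable_cyl ih.
rewrite -Ep in Fp; rewrite -En in Fn.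
have ige (g : R * T -> \bar R) : measurable_fun cyl g -> (forall z, 0 <= g z) ->
    \int[lebesgue_measure]_(t in `[0%R, 1%R]) \int[rho t]_(x in Omega) g (t, x) < +oo ->
    lebesgue_measure.-integrable (`[0%R, 1%R]%classic : set R) (fun t => \int[rho t]_(x in Omega) g (t, x)).
  move=> mg g0 gfin; apply/integrableP; split.
    by apply: measurable_inner_cyl => // z _; exact: g0.
  under eq_integral do rewrite gee0_abs ?integral_ge0//.
  by [].
rewrite -integralB//; last 2 first.
- by apply: ige => //; exact: funepos_ge0.
- by apply: ige => //; exact: funeneg_ge0.
apply: eq_integral => t _; rewrite [LHS]integralE.
by congr (_ - _); apply: eq_integral => x _; rewrite ?(funeposE, funenegE).
Qed.

Lemma spacetime_cyl_lty : spacetime mrho cyl < +oo.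
Proof.
apply: (@le_lt_trans _ _ 1); last exact: ltry.
apply: (@le_trans _ _ (spacetime mrho setT)); last exact: sprobability_setT.
by apply: le_measure; rewrite ?inE//; exact: measurable_cyl.
Qed.

End spacetime_Omega.

End spacetime_integral.

(** * Bounds on compact sets and the fundamental theorem of calculus *)

Section compact_bounds.
Context {R : realType} {N : nat}.
Local Notation T := (borelRn R N).
Local Notation V := (R * 'rV[R]_N)%type.

Lemma compact_norm_le (B : R) : compact [set x : 'rV[R]_N | `|x| <= B].
Proof.
apply: bounded_closed_compact.
  by exists B; split; [exact: num_real|move=> M BM x /= xB; apply: le_trans (ltW BM)].
rewrite -[X in closed X]/((fun x : 'rV[R]_N => `|x|) @^-1` [set r | r <= B]).
by apply: closed_comp; [move=> x _; exact: norm_continuous|exact: closed_le].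
Qed.

(** Times up to 2 in absolute value are covered because mean value arguments started in [0, 1] may
    reach any point of [-1, 2]. *)
Lemma continuous_bounded_box (f : V -> R) (B : R) : continuous f ->
  exists2 C, 0 <= C & forall t x, `|t| <= 2 -> `|x| <= B -> `|f (t, x)| <= C.
Proof.
move=> cf.
pose K : set V := `[-2, 2]%classic `*` [set x : 'rV[R]_N | `|x| <= B].
have cK : compact K.
  by apply: compact_setX; [exact: segment_compact|exact: compact_norm_le].
have := compact_bounded (continuous_compact (continuous_subspaceT cf) cK).
move=> [M [_ HM]]; exists (`|M| + 1) => [|t x tM xB]; first by rewrite addr_ge0.
apply: (HM (`|M| + 1)); first by rewrite ltr_pwDr// ler_norm.
by exists (t, x) => //; split => //=; rewrite in_itv/= -ler_norml.
Qed.

Lemma continuous_section (phi : V -> R) t : continuous phi ->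
  continuous (fun x => phi (t, x)).
Proof.
move=> cphi x; apply: (@continuous_comp _ _ _ (fun x => (t, x)) phi); last exact: cphi.
move=> A [[P Q] /= [Pt Qx] PQA].
by apply: filterS Qx => y Qy; apply: PQA; split => //; exact: nbhs_singleton.
Qed.

Lemma FTC2_derive (F f : R -> R) (a b : R) : a < b ->
  (forall x : R, is_derive x 1 F (f x)) -> continuous f ->
  (\int[lebesgue_measure]_(x in `[a, b]) (f x)%:E = (F b - F a)%:E)%E.
Proof.
move=> ab dF cf; have cF : continuous F by move=> x; exact: is_derive_continuous.
rewrite (continuous_FTC2 ab (continuous_subspaceT cf) (F := F)) ?EFinB//.
- split.
  + by move=> x _; exact: ex_derive.
  + by apply: cvg_at_right_filter; exact: cF.
  + by apply: cvg_at_left_filter; exact: cF.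
- by move=> x _; rewrite derive1E derive_val.
Qed.

Lemma bounded_set_le (A : set 'rV[R]_N) : bounded_set A ->
  exists B, forall x, A x -> `|x| <= B.
Proof.
move=> [M [_ HM]]; exists (`|M| + 1) => x Ax.
by apply: (HM (`|M| + 1)) => //; rewrite ltr_pwDr// ler_norm.
Qed.

End compact_bounds.

(** * Endpoints of solutions of the continuity equation *)

Section step_derivative.
Context {R : realType}.

Definition dstep (x : R) : R := 'D_1 (step : R^o -> R) x.

Lemma is_derive_step (x : R) : is_derive x 1 step (dstep x).
Proof. by have := Ck_is_derive (x : R^o) 1 (Ck_step 1). Qed.

Lemma continuous_dstep : continuous dstep.
Proof. exact: (Ck_continuous (Ck_derive (1 : R^o) (Ck_step 1))). Qed.

(** This sign makes the derivatives of ramps densities that concentrate at the endpoints of [0, 1].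
    In the quotient rule the products [f x * f' x] cancel, and the two remaining terms are
    nonnegative. *)
Lemma dstep_ge0 x : 0 <= dstep x.
Proof.
pose f := flat (1 : {poly R}); pose df := flat (flat_next (1 : {poly R})).
have df0 y : 0 <= df y.
  rewrite /df /flat /flat_next; case: ifPn => // y0.
  by rewrite derivC subr0 mulr1 hornerXn mulr_ge0 ?expR_ge0// exprn_ge0// invr_ge0 ltW.
have dg : is_derive x 1 (fun y => f (1 - y)) (- df (1 - x)).
  have d1 : is_derive x 1 (fun y : R => 1 - y) (-1).
    by rewrite -[X in is_derive _ _ _ X]sub0r; apply: is_deriveB.
  rewrite -mulN1r mulrC.
  exact: (@is_derive1_comp R f (fun y => 1 - y) x (df (1 - x)) (-1) (is_derive_flat _ _) d1).
have df' : is_derive x 1 f (df x) by exact: is_derive_flat.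
have dD := is_deriveD df' dg.
have D0 := step_den_gt0 x.
have dV : is_derive x 1 (fun y => (f y + f (1 - y))^-1)
    (- (f x + f (1 - x)) ^- 2 *: (df x + - df (1 - x))).
  by apply: is_deriveV => //; rewrite gt_eqF.
have := is_deriveM df' dV => /(@derive_val _ _ _ _ _ _ _).
have := is_derive_step x => /(@derive_val _ _ _ _ _ _ _) <-.
rewrite -[step in 'D_1 step x]/(f * (fun y => (f y + f (1 - y))^-1)) => ->.
rewrite /GRing.scale/= -/f.
have f0 : 0 <= f x by exact: flat1_ge0.
have g0 : 0 <= f (1 - x) by exact: flat1_ge0.
rewrite (_ : _ + _ = (df x * f (1 - x) + f x * df (1 - x)) * (f x + f (1 - x)) ^- 2).
  by rewrite mulr_ge0 ?addr_ge0 ?mulr_ge0// invr_ge0 sqr_ge0.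
by field; rewrite gt_eqF.
Qed.

End step_derivative.

Section tgrad.
Context {R : realType} {N : nat}.
Local Notation T := (borelRn R N).
Local Notation V := (R * 'rV[R]_N)%type.
Implicit Types (phi : V -> R) (v : V -> 'rV[R]_N).

(** The derivative of [phi] along the field, that is, the integrand of the continuity equation. *)
Definition tgrad phi v (z : V) : R :=
  'D_((1, 0) : V) phi z + \sum_(i < N) v z 0 i * 'D_((0, delta_mx 0 i) : V) phi z.

(** Weaker than the support condition of [test_function]: such functions may be nonzero at the times
    0 and 1. *)
Definition xcompact phi := exists B, forall t x, B < `|x| -> phi (t, x) = 0.

Lemma C1_box_bounds phi (B : R) : Ck_on setT 1 phi ->
  exists2 C, 0 <= C & forall t x, `|t| <= 2 -> `|x| <= B ->
    [/\ `|phi (t, x)| <= C, `|'D_((1, 0) : V) phi (t, x)| <= C &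
        forall i, `|'D_((0, delta_mx 0 i) : V) phi (t, x)| <= C].
Proof.
move=> C1; have [C0 C00 H0] := continuous_bounded_box B (Ck_continuous C1).
have [C1' C10 H1] := continuous_bounded_box B (Ck_continuous (Ck_derive ((1, 0) : V) C1)).
have : forall i, exists C, 0 <= C /\ forall t x, `|t| <= 2 -> `|x| <= B ->
    `|'D_((0, delta_mx 0 i) : V) phi (t, x)| <= C.
  move=> i; have [C ? ?] := continuous_bounded_box B (Ck_continuous (Ck_derive ((0, delta_mx 0 i) : V) C1)).
  by exists C.
move=> /choice[C /all_and2[Ci0 HC]].
exists (C0 + C1' + \sum_i C i) => [|t x t2 xB]; first by rewrite !addr_ge0// sumr_ge0.
have S0 : 0 <= \sum_i C i by rewrite sumr_ge0.
split.
- by apply: (le_trans (H0 _ _ t2 xB)); rewrite -addrA lerDl addr_ge0.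
- by apply: (le_trans (H1 _ _ t2 xB)); rewrite addrAC lerDr addr_ge0.
- move=> i; apply: (le_trans (HC i _ _ t2 xB)).
  rewrite (bigD1 i)//= addrCA lerDl addr_ge0 ?addr_ge0//.
  by rewrite sumr_ge0.
Qed.

Lemma tgrad_bound phi v (C : R) t x : 0 <= C ->
  `|'D_((1, 0) : V) phi (t, x)| <= C ->
  (forall i, `|'D_((0, delta_mx 0 i) : V) phi (t, x)| <= C) ->
  `|tgrad phi v (t, x)| <= C * (1 + N%:R * enorm (v (t, x))).
Proof.
move=> C0 H1 H2; rewrite /tgrad; apply: (le_trans (ler_normD _ _)).
rewrite mulrDr mulr1 lerD//; apply: (le_trans (ler_norm_sum _ _ _)).
have -> : C * (N%:R * enorm (v (t, x))) = \sum_(i < N) C * enorm (v (t, x)).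
  by rewrite sumr_const card_ord -[RHS]mulr_natl mulrCA.
apply: ler_sum => i _; rewrite normrM mulrC; apply: ler_pM.
- exact: normr_ge0.
- exact: normr_ge0.
- exact: H2.
- exact: coord_le_enorm.
Qed.

Lemma measurable_tgrad (D : set (R * T)) phi v : measurable D -> Ck_on setT 1 phi ->
  measurable_fun D (v : R * T -> T) -> measurable_fun D (tgrad phi v : R * T -> R).
Proof.
move=> mD C1 mv.
have mder (u : V) : measurable_fun D ((fun z => 'D_u phi z) : R * T -> R).
  apply: measurable_funTS; apply: continuous_measurable_spacetime.
  exact: (Ck_continuous (Ck_derive u C1)).
apply: measurable_funD; first exact: mder.
apply: measurable_sum => i; apply: measurable_funM; last exact: mder.
apply: (measurableT_comp (measurable_coord i)); exact: mv.
Qed.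

Lemma measurable_enorm_comp d (X : measurableType d) (D : set X) (w : X -> T) :
  measurable_fun D w -> measurable_fun D (fun z => enorm (w z)).
Proof.
move=> mw; apply: (measurableT_comp (f := @enorm R N : T -> R)) => //.
by apply: continuous_measurable_Rn; exact: continuous_enorm.
Qed.

End tgrad.

(** * Averages against concentrating densities *)

Section delta_limits.
Context {R : realType}.
Local Open Scope ereal_scope.

(** The density [w] comes with a primitive [W], from which its total mass 1 is read off. *)
Lemma bump_average (w W F : R -> R) (c e a b : R) :
  (forall t : R, is_derive t (1%R : R) W (w t)) -> continuous w ->
  (forall t, 0 <= w t)%R -> (W 0 = 0)%R -> (W 1 = 1)%R ->
  (forall t, w t != 0 -> a <= t <= b)%R ->
  (forall t, `[0%R, 1%R]%classic t -> a <= t <= b -> `|F t - c| <= e)%R ->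
  lebesgue_measure.-integrable (`[0%R, 1%R]%classic : set R) (EFin \o (fun t => w t * F t)%R) ->
  `| \int[lebesgue_measure]_(t in `[0%R, 1%R]) (w t * F t)%:E - c%:E | <= e%:E.
Proof.
move=> dW cw w0 W0 W1 wab Fc iwF.
have intw : \int[lebesgue_measure]_(t in `[0%R, 1%R]) (w t)%:E = 1.
  by rewrite (FTC2_derive ltr01 dW cw) W0 W1 subr0.
have mw : measurable_fun (`[0%R, 1%R]%classic : set R) w.
  by apply: measurable_funTS; exact: continuous_measurable_fun.
have iw : lebesgue_measure.-integrable (`[0%R, 1%R]%classic : set R) (EFin \o w).
  apply/integrableP; split; first exact/measurable_EFinP.
  apply: (@le_lt_trans _ _ 1); last exact: ltry.
  rewrite -intw le_eqVlt; apply/orP; left; apply/eqP.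
  by apply: eq_integral => t _ /=; rewrite ger0_norm.
have iwc (k : R) : lebesgue_measure.-integrable (`[0%R, 1%R]%classic : set R) (EFin \o (fun t => w t * k)%R).
  rewrite (_ : EFin \o _ = (fun t => (EFin \o w) t * k%:E)); first exact: integrableZr.
  by apply/funext => t /=; rewrite EFinM.
have intwk (k : R) : \int[lebesgue_measure]_(t in `[0%R, 1%R]) (w t * k)%:E = k%:E.
  under eq_integral do rewrite EFinM.
  by rewrite integralZr//= intw mul1e.
rewrite -[X in _ - X]intwk -integralB_EFin//.
apply: (@le_trans _ _ (\int[lebesgue_measure]_(t in `[0%R, 1%R]) `|((w t * F t)%:E - (w t * c)%:E)|)).
  apply: le_abse_integral => //; apply/measurable_EFinP.
  by apply: measurable_funB; apply/measurable_EFinP; [exact: measurable_int iwF|exact: measurable_int (iwc c)].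
rewrite -[leRHS]intwk; apply: ge0_le_integral => //.
- apply: measurableT_comp => //; apply: emeasurable_funB; [exact: measurable_int iwF|exact: measurable_int (iwc c)].
- exact: measurable_int (iwc e).
- move=> t t01; rewrite -EFinB abse_EFin lee_fin -mulrBr normrM ger0_norm//.
  have [->|wt] := eqVneq (w t) 0%R; first by rewrite !mul0r.
  by rewrite ler_wpM2l// Fc//; exact: wab.
Qed.

End delta_limits.

(** * Cutoffs in time *)

Section cutoff.
Context {R : realType}.
Implicit Types (k : nat) (t : R).

(** [ramp_up k] rises on [1/k, 2/k] and [ramp_dn k] on [1 - 2/k, 1 - 1/k]. For k > 3 these intervals
    are disjoint, and the difference of the ramps is a plateau supported inside ]0, 1[. *)
Definition ramp_up k t : R := step (k%:R * t - 1).
Definition ramp_dn k t : R := step (k%:R * t - k%:R + 2).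
Definition cutoff k t : R := ramp_up k t - ramp_dn k t.
Definition dramp_up k t : R := k%:R * dstep (k%:R * t - 1).
Definition dramp_dn k t : R := k%:R * dstep (k%:R * t - k%:R + 2).
Definition dcutoff k t : R := dramp_up k t - dramp_dn k t.

Lemma is_derive_step_affine (a b t : R) :
  is_derive t 1 (fun t => step (a * t + b)) (a * dstep (a * t + b)).
Proof.
have d1 : is_derive t 1 (fun y : R => a * y + b) a.
  rewrite -[X in is_derive _ _ _ X]addr0; apply: is_deriveD.
  rewrite -[X in is_derive _ _ _ X]mulr1.
  exact: (@is_deriveZ R R^o R^o id a t 1 1).
rewrite mulrC.
exact: (@is_derive1_comp R step (fun y => a * y + b) t _ a (is_derive_step _) d1).
Qed.

Lemma is_derive_ramp_up k t : is_derive t 1 (ramp_up k) (dramp_up k t).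
Proof. exact: is_derive_step_affine. Qed.

Lemma is_derive_ramp_dn k t : is_derive t 1 (ramp_dn k) (dramp_dn k t).
Proof.
rewrite /ramp_dn (_ : dramp_dn k t = k%:R * dstep (k%:R * t + (- k%:R + 2))); last first.
  by rewrite /dramp_dn -addrA.
rewrite (_ : (fun t => _) = (fun t => step (k%:R * t + (- k%:R + 2)))).
  exact: is_derive_step_affine.
by apply/funext => s; rewrite -addrA.
Qed.

Lemma is_derive_cutoff k t : is_derive t 1 (cutoff k) (dcutoff k t).
Proof. exact: (is_deriveB (is_derive_ramp_up _ _) (is_derive_ramp_dn _ _)). Qed.

Lemma continuous_dstep_affine (a b : R) : continuous (fun t => a * dstep (a * t + b)).
Proof.
move=> t; apply: cvgM; first exact: cvg_cst.
apply: (@continuous_comp _ _ _ (fun t => a * t + b) dstep); last exact: continuous_dstep.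
by apply: cvgD; [apply: cvgM; [exact: cvg_cst|exact: cvg_id]|exact: cvg_cst].
Qed.

Lemma continuous_dramp_up k : continuous (dramp_up k).
Proof. exact: continuous_dstep_affine. Qed.

Lemma continuous_dramp_dn k : continuous (dramp_dn k).
Proof.
rewrite (_ : dramp_dn k = (fun t => k%:R * dstep (k%:R * t + (- k%:R + 2)))).
  exact: continuous_dstep_affine.
by apply/funext => s; rewrite /dramp_dn -addrA.
Qed.

Lemma dstep_supp (x : R) : dstep x != 0 -> 0 <= x <= 1.
Proof.
move=> H; apply/andP; split; rewrite leNgt; apply: contra_neqN H => x0.
  rewrite /dstep (@near_eq_derive _ _ _ _ (fun=> 0 : R)) ?derive_cst//.
  near=> y; apply: step_le0; apply: ltW; near: y; exact: lt_nbhsl.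
rewrite /dstep (@near_eq_derive _ _ _ _ (fun=> 1 : R)) ?derive_cst//.
near=> y; apply: step_ge1; apply: ltW; near: y; exact: lt_nbhsr.
Unshelve. all: by end_near. Qed.

Lemma dramp_up_supp k t : (0 < k)%N -> dramp_up k t != 0 -> k%:R^-1 <= t <= 2 / k%:R.
Proof.
move=> k0; rewrite mulf_eq0 negb_or => /andP[_ /dstep_supp/andP[h1 h2]].
have K0 : 0 < k%:R :> R by rewrite ltr0n.
apply/andP; split; [rewrite -div1r ler_pdivrMr//|rewrite ler_pdivlMr//]; rewrite mulrC; lra.
Qed.

Lemma dramp_dn_supp k t : (0 < k)%N -> dramp_dn k t != 0 ->
  1 - 2 / k%:R <= t <= 1 - k%:R^-1.
Proof.
move=> k0; rewrite mulf_eq0 negb_or => /andP[_ /dstep_supp/andP[h1 h2]].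
have K0 : 0 < k%:R :> R by rewrite ltr0n.
rewrite -(ler_pM2l K0) -[X in _ && X](ler_pM2l K0) !mulrBr mulr1 mulrCA divff ?gt_eqF//.
by rewrite mulr1; lra.
Qed.

Lemma cutoff_out k t : (3 < k)%N -> (t < k%:R^-1) || (1 - k%:R^-1 < t) -> cutoff k t = 0.
Proof.
move=> k3; have K0 : 0 < k%:R :> R by rewrite ltr0n (ltn_trans _ k3).
have K3 : 3 < k%:R :> R by rewrite ltr_nat.
rewrite /cutoff /ramp_up /ramp_dn -(ltr_pM2l K0) -[X in _ || X](ltr_pM2l K0) mulrBr mulr1.
rewrite divff ?gt_eqF// => /orP[h|h].
  by rewrite !step_le0 ?subrr//; lra.
by rewrite !step_ge1 ?subrr//; lra.
Qed.

Lemma cutoff_bound k t : `|cutoff k t| <= 1.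
Proof.
rewrite /cutoff /ramp_up /ramp_dn.
have := step_ge0 (k%:R * t - 1); have := step_le1 (k%:R * t - 1).
have := step_ge0 (k%:R * t - k%:R + 2); have := step_le1 (k%:R * t - k%:R + 2).
by rewrite ler_norml; lra.
Qed.

Lemma cutoff_cvg t : 0 < t < 1 -> cutoff k t @[k --> \oo] --> (1 : R).
Proof.
move=> /andP[t0 t1]; apply: cvg_near_cst; near=> k.
have h1 : 2 / t <= k%:R by near: k; exact: nbhs_infty_ger.
have h2 : 2 / (1 - t) <= k%:R by near: k; exact: nbhs_infty_ger.
rewrite /cutoff /ramp_up /ramp_dn.
rewrite ler_pdivrMr// in h1.
rewrite ler_pdivrMr ?subr_gt0// in h2.
by rewrite step_ge1 ?step_le0 ?subr0//; lra.
Unshelve. all: by end_near. Qed.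

Lemma Ck_step_affine m (a b : R) : Ck_on [set: R^o] m (fun t => step (a * t + b)).
Proof.
apply: (@Ck_affine R R^o R^o (fun t => a * t + b) (fun u => a * u) _ _ m step).
- by move=> x; apply: cvgD; [apply: cvgM; [exact: cvg_cst|exact: cvg_id]|exact: cvg_cst].
- by move=> x u h; rewrite /GRing.scale/=; ring.
- exact: Ck_step.
Qed.

Lemma Ck_cutoff m k : Ck_on [set: R^o] m (cutoff k).
Proof.
apply: CkB; first exact: Ck_step_affine.
rewrite (_ : ramp_dn k = (fun t => step (k%:R * t + (- k%:R + 2)))).
  exact: Ck_step_affine.
by apply/funext => t; rewrite /ramp_dn -addrA.
Qed.

End cutoff.

(** * The continuity equation with boundary terms in time *)

Section boundary_terms.
Context {R : realType} {N : nat}.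
Local Notation T := (borelRn R N).
Local Notation V := (R * 'rV[R]_N)%type.
Variables (Omega : set 'rV[R]_N) (rho : R -> probability T R) (B : R).
Hypotheses (oO : open Omega) (OB : forall x, Omega x -> `|x| <= B).
Hypothesis nrho : narrow_curve Omega rho.
Local Open Scope ereal_scope.

Let mO : measurable (Omega : set T). Proof. exact: open_measurable_Rn. Qed.
Local Notation mrho := (narrow_curve_measurable oO nrho).
Local Notation M := (spacetime mrho).
Local Notation cylO := (@cyl R N Omega).

Lemma cyl_bounds z : cylO z -> (`|z.1| <= 2)%R /\ (`|z.2| <= B)%R.
Proof.
move=> [/=]; rewrite in_itv/= => /andP[t0 t1] /OB zB; split => //.
by rewrite ger0_norm//; apply: (le_trans t1); rewrite ler1n.
Qed.

Section field.
Variable v : V -> 'rV[R]_N.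
Hypothesis mv : measurable_fun (`[0%R, 1%R]%classic `*` setT : set (R * T)) (v : R * T -> T).
Hypothesis fv : \int[lebesgue_measure]_(t in `[0%R, 1%R])
  \int[rho t]_(x in Omega) (enorm (v (t, x)))%:E < +oo.

Lemma measurable_field_cyl : measurable_fun cylO (v : R * T -> T).
Proof.
apply: measurable_funS mv; first exact: measurableX.
by move=> z [].
Qed.

Lemma integrable_enorm : M.-integrable cylO (fun z => (enorm (v z))%:E).
Proof.
have me : measurable_fun cylO (fun z => (enorm (v z))%:E).
  by apply/measurable_EFinP; apply: measurable_enorm_comp; exact: measurable_field_cyl.
apply/integrableP; split => //.
under eq_integral do rewrite abse_EFin ger0_norm ?enorm_ge0//.
rewrite -spacetime_cyl_ge0// => z _; rewrite lee_fin; exact: enorm_ge0.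
Qed.

Lemma integrable_tgrad phi : Ck_on setT 1 phi ->
  M.-integrable cylO (fun z => (tgrad phi v z)%:E).
Proof.
move=> C1; have [C C0 HC] := C1_box_bounds B C1.
apply: (@le_integrable _ _ _ M cylO _ _
  (fun z => (C%:E * (cst 1 z + N%:R%:E * (enorm (v z))%:E)))).
- exact: measurable_cyl.
- apply/measurable_EFinP; apply: measurable_tgrad => //; first exact: measurable_cyl.
  exact: measurable_field_cyl.
- move=> [t x] /cyl_bounds[/= t2 xB]; have [_ h1 h2] := HC t x t2 xB.
  rewrite lee_fin.
  apply: (le_trans (tgrad_bound v C0 h1 h2)); exact: ler_norm.
- apply: integrableZl; first exact: measurable_cyl.
  apply: integrableD; first exact: measurable_cyl.
    apply: (@integrable_bounded _ _ _ M cylO (fun=> 1%R) 1%R) => //.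
    + exact: measurable_cyl.
    + exact: spacetime_cyl_lty.
    + by move=> *; rewrite normr1.
  apply: integrableZl; first exact: measurable_cyl.
  exact: integrable_enorm.
Qed.

Lemma tgrad_time_mul (eta deta : R -> R) phi z :
  (forall m, Ck_on [set: R^o] m (eta : R^o -> R)) ->
  (forall t : R, is_derive t (1%R : R) eta (deta t)) ->
  Ck_on setT 1 phi ->
  tgrad (fun z => eta z.1 * phi z)%R v z = (deta z.1 * phi z + eta z.1 * tgrad phi v z)%R.
Proof.
move=> Ceta deta_ C1.
have AE (x u : V) (h : R) : fst (h *: u + x)%R = (h *: (u.1 : R^o) + x.1)%R by [].
have deta1 (u : V) : is_derive z u (eta \o fst) (u.1 * deta z.1)%R.
  have D1 : is_derive (z.1 : R^o) (u.1 : R^o) (eta : R^o -> R) (u.1 * deta z.1)%R.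
    exact: is_derive_dir.
  have := @is_derive_affine R V R^o fst fst AE eta z u (@ex_derive _ _ _ _ _ _ _ D1).
  by rewrite (@derive_val _ _ _ _ _ _ _ D1).
have dphi (u : V) : is_derive z u phi ('D_u phi z) by exact: Ck_is_derive C1.
have dprod (u : V) : 'D_u (fun z => eta z.1 * phi z)%R z = (eta z.1 * 'D_u phi z + phi z * (u.1 * deta z.1))%R.
  exact: (@derive_val _ _ _ _ _ _ _ (is_deriveM (deta1 u) (dphi u))).
have S : (\sum_(i < N) v z 0 i * 'D_((0, delta_mx 0 i) : V) (fun z => eta z.1 * phi z) z =
    eta z.1 * \sum_(i < N) v z 0 i * 'D_((0, delta_mx 0 i) : V) phi z)%R.
  by rewrite mulr_sumr; apply: eq_bigr => i _; rewrite dprod /= mul0r mulr0 addr0 mulrCA.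
rewrite /tgrad S dprod /= mul1r; ring.
Qed.

End field.

Lemma fin_inner (phi : V -> R) t : continuous phi -> `[0%R, 1%R]%classic t ->
  (rho t).-integrable (Omega : set T) (fun x => (phi (t, x))%:E).
Proof.
move=> cphi t01; have [C C0 HC] := continuous_bounded_box B cphi.
apply: (@integrable_bounded _ _ _ (rho t) (Omega : set T) (fun x => phi (t, x)) C) => //.
- exact: prob_lty.
- apply: measurable_funTS; apply: continuous_measurable_Rn.
  exact: continuous_section.
- move=> x Ox; have [|t2 xB] := @cyl_bounds (t, x); first by split.
  exact: HC.
Qed.

Definition timefun (phi : V -> R) (t : R) : R :=
  fine (\int[rho t]_(x in Omega) (phi (t, x))%:E).

Lemma timefunE phi t : continuous phi -> `[0%R, 1%R]%classic t ->
  (timefun phi t)%:E = \int[rho t]_(x in Omega) (phi (t, x))%:E.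
Proof.
by move=> cphi t01; rewrite fineK//; apply: integrable_fin_num => //; exact: fin_inner.
Qed.

(** Measure and integrand both move. With the integrand frozen at [t0], narrow continuity applies;
    the error is at most [C * |t - t0|], because the masses are 1 and [phi] is Lipschitz in time
    uniformly over the bounded set [Omega]. *)
Lemma timefun_continuous phi : Ck_on setT 1 phi ->
  {within `[0%R, 1%R]%classic, continuous (timefun phi)}.
Proof.
move=> C1; have cphi := Ck_continuous C1.
have [C C0 HC] := C1_box_bounds B C1.
have lip t t0 x : `[0%R, 1%R]%classic t -> `[0%R, 1%R]%classic t0 -> Omega x ->
    (`|phi (t, x) - phi (t0, x)| <= C * `|t - t0|)%R.
  move=> t01 t001 Ox; have [xi xile] := line_MVT C1 (t0, x) (1%R, 0%R) (t - t0)%R.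
  rewrite (_ : ((t0, x) + (t - t0) *: (1, 0))%R = (t, x) :> V); last first.
    congr (_, _); first by rewrite /= /GRing.scale/= mulr1 addrC subrK.
    by rewrite /= scaler0 addr0.
  rewrite (_ : ((t0, x) + xi *: (1, 0))%R = ((t0 + xi)%R, x) :> V); last first.
    congr (_, _); first by rewrite /= /GRing.scale/= mulr1.
    by rewrite /= scaler0 addr0.
  move=> ->; rewrite normrM mulrC ler_wpM2r//.
  have xB := OB Ox.
  move: t01 t001; rewrite /= !in_itv/= => /andP[? ?] /andP[? ?].
  have xi1 : (`|xi| <= 1)%R by apply: (le_trans xile); rewrite ler_norml; lra.
  have t2 : (`|t0 + xi| <= 2)%R.
    by apply: (le_trans (ler_normD _ _)); rewrite (ger0_norm (x := t0))//; lra.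
  by have [_ ? _] := HC _ _ t2 xB.
apply/subspace_continuousP => t0 t001.
have [_ nc] := nrho t001.
have c0 : {within Omega, continuous (fun x => phi (t0, x))}.
  apply: continuous_subspaceT.
  exact: continuous_section.
have b0 : exists M0 : R, forall x, Omega x -> (`|phi (t0, x)| <= M0)%R.
  exists C => x Ox; have [|t2 xB] := @cyl_bounds (t0, x); first by split.
  by have [] := HC _ _ t2 xB.
have mphi t : measurable_fun (Omega : set T) (fun x => phi (t, x)).
  apply: measurable_funTS; apply: continuous_measurable_Rn.
  exact: continuous_section.
have i0 t : (rho t).-integrable (Omega : set T) (fun x => (phi (t0, x))%:E).
  apply: (@integrable_bounded _ _ _ (rho t) (Omega : set T) (fun x => phi (t0, x)) C) => //.
    exact: prob_lty.
  move=> x Ox; have [|t2 xB] := @cyl_bounds (t0, x); first by split.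
  by have [] := HC _ _ t2 xB.
have {}nc := nc _ c0 b0.
pose G t := fine (\int[rho t]_(x in Omega) (phi (t0, x))%:E).
have cG : G t @[t --> within `[0%R, 1%R]%classic (nbhs t0)] --> timefun phi t0.
  by apply: fine_cvg; rewrite timefunE.
apply/cvgrPdist_le => /= e e0.
move/cvgrPdist_le : cG => /(_ (e / 2)%R); rewrite divr_gt0// => /(_ isT) cG.
have near1 : \forall t \near within `[0%R, 1%R]%classic (nbhs t0), (C * `|t - t0| <= e / 2)%R.
  apply: cvg_within; near=> t.
  have : (`|t0 - t| <= e / 2 / (C + 1))%R.
    by near: t; apply: cvgr_dist_le; rewrite ?divr_gt0// ltr_wpDl.
  rewrite ler_pdivlMr ?ltr_wpDl// distrC => h; apply: le_trans h.
  by rewrite mulrC ler_wpM2l// lerDl.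
have near2 : \forall t \near within `[0%R, 1%R]%classic (nbhs t0), `[0%R, 1%R]%classic t.
  exact: withinT.
near=> t.
have t01 : `[0%R, 1%R]%classic t by near: t.
have h1 : (`|timefun phi t0 - G t| <= e / 2)%R by near: t.
have h2 : (C * `|t - t0| <= e / 2)%R by near: t.
suff h3 : (`|G t - timefun phi t| <= e / 2)%R.
  rewrite -[X in (`|X|)%R]/(timefun phi t0 - timefun phi t)%R.
  by apply: (le_trans (ler_distD (G t) _ _)); lra.
apply: le_trans h2.
have it : (rho t).-integrable (Omega : set T) (fun x => (phi (t, x))%:E) by exact: fin_inner.
rewrite -lee_fin -abse_EFin EFinB timefunE// /G fineK; last by apply: integrable_fin_num => //; exact: i0.
rewrite -integralB_EFin//; last exact: i0.
apply: (@le_trans _ _ (\int[rho t]_(x in Omega) `|(phi (t0, x))%:E - (phi (t, x))%:E|)).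
  by apply: le_abse_integral => //; apply: emeasurable_funB; exact/measurable_EFinP.
apply: (@le_trans _ _ (\int[rho t]_(x in Omega) (C * `|t - t0|)%:E)).
  apply: ge0_le_integral => //.
  - by apply: measurableT_comp => //; apply: emeasurable_funB; exact/measurable_EFinP.
  - by move=> x Ox; rewrite -EFinB abse_EFin lee_fin distrC lip.
rewrite integral_cst// [X in _ * X](nrho t01).1.
by rewrite mule1.
Unshelve. all: by end_near. Qed.

Lemma spacetime_time_null (Z : set R) : measurable Z -> lebesgue_measure Z = 0 ->
  M (Z `*` setT : set (R * T)) = 0.
Proof.
move=> mZ Z0; have mZT : measurable (Z `*` setT : set (R * T)) by exact: measurableX.
rewrite -[X in M X]setIT -integral_indic// spacetime_ge0//; last first.
- by apply/measurable_EFinP; exact: measurable_indic.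
rewrite (_ : (fun _ => _) = (fun t => (\1_Z t)%:E)); last first.
  apply/funext => t; rewrite (_ : (fun _ => _) = cst (\1_Z t)%:E).
    by rewrite integral_cst// [X in _ * X]probability_setT mule1.
  apply/funext => x; rewrite !indicE; congr ((nat_of_bool _)%:R%:E).
  by apply/idP/idP; rewrite !inE => //= -[].
rewrite integral_indic//; apply/eqP; rewrite eq_le measure_ge0 andbT.
by rewrite -Z0 le_measure// ?inE//; exact: measurableI.
Qed.

Lemma cvg_natV0 : (k%:R^-1 @[k --> \oo] --> (0 : R))%R.
Proof.
apply/cvgrPdist_le => e e0; near=> k; rewrite sub0r normrN ger0_norm ?invr_ge0//.
have ek : (e^-1 <= k%:R)%R by near: k; exact: nbhs_infty_ger.
have k0 : (0 < k%:R :> R)%R by apply: lt_le_trans ek; rewrite invr_gt0.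
by rewrite -[e]invrK lef_pV2 ?posrE ?invr_gt0.
Unshelve. all: by end_near. Qed.

Section formula.
Variable v : V -> 'rV[R]_N.
Hypothesis mv : measurable_fun (`[0%R, 1%R]%classic `*` setT : set (R * T)) (v : R * T -> T).
Hypothesis fv : \int[lebesgue_measure]_(t in `[0%R, 1%R])
  \int[rho t]_(x in Omega) (enorm (v (t, x)))%:E < +oo.
Hypothesis cev : forall phi, test_function phi ->
  \int[lebesgue_measure]_(t in `[0%R, 1%R]) \int[rho t]_(x in Omega) (tgrad phi v (t, x))%:E = 0.

Lemma test_cutoff k phi : (3 < k)%N -> smooth_on setT phi -> xcompact phi ->
  test_function (fun z : V => cutoff k z.1 * phi z)%R.
Proof.
move=> k3 sphi [b phib]; split.
  move=> m; apply: CkM; last exact: sphi.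
  apply: (@Ck_affine R V R^o fst fst _ _ m (cutoff k : R^o -> R)) => //.
  - by move=> z; exact: cvg_fst.
  - exact: Ck_cutoff.
have K0 : (0 < k%:R :> R)%R by rewrite ltr0n (ltn_trans _ k3).
exists (`[(k%:R^-1)%R, (1 - k%:R^-1)%R]%classic `*` [set x : 'rV[R]_N | (`|x| <= b)%R]).
split.
- by apply: compact_setX; [exact: segment_compact|exact: compact_norm_le].
- move=> [t x] [/= + _]; rewrite !in_itv/= => /andP[t0 t1]; split => //.
  have i0 : (0 < k%:R^-1 :> R)%R by rewrite invr_gt0.
  by rewrite (lt_le_trans i0 t0)/= (le_lt_trans t1)// gtrBl.
- move=> [t x] /= nK; have [bx|xb] := ltP b `|x|%R; first by rewrite phib ?mulr0.
  rewrite cutoff_out ?mul0r//; apply: contra_notT nK; rewrite negb_or -!leNgt => /andP[h1 h2].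
  by split => //=; rewrite in_itv/= h1 h2.
Qed.

Lemma timefun_weighted (w : R -> R) phi : continuous w -> Ck_on setT 1 phi ->
  lebesgue_measure.-integrable (`[0%R, 1%R]%classic : set R) (EFin \o (fun t => w t * timefun phi t)%R) /\
  \int[M]_(z in cylO) (w z.1 * phi z)%:E =
  \int[lebesgue_measure]_(t in `[0%R, 1%R]) (w t * timefun phi t)%:E.
Proof.
move=> cw C1; have cphi := Ck_continuous C1.
have cF := timefun_continuous C1.
split.
  apply: continuous_compact_integrable; first exact: segment_compact.
  move=> t; apply: (@cvgM _ _ (nbhs (t : subspace _))); last exact: cF.
  have cw' : {within `[0%R, 1%R]%classic, continuous w} by exact: continuous_subspaceT.
  exact: cw'.
have cwp : continuous (fun z : V => w z.1 * phi z)%R.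
  move=> z; apply: cvgM; last exact: cphi.
  by apply: continuous_comp; [exact: cvg_fst|exact: cw].
rewrite -spacetime_cyl//.
  apply: eq_integral => t /set_mem t01; rewrite EFinM timefunE//.
  rewrite -integralZl//; last exact: fin_inner.
have [C C0 HC] := continuous_bounded_box B cwp.
apply: (@integrable_bounded _ _ _ M cylO (fun z => w z.1 * phi z)%R C) => //.
- exact: measurable_cyl.
- exact: spacetime_cyl_lty.
- by apply: measurable_funTS; exact: continuous_measurable_spacetime.
- by move=> [t x] /cyl_bounds[/= ? ?]; exact: HC.
Qed.

Lemma ramp_limit (W w : nat -> R -> R) (a b : nat -> R) phi (t0 : R) :
  Ck_on setT 1 phi -> `[0%R, 1%R]%classic t0 ->
  (forall k (t : R), is_derive t (1%R : R) (W k) (w k t)) -> (forall k, continuous (w k)) ->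
  (forall k t, 0 <= w k t)%R -> (\forall k \near \oo, W k 0 = 0 /\ W k 1 = 1)%R ->
  (\forall k \near \oo, forall t, w k t != 0 -> a k <= t <= b k)%R ->
  (a k @[k --> \oo] --> t0)%R -> (b k @[k --> \oo] --> t0)%R ->
  (fine (\int[lebesgue_measure]_(t in `[0%R, 1%R]) (w k t * timefun phi t)%:E) @[k --> \oo] --> timefun phi t0)%R.
Proof.
move=> C1 t001 dW cw w0 W01 wab at0 bt0.
apply/cvgrPdist_le => e e0.
have /subspace_continuousP/(_ t0 t001)/cvgrPdist_le/(_ e e0) := timefun_continuous C1.
rewrite /prop_near1/= => /nbhs_ballP[d /= d0 Hd].
near=> k.
have [Wk0 Wk1] : (W k 0 = 0 /\ W k 1 = 1)%R by near: k.
have ad : (`|t0 - a k| < d)%R by near: k; exact: (cvgrPdist_lt _ _).1.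
have bd : (`|t0 - b k| < d)%R by near: k; exact: (cvgrPdist_lt _ _).1.
have wabk : (forall t, w k t != 0 -> a k <= t <= b k)%R by near: k.
have [ik _] := timefun_weighted (cw k) C1.
have ifin : \int[lebesgue_measure]_(t in `[0%R, 1%R]) (w k t * timefun phi t)%:E \is a fin_num.
  by apply: integrable_fin_num.
rewrite distrC -lee_fin -abse_EFin EFinB fineK//.
apply: (bump_average (dW k) (cw k) (w0 k) Wk0 Wk1 wabk) => // t t01 /andP[at_ bt_].
rewrite distrC; apply: (Hd t) => //.
rewrite /ball/=; move: ad bd; rewrite !ltr_norml => /andP[? ?] /andP[? ?]; apply/andP; split; lra.
Unshelve. all: by end_near. Qed.

(** Test the equation on [cutoff k] times [phi]. The derivative of the cutoff is a difference of two
    approximate Dirac masses, at 0 and at 1, which give the endpoint values in the limit; the other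
    term tends by domination to the integral without cutoff. *)
Lemma boundary_formula phi : smooth_on setT phi -> xcompact phi ->
  \int[lebesgue_measure]_(t in `[0%R, 1%R]) \int[rho t]_(x in Omega) (tgrad phi v (t, x))%:E =
  (timefun phi 1 - timefun phi 0)%:E.
Proof.
move=> sphi kphi; have C1 := sphi 1%N.
have iT := integrable_tgrad mv fv C1.
have mC := @measurable_cyl R N Omega mO.
rewrite (@spacetime_cyl _ _ _ _ mO mrho (fun z => (tgrad phi v z)%:E))//.
pose i := fine (\int[M]_(z in cylO) (tgrad phi v z)%:E).
have iE : \int[M]_(z in cylO) (tgrad phi v z)%:E = i%:E by rewrite fineK//; exact: integrable_fin_num.
pose u k := fine (\int[lebesgue_measure]_(t in `[0%R, 1%R]) (dramp_up k t * timefun phi t)%:E).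
pose w k := fine (\int[lebesgue_measure]_(t in `[0%R, 1%R]) (dramp_dn k t * timefun phi t)%:E).
pose b k := fine (\int[M]_(z in cylO) (cutoff k z.1 * tgrad phi v z)%:E).
have cuw k : continuous (dcutoff k : R -> R).
  by move=> t; apply: cvgB; [exact: continuous_dramp_up|exact: continuous_dramp_dn].
have mcut k : measurable_fun cylO (fun z => cutoff k z.1).
  apply: measurable_funTS; apply: continuous_measurable_spacetime => z.
  apply: continuous_comp; first exact: cvg_fst.
  exact: (Ck_continuous (Ck_cutoff 0 k)).
have icut k : M.-integrable cylO (fun z => (cutoff k z.1 * tgrad phi v z)%:E).
  apply: (@le_integrable _ _ _ M cylO _ _ (fun z => (tgrad phi v z)%:E)) => //.
    apply/measurable_EFinP; apply: measurable_funM => //.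
    by apply/measurable_EFinP; exact: measurable_int iT.
  move=> z _; rewrite !abse_EFin lee_fin normrM.
  by rewrite -[leRHS]mul1r ler_wpM2r// cutoff_bound.
have main k : (3 < k)%N -> (u k - w k + b k = 0)%R.
  move=> k3; have := cev (test_cutoff k3 sphi kphi).
  have E z : tgrad (fun z => cutoff k z.1 * phi z)%R v z =
      (dcutoff k z.1 * phi z + cutoff k z.1 * tgrad phi v z)%R.
    by apply: tgrad_time_mul => //; [move=> m; exact: Ck_cutoff|move=> t; exact: is_derive_cutoff].
  under eq_integral do under eq_integral do rewrite E.
  have [iu _] := timefun_weighted (@continuous_dramp_up R k) C1.
  have [iw _] := timefun_weighted (@continuous_dramp_dn R k) C1.
  have [_ EA] := timefun_weighted (cuw k) C1.
  have iA : M.-integrable cylO (fun z => (dcutoff k z.1 * phi z)%:E).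
    have cwp : continuous (fun z : V => dcutoff k z.1 * phi z)%R.
      move=> z; apply: cvgM; last exact: (Ck_continuous C1).
      by apply: continuous_comp; [exact: cvg_fst|exact: cuw].
    have [C C0 HC] := continuous_bounded_box B cwp.
    apply: (@integrable_bounded _ _ _ M cylO (fun z => dcutoff k z.1 * phi z)%R C) => //.
    - exact: spacetime_cyl_lty.
    - by apply: measurable_funTS; exact: continuous_measurable_spacetime.
    - by move=> [t x] /cyl_bounds[/= ? ?]; exact: HC.
  rewrite (@spacetime_cyl _ _ _ _ mO mrho (fun z => (dcutoff k z.1 * phi z + cutoff k z.1 * tgrad phi v z)%:E)); last first.
    by under [X in _.-integrable _ X]eq_fun do rewrite EFinD; exact: integrableD.
  under eq_integral do rewrite EFinD.
  have uE : \int[lebesgue_measure]_(t in `[0%R, 1%R]) (dramp_up k t * timefun phi t)%:E = (u k)%:E.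
    by rewrite [RHS]fineK//; apply: integrable_fin_num iu.
  have wE : \int[lebesgue_measure]_(t in `[0%R, 1%R]) (dramp_dn k t * timefun phi t)%:E = (w k)%:E.
    by rewrite [RHS]fineK//; apply: integrable_fin_num iw.
  have bE : \int[M]_(z in cylO) (cutoff k z.1 * tgrad phi v z)%:E = (b k)%:E.
    by rewrite [RHS]fineK//; apply: integrable_fin_num (icut k).
  have dE : \int[lebesgue_measure]_(t in `[0%R, 1%R]) (dcutoff k t * timefun phi t)%:E = (u k)%:E - (w k)%:E.
    transitivity (\int[lebesgue_measure]_(t in `[0%R, 1%R]) (dramp_up k t * timefun phi t)%:E -
      \int[lebesgue_measure]_(t in `[0%R, 1%R]) (dramp_dn k t * timefun phi t)%:E); last by rewrite uE wE.
    rewrite -(integralB_EFin _ iu iw)//.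
    by apply: eq_integral => t _; rewrite /dcutoff mulrBl EFinB.
  rewrite integralD; [|exact: mC|exact: iA|exact: icut].
  by rewrite EA dE bE -EFinB -EFinD => -[].
have inv0 : (k%:R^-1 @[k --> \oo] --> (0 : R))%R by exact: cvg_natV0.
have inv20 : (2 / k%:R @[k --> \oo] --> (0 : R))%R.
  by rewrite -[X in _ --> X](mulr0 2%R); apply: cvgM; [exact: cvg_cst|exact: inv0].
have u0 : (u k @[k --> \oo] --> timefun phi 0)%R.
  apply: (@ramp_limit (@ramp_up R) (@dramp_up R) (fun k => k%:R^-1)%R (fun k => 2 / k%:R)%R) => //.
  - by rewrite /= in_itv/= lexx ler01.
  - by move=> k t; exact: is_derive_ramp_up.
  - by move=> k; exact: continuous_dramp_up.
  - by move=> k t; rewrite mulr_ge0// dstep_ge0.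
  - near=> k; rewrite /ramp_up mulr0 sub0r mulr1 step_le0 ?lerN10// step_ge1//.
    by rewrite lerBrDr; near: k; exact: nbhs_infty_ger.
  - near=> k => t; apply: dramp_up_supp; near: k; exact: nbhs_infty_gt.
have w1 : (w k @[k --> \oo] --> timefun phi 1)%R.
  apply: (@ramp_limit (@ramp_dn R) (@dramp_dn R) (fun k => 1 - 2 / k%:R)%R (fun k => 1 - k%:R^-1)%R) => //.
  - by rewrite /= in_itv/= lexx ler01.
  - by move=> k t; exact: is_derive_ramp_dn.
  - by move=> k; exact: continuous_dramp_dn.
  - by move=> k t; rewrite mulr_ge0// dstep_ge0.
  - near=> k; rewrite /ramp_dn mulr0 sub0r mulr1 subrr add0r.
    have k2 : (2 <= k%:R :> R)%R by near: k; exact: nbhs_infty_ger.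
    by rewrite step_le0 ?step_ge1//; lra.
  - near=> k => t; apply: dramp_dn_supp; near: k; exact: nbhs_infty_gt.
  - by rewrite -[X in _ --> X](subr0 1%R); apply: cvgB; [exact: cvg_cst|exact: inv20].
  - by rewrite -[X in _ --> X](subr0 1%R); apply: cvgB; [exact: cvg_cst|exact: inv0].
have bi : (b k @[k --> \oo] --> i)%R.
  apply: fine_cvg; rewrite -iE.
  have [] := @dominated_convergence _ _ _ M cylO mC (fun k z => (cutoff k z.1 * tgrad phi v z)%:E)
    (fun z => (tgrad phi v z)%:E) (fun z => `|(tgrad phi v z)%:E|) _ _ _ _ _ => //.
  - by move=> k; exact: measurable_int (icut k).
  - exact: measurable_int iT.
  (* The cutoffs tend to 1 except at the times 0 and 1, which are negligible for rho(t, x) dt dx. *)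
  - exists (([set 0%R] `|` [set 1%R]) `*` setT); split.
    + by apply: measurableX => //; exact: measurableU.
    + apply: spacetime_time_null; first exact: measurableU.
      by apply: countable_lebesgue_measure0; apply: finite_set_countable; exact: finite_set2.
    + move=> [t x] /= /not_implyP[[/= t01 _] nc]; split => //=.
      apply: contra_notP nc => /not_orP[/eqP t0 /eqP t1].
      move: t01; rewrite in_itv/= => /andP[t00 t11].
      apply: cvg_EFin; first exact: nearW.
      rewrite -[X in _ --> X]mul1r; apply: cvgM; last exact: cvg_cst.
      by apply: cutoff_cvg; rewrite !lt_neqAle eq_sym t0 t00 t1 t11.
  - exact: integrable_abse.
  - apply/aeW => k z _; rewrite !abse_EFin lee_fin normrM -[leRHS]mul1r ler_wpM2r//.
    exact: cutoff_bound.
have lim0 : (u k - w k + b k @[k --> \oo] --> timefun phi 0 - timefun phi 1 + i)%R.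
  by apply: cvgD => //; exact: cvgB.
have lim1 : (u k - w k + b k @[k --> \oo] --> (0 : R))%R.
  by apply: cvg_near_cst; near=> k; apply: main; near: k; exact: nbhs_infty_gt.
have h : (timefun phi 0 - timefun phi 1 + i = 0)%R.
  exact: (cvg_unique (@norm_hausdorff _ _) lim0 lim1).
rewrite iE; congr EFin; apply/eqP; rewrite -subr_eq0; apply/eqP; rewrite -[RHS]h; ring.
Unshelve. all: by end_near. Qed.

End formula.

End boundary_terms.

(** * Admissible curves *)

Section admissible.
Context {R : realType} {N : nat}.
Local Notation T := (borelRn R N).
Local Notation V := (R * 'rV[R]_N)%type.
Variables (Omega : set 'rV[R]_N) (p : 'rV[R]_N -> R).
Implicit Types (mu nu : probability T R) (lam : R).
Local Open Scope ereal_scope.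

Definition modular lam (rho : R -> probability T R) (v : V -> 'rV[R]_N) : \bar R :=
  \int[lebesgue_measure]_(t in `[0%R, 1%R])
    \int[rho t]_(x in Omega) (enorm (lam^-1 *: v (t, x)) `^ p x)%:E.

(** The infimum over curves and the infimum in the Luxemburg norm merge into one infimum over [lam].
    Neither is known to be attained, so the constructions are carried out on [adm] and only then
    transferred to [Wp]. *)
Definition adm lam mu nu := exists (rho : R -> probability T R) (v : V -> 'rV[R]_N),
  [/\ narrow_curve Omega rho, continuity_equation Omega rho v,
      measure_eq (rho 0%R) mu, measure_eq (rho 1%R) nu & modular lam rho v <= 1].

Lemma Wp_le lam mu nu : (0 < lam)%R -> adm lam mu nu -> Wp Omega p mu nu <= lam%:E.
Proof.
move=> l0 [rho [v [h1 h2 h3 h4 h5]]].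
apply: (@le_trans _ _ (Lp_norm Omega p rho v)).
  by apply: ereal_inf_lbound; exists rho, v.
by apply: ereal_inf_lbound; exists lam.
Qed.

Lemma Wp_lt_adm lam mu nu : Wp Omega p mu nu < lam%:E ->
  exists l, [/\ (0 < l)%R, (l < lam)%R & adm l mu nu].
Proof.
move=> /ereal_inf_lt[_ [rho [v [h1 h2 h3 h4 ->]]]].
move=> /ereal_inf_lt[_ [l [l0 hl] <-]]; rewrite lte_fin => llam.
by exists l; split => //; exists rho, v.
Qed.

Lemma Wp_ge0 mu nu : 0 <= Wp Omega p mu nu.
Proof.
apply: le_ereal_inf_tmp => _ [rho [v [_ _ _ _ ->]]].
by apply: le_ereal_inf_tmp => _ [l [l0 _] <-]; rewrite lee_fin ltW.
Qed.

Lemma adm_eq lam mu mu' nu nu' : measure_eq mu mu' -> measure_eq nu nu' ->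
  adm lam mu nu -> adm lam mu' nu'.
Proof.
move=> Em En [rho [v [h1 h2 h3 h4 h5]]]; exists rho, v; split => // A mA.
  by rewrite h3// Em.
by rewrite h4// En.
Qed.

End admissible.

(** * Control of smooth integrals by the cost *)

Section lower_bound.
Context {R : realType} {N : nat}.
Local Notation T := (borelRn R N).
Local Notation V := (R * 'rV[R]_N)%type.
Variables (Omega : set 'rV[R]_N) (p : 'rV[R]_N -> R) (B : R).
Hypotheses (oO : open Omega) (OB : forall x, Omega x -> `|x| <= B).
Hypothesis mp : measurable_fun (Omega : set T) (p : T -> R).
Hypothesis p1 : forall x, Omega x -> 1 <= p x.
Local Open Scope ereal_scope.

Let mO : measurable (Omega : set T). Proof. exact: open_measurable_Rn. Qed.
Local Notation cylO := (@cyl R N Omega).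

Lemma measurable_modular (v : V -> 'rV[R]_N) (lam : R) :
  measurable_fun (`[0%R, 1%R]%classic `*` setT : set (R * T)) (v : R * T -> T) ->
  measurable_fun cylO (fun z => (enorm (lam^-1 *: v z) `^ p z.2)%R).
Proof.
move=> mv; apply: measurable_fun_powR2; first exact: measurable_cyl.
  rewrite (_ : (fun _ => _) = (fun z => `|lam^-1| * enorm (v z))%R); last first.
    by apply/funext => z; rewrite enormZ.
  apply: measurable_funM => //; apply: measurable_enorm_comp.
  by apply: measurable_funS mv; [exact: measurableX|move=> z []].
apply: (@measurable_comp _ _ _ (R * T)%type T R (Omega : set T) p cylO snd) => //.
  by move=> _ [z [_ Oz] <-].
exact: measurable_funS measurable_snd.
Qed.

Lemma enorm_le_modular (u : 'rV[R]_N) x lam : (0 < lam)%R -> Omega x ->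
  (enorm u <= lam * (1 + enorm (lam^-1 *: u) `^ p x))%R.
Proof.
move=> l0 Ox; rewrite enormZ ger0_norm ?invr_ge0 ?(ltW l0)//.
rewrite -[leLHS](mulKf (lt0r_neq0 l0)) [X in (X <= _)%R]mulrCA ler_pM2l//.
have a0 : (0 <= lam^-1 * enorm u)%R by rewrite mulr_ge0 ?enorm_ge0// invr_ge0 ltW.
set a := (lam^-1 * enorm u)%R in a0 *.
have [a1|a1] := leP a 1%R; first by apply: (le_trans a1); rewrite lerDl powR_ge0.
apply: (@le_trans _ _ (a `^ p x)%R); last by rewrite lerDr.
rewrite -[leLHS]powRr1//; apply: ler_powR; first exact: ltW.
exact: p1.
Qed.

(** The factor 2 adds the mass of the space-time measure and the modular, each at most 1. *)
Lemma enorm_integral_le rho v lam : narrow_curve Omega rho ->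
  measurable_fun (`[0%R, 1%R]%classic `*` setT : set (R * T)) (v : R * T -> T) ->
  (0 < lam)%R -> modular Omega p lam rho v <= 1 ->
  \int[lebesgue_measure]_(t in `[0%R, 1%R]) \int[rho t]_(x in Omega) (enorm (v (t, x)))%:E
    <= (lam * 2)%:E.
Proof.
move=> nrho mv l0 mod1.
pose mrho := narrow_curve_measurable oO nrho.
have mC := @measurable_cyl R N Omega mO.
have mm := measurable_modular lam mv.
have me : measurable_fun cylO (fun z => (enorm (v z))%:E).
  by apply/measurable_EFinP; apply: measurable_enorm_comp; exact: measurable_field_cyl.
rewrite (@spacetime_cyl_ge0 _ _ _ _ mO mrho (fun z => (enorm (v z))%:E))//; last first.
  by move=> z _; rewrite lee_fin enorm_ge0.
apply: (@le_trans _ _ (\int[spacetime mrho]_(z in cylO)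
    (lam%:E * (cst 1 z + (enorm (lam^-1 *: v z) `^ p z.2)%:E)))).
  apply: ge0_le_integral => //.
  - by move=> z _; rewrite lee_fin enorm_ge0.
  - apply: measurable_funeM; apply: emeasurable_funD; first exact: measurable_cst.
    exact/measurable_EFinP.
  - move=> z [_ Oz]; rewrite -EFinD -EFinM lee_fin; exact: enorm_le_modular.
rewrite ge0_integralZl//; last 3 first.
- by apply: emeasurable_funD; [exact: measurable_cst|exact/measurable_EFinP].
- by move=> z _; rewrite -EFinD lee_fin addr_ge0// powR_ge0.
- by rewrite lee_fin ltW.
rewrite EFinM lee_wpmul2l ?lee_fin ?(ltW l0)//.
rewrite ge0_integralD//; last 2 first.
- by move=> z _; rewrite lee_fin powR_ge0.
- exact/measurable_EFinP.
rewrite integral_cst// mul1e -[2%R]/(1 + 1)%R EFinD leeD//.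
  apply: (@le_trans _ _ (spacetime mrho setT)); last exact: sprobability_setT.
  by apply: le_measure; rewrite ?inE.
rewrite -(@spacetime_cyl_ge0 _ _ _ _ mO mrho (fun z => (enorm (lam^-1 *: v z) `^ p z.2)%:E))//.
- exact/measurable_EFinP.
- by move=> z _; rewrite lee_fin powR_ge0.
Qed.

(** Seen as a function of (t, x), [psi] has no time derivative, so the boundary formula leaves the
    integral of [grad psi . v]. The constant is chosen before [lam], [mu] and [nu], a uniformity on
    which the limits rely. *)
Lemma adm_test (psi : 'rV[R]_N -> R) : smooth_on setT psi ->
  (exists b, forall x, b < `|x| -> psi x = 0)%R ->
  exists2 C : R, (0 <= C)%R & forall lam mu nu, (0 < lam)%R ->
    prob_on Omega mu -> prob_on Omega nu -> adm Omega p lam mu nu ->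
    (`| fine (\int[mu]_(x in Omega) (psi x)%:E) - fine (\int[nu]_(x in Omega) (psi x)%:E) | <= C * lam)%R.
Proof.
move=> spsi [b psib].
pose phi : V -> R := psi \o snd.
have sphi : smooth_on setT phi.
  move=> m; apply: (@Ck_affine R V 'rV[R]_N snd snd _ _ m psi) => //.
  by move=> z; exact: cvg_snd.
have C1 := sphi 1%N; have [C C0 HC] := C1_box_bounds B C1.
(* [C] bounds each partial derivative on [Omega], [N] comes from summing over the coordinates and 2
   from [enorm_integral_le]. *)
exists (C * N%:R * 2)%R; first by rewrite !mulr_ge0.
move=> lam mu nu l0 muO nuO [rho [v [nrho [mv fv cev] r0 r1 mod1]]].
pose mrho := narrow_curve_measurable oO nrho.
have mC := @measurable_cyl R N Omega mO.
have kphi : xcompact phi by exists b => t x /psib.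
have BF := boundary_formula oO OB nrho mv fv cev sphi kphi.
have iT := integrable_tgrad oO OB nrho mv fv C1.
rewrite (@spacetime_cyl _ _ _ _ mO mrho (fun z => (tgrad phi v z)%:E) iT) in BF.
have tE (t : R) (m : probability T R) : measure_eq (rho t) m ->
    timefun Omega rho phi t = fine (\int[m]_(x in Omega) (psi x)%:E).
  move=> E; rewrite /timefun; congr fine; apply: eq_measure_integral => A mA _; exact: E.
rewrite -(tE _ _ r0) -(tE _ _ r1) distrC -lee_fin -abse_EFin -BF.
have gradE z : cylO z -> (`|tgrad phi v z| <= C * N%:R * enorm (v z))%R.
  move=> cz; have [t2 xB] := cyl_bounds OB cz; have [_ _ h2] := HC z.1 z.2 t2 xB.
  rewrite /tgrad (_ : 'D_((1%R, 0%R) : V) phi z = 0%R) ?add0r; last first.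
    have AE (x u : V) (h : R) : snd (h *: u + x)%R = (h *: u.2 + x.2)%R by [].
    have d0 : derivable psi z.2 (0%R : 'rV[R]_N) by exact: derivable0.
    have := @is_derive_affine R V 'rV[R]_N snd snd AE psi z (1%R, 0%R) d0.
    by move=> /(@derive_val _ _ _ _ _ _ _) ->; rewrite derive0.
  apply: (le_trans (ler_norm_sum _ _ _)).
  have -> : (C * N%:R * enorm (v z) = \sum_(i < N) C * enorm (v z))%R.
    by rewrite sumr_const card_ord -[RHS]mulr_natl mulrCA mulrA.
  apply: ler_sum => i _; rewrite normrM mulrC; apply: ler_pM.
  - exact: normr_ge0.
  - exact: normr_ge0.
  - by rewrite [z]surjective_pairing; exact: h2.
  - exact: coord_le_enorm.
have me : measurable_fun cylO (fun z => (enorm (v z))%:E).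
  by apply/measurable_EFinP; apply: measurable_enorm_comp; exact: measurable_field_cyl.
apply: (le_trans (le_abse_integral _ mC (measurable_int _ iT))).
apply: (@le_trans _ _ (\int[spacetime mrho]_(z in cylO) ((C * N%:R)%:E * (enorm (v z))%:E))).
  apply: ge0_le_integral => //.
  - by apply: measurableT_comp => //; exact: measurable_int iT.
  - exact: measurable_funeM.
have CN0 : (0 <= C * N%:R)%R by rewrite mulr_ge0.
rewrite ge0_integralZl//; last by move=> z _; rewrite lee_fin enorm_ge0.
rewrite -(@spacetime_cyl_ge0 _ _ _ _ mO mrho (fun z => (enorm (v z))%:E))//; last first.
  by move=> z _; rewrite lee_fin enorm_ge0.
rewrite (_ : (C * N%:R * 2 * lam = (C * N%:R) * (lam * 2))%R); last by ring.
rewrite [leRHS]EFinM lee_wpmul2l ?lee_fin//.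
exact: enorm_integral_le.
Qed.

End lower_bound.

(** * Changes of variable in time *)

Section image_measure.
Context {d1 d2} {X : measurableType d1} {Y : measurableType d2} {R : realType}.
Variables (m : {measure set X -> \bar R}) (f : X -> Y) (mf : measurable_fun setT f).

Definition image_measure : {measure set Y -> \bar R} :=
  measure_function_pushforward__canonical__measure_function_Measure m mf.

End image_measure.

Section time_change.
Context {R : realType}.
Local Open Scope ereal_scope.
Local Notation leb := (@lebesgue_measure R).
Local Notation RM := (measurableTypeR R).

Lemma pmule_subr (k : R) (a b : \bar R) : (0 < k)%R -> k%:E * (a - b) = k%:E * a - k%:E * b.
Proof.
move=> k0; have k0e : 0 < k%:E by rewrite lte_fin.
case: a => [a||]; case: b => [b||] //=; rewrite ?(gt0_muley k0e) ?(gt0_muleNy k0e)//=.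
by rewrite -EFinB -!EFinM -EFinB mulrBr.
Qed.

Section substitution.
Context d (Z : measurableType d).
Variables (m : {measure set Z -> \bar R}) (f : Z -> RM).
Hypotheses (mf : measurable_fun setT f).
Hypothesis fE : forall x y, (x <= y)%R -> m (f @^-1` `]x, y]) = (y - x)%:E.

Lemma lebesgue_substitution (A : set R) : measurable A -> leb A = m (f @^-1` A).
Proof.
move=> mA; rewrite -[RHS]/(image_measure m mf A).
apply: lebesgue_measure_unique => // _ [[a b] _ <-] /=.
rewrite -[RHS]/(m (f @^-1` `]a, b])).
have [ab|ba] := leP a b.
  by rewrite fE// lebesgue_measure_itv/= lte_fin; case: ltgtP ab => // -> _; rewrite subrr.
by rewrite set_itv_ge ?bnd_simp -?leNgt ?(ltW ba)// preimage_set0 !measure0.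
Qed.

Lemma ge0_integral_substitution (D : set R) (F : R -> \bar R) :
  measurable D -> measurable_fun D F -> (forall t, D t -> 0 <= F t) ->
  \int[leb]_(t in D) F t = \int[m]_(s in f @^-1` D) F (f s).
Proof.
move=> mD mF F0.
rewrite -(ge0_integral_pushforward mf m mD mF); last by move=> t /set_mem; exact: F0.
by apply: eq_measure_integral => A mA _; exact: lebesgue_substitution.
Qed.

(** Positive and negative parts are compared separately, so that measurability is all there is to
    check on an iterated integral. *)
Lemma integral_substitution (D : set R) (F : R -> \bar R) :
  measurable D -> measurable_fun D F ->
  \int[leb]_(t in D) F t = \int[m]_(s in f @^-1` D) F (f s).
Proof.
move=> mD mF; rewrite [LHS]integralE [RHS]integralE.
rewrite (ge0_integral_substitution mD (measurable_funepos mF)); last by move=> *; exact: funepos_ge0.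
rewrite (ge0_integral_substitution mD (measurable_funeneg mF)); last by move=> *; exact: funeneg_ge0.
by congr (_ - _); apply: eq_integral => t _; rewrite ?(funeposE, funenegE).
Qed.

End substitution.

Lemma integral_mscale_pos (k : R) (k0 : (0 < k)%R) (D : set RM) (F : RM -> \bar R) :
  measurable D -> measurable_fun D F ->
  \int[mscale (NngNum (ltW k0)) leb]_(t in D) F t = k%:E * \int[leb]_(t in D) F t.
Proof.
move=> mD mF; rewrite integralE [X in _ * X]integralE pmule_subr//.
by rewrite !ge0_integral_mscale//; [exact: measurable_funeneg|exact: measurable_funepos].
Qed.

Lemma measurable_affine (a b : R) : measurable_fun setT (fun s : R => a * s + b)%R.
Proof.
by apply: measurable_funD => //; apply: measurable_funM => //; exact: measurable_cst.
Qed.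

Lemma integral_affine (a b : R) (D : set R) (F : R -> \bar R) :
  (0 < a)%R -> measurable D -> measurable_fun D F ->
  \int[leb]_(t in D) F t =
    a%:E * \int[leb]_(s in [set s | D (a * s + b)%R]) F (a * s + b)%R.
Proof.
move=> a0 mD mF; have ma := measurable_affine a b.
have mpre : measurable [set s : RM | D (a * s + b)%R].
  by have := ma measurableT D mD; rewrite setTI.
have mFa : measurable_fun ([set s : RM | D (a * s + b)%R] : set RM) (fun s => F (a * s + b)%R).
  apply: (@measurable_comp _ _ _ RM RM _ D F) => //.
    by move=> _ [s /= Ds <-].
  exact: measurable_funTS.
rewrite -(integral_mscale_pos a0 mpre mFa).
apply: (@integral_substitution _ RM (mscale (NngNum (ltW a0)) leb) (fun s => a * s + b)%R) => //.
move=> x y xy.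
rewrite (_ : _ @^-1` _ = `](x - b) / a, (y - b) / a]%classic)%R; last first.
  by apply/seteqP; split => s /=; rewrite !in_itv/= ltr_pdivrMr// ler_pdivlMr// ltrBlDr lerBrDr mulrC.
rewrite [LHS](_ : _ = a%:E * leb `]((x - b) / a)%R, ((y - b) / a)%R]%classic)//.
rewrite [X in _ * X](lebesgue_measure_itv `](x - b) / a, (y - b) / a]%R)/= lte_fin ltr_pM2r ?invr_gt0// ltrD2r.
case: ltgtP xy => // [xy _|-> _]; last by rewrite mule0 subrr.
by rewrite -EFinB -EFinM; congr EFin; field; rewrite gt_eqF.
Qed.

Lemma integral_reverse (F : R -> \bar R) : measurable_fun (`[0%R, 1%R]%classic : set R) F ->
  \int[leb]_(t in `[0%R, 1%R]) F t = \int[leb]_(s in `[0%R, 1%R]) F (1 - s)%R.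
Proof.
move=> mF.
rewrite (@integral_substitution _ RM leb (fun s => 1 - s)%R _ _ _ F)//.
- congr (integral _ _ _); apply/seteqP.
  by split => s /=; rewrite !in_itv/= => /andP[? ?]; apply/andP; split; lra.
- by apply: measurable_funB => //; exact: measurable_cst.
- move=> x y xy.
  rewrite (_ : _ @^-1` _ = `[1 - y, 1 - x[%classic)%R; last first.
    by apply/seteqP; split => s /=; rewrite !in_itv/= => /andP[? ?]; apply/andP; split; lra.
  rewrite [LHS](lebesgue_measure_itv `[1 - y, 1 - x[%R)/= lte_fin ltrD2l ltrN2.
  case: ltgtP xy => // [xy _|-> _]; last by rewrite subrr.
  by rewrite -EFinB; congr EFin; ring.
Qed.

End time_change.

(** * Time reversal *)

Section reversal.
Context {R : realType} {N : nat}.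
Local Notation T := (borelRn R N).
Local Notation V := (R * 'rV[R]_N)%type.
Variables (Omega : set 'rV[R]_N) (p : 'rV[R]_N -> R) (B : R).
Hypotheses (oO : open Omega) (OB : forall x, Omega x -> `|x| <= B).
Hypothesis mp : measurable_fun (Omega : set T) (p : T -> R).
Local Open Scope ereal_scope.
Local Notation leb := (@lebesgue_measure R).

Let mO : measurable (Omega : set T). Proof. exact: open_measurable_Rn. Qed.
Local Notation cylO := (@cyl R N Omega).

Lemma inner_ge0_measurable rho (h : R * T -> \bar R) : narrow_curve Omega rho ->
  measurable_fun cylO h -> (forall z, cylO z -> 0 <= h z) ->
  measurable_fun (`[0%R, 1%R]%classic : set R) (fun t => \int[rho t]_(x in Omega) h (t, x)).
Proof. move=> nrho; exact: measurable_inner_cyl mO (narrow_curve_measurable oO nrho) h. Qed.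

Lemma inner_measurable rho (h : R * T -> \bar R) : narrow_curve Omega rho ->
  measurable_fun cylO h ->
  measurable_fun (`[0%R, 1%R]%classic : set R) (fun t => \int[rho t]_(x in Omega) h (t, x)).
Proof.
move=> nrho mh.
rewrite (_ : (fun _ => _) = (fun t => \int[rho t]_(x in Omega) h^\+ (t, x) -
   \int[rho t]_(x in Omega) h^\- (t, x))).
  apply: emeasurable_funB; apply: inner_ge0_measurable => //.
  - exact: measurable_funepos.
  - exact: measurable_funeneg.
apply/funext => t; rewrite [LHS]integralE.
by congr (_ - _); apply: eq_integral => x _; rewrite ?(funeposE, funenegE).
Qed.

Lemma narrow_cvg_comp (rho : R -> probability T R) (m : probability T R) (g : R -> R) (t : R) (S S' : set R) :
  continuous g -> (forall s, S s -> S' (g s)) ->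
  narrow_cvg Omega (within S' (nbhs (g t))) rho m ->
  narrow_cvg Omega (within S (nbhs t)) (rho \o g) m.
Proof.
move=> cg gS nc f cf bf.
apply: (cvg_comp g (fun s => \int[rho s]_(x in Omega) (f x)%:E) _ (nc f cf bf)).
move=> A /= HA; change (nbhs t (fun s => S s -> A (g s))).
by apply: (@filterS _ (nbhs t) _ _ _ _ (cg t _ HA)) => s As /gS; exact: As.
Qed.

Lemma tgrad_time_affine (a b : R) (phi : V -> R) (v : V -> 'rV[R]_N) t x :
  Ck_on setT 1 phi ->
  tgrad (fun z : V => phi (a * z.1 + b, z.2))%R v (t, x) =
    (a * 'D_((1, 0) : V) phi (a * t + b, x) +
     \sum_(i < N) v (t, x) 0 i * 'D_((0, delta_mx 0 i) : V) phi (a * t + b, x))%R.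
Proof.
move=> C1; pose A (z : V) : V := (a * z.1 + b, z.2)%R.
pose dA (u : V) : V := (a * u.1, u.2)%R.
have AE (z u : V) (h : R) : (A (h *: u + z) = h *: dA u + A z)%R.
  by rewrite /A /dA; congr (_, _); rewrite /= /GRing.scale/=; ring.
have dE (u : V) z : 'D_u (phi \o A) z = 'D_(dA u) phi (A z).
  by apply: derive_val; apply: is_derive_affine => //; apply: Ck_derivable C1.
rewrite /tgrad -[fun z => _]/(phi \o A) !dE; congr (_ + _)%R.
  rewrite -(derive_scale_dir C1); congr ('D_ _ phi _).
  by rewrite /dA; congr (_, _); rewrite /= ?scaler0// /GRing.scale/= mulr1.
by apply: eq_bigr => i _; rewrite dE /dA/= mulr0.
Qed.

Lemma tgradZ (c : R) (phi : V -> R) (v : V -> 'rV[R]_N) z : Ck_on setT 1 phi ->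
  tgrad (fun z => c * phi z)%R v z = (c * tgrad phi v z)%R.
Proof.
move=> C1.
have dE (u : V) : 'D_u (fun z => c * phi z)%R z = (c * 'D_u phi z)%R.
  by have := deriveZ c (@Ck_derivable _ _ 0 phi z u C1).
rewrite /tgrad dE mulrDr mulr_sumr; congr (_ + _)%R.
by apply: eq_bigr => i _; rewrite dE mulrCA.
Qed.

Lemma smooth_time_affine (a b : R) (phi : V -> R) : smooth_on setT phi ->
  smooth_on setT (fun z : V => phi (a * z.1 + b, z.2))%R.
Proof.
move=> sphi m.
apply: (@Ck_affine R V V (fun z : V => (a * z.1 + b, z.2))%R (fun u : V => (a * u.1, u.2))%R _ _ m phi).
- move=> z; apply: (@cvg_pair _ _ _ _ (nbhs (a * z.1 + b)%R) (nbhs z.2)); last exact: cvg_snd.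
  by apply: cvgD; [apply: cvgM; [exact: cvg_cst|exact: cvg_fst]|exact: cvg_cst].
- by move=> z u h; congr (_, _); rewrite /= /GRing.scale/=; ring.
- exact: sphi.
Qed.

Lemma test_xcompact (phi : V -> R) : test_function phi -> xcompact phi.
Proof.
move=> [_ [K [cK _ phiK]]].
have [M [_ HM]] := compact_bounded cK.
exists (`|M| + 1)%R => t x Mx; apply: phiK => /(HM (`|M| + 1)%R _).
rewrite ltr_pwDr ?ler_norm// => /(_ isT)/=; apply/negP; rewrite -ltNge.
by apply: lt_le_trans Mx _; rewrite prod_normE/= le_max lexx orbT.
Qed.

Lemma test_endpoints (phi : V -> R) x : test_function phi -> phi (0%R, x) = 0%R /\ phi (1%R, x) = 0%R.
Proof.
move=> [_ [K [cK K01 phiK]]]; split; apply: phiK => /K01[/=].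
  by rewrite in_itv/= ltxx.
by rewrite in_itv/= ltxx andbF.
Qed.

Lemma adm_sym lam mu nu : adm Omega p lam mu nu -> adm Omega p lam nu mu.
Proof.
move=> [rho [v [nrho [mv fv cev] r0 r1 mod1]]].
have mrev : measurable_fun (setT : set R) (fun t : R => 1 - t)%R.
  by apply: measurable_funB => //; exact: measurable_cst.
have rev01 (t : R) : `[0%R, 1%R]%classic t -> `[0%R, 1%R]%classic (1 - t)%R.
  by rewrite /= !in_itv/=; lra.
pose rho' t := rho (1 - t)%R; pose v' (z : V) := (- v (1 - z.1, z.2))%R.
have nrho' : narrow_curve Omega rho'.
  move=> t t01; have [rO nc] := nrho _ (rev01 _ t01); split => //.
  apply: (@narrow_cvg_comp rho (rho (1 - t)%R) (fun t => 1 - t)%R t _ _ _ rev01 nc).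
  by move=> y; apply: cvgB; [exact: cvg_cst|exact: cvg_id].
have mpair : measurable_fun (`[0%R, 1%R]%classic `*` setT : set (R * T)) (fun z : R * T => (1 - z.1, z.2)%R : R * T).
  apply: measurable_funTS; apply/measurable_fun_pairP; split => /=; last exact: measurable_snd.
  exact: (measurableT_comp mrev measurable_fst).
have mv' : measurable_fun (`[0%R, 1%R]%classic `*` setT : set (R * T)) (v' : R * T -> T).
  apply: measurable_fun_Rn => [|i]; first exact: measurableX.
  rewrite (_ : (fun _ => _) = (fun z : R * T => - (v (1 - z.1, z.2) 0 i))%R); last first.
    by apply/funext => z; rewrite mxE.
  apply: measurable_funN.
  apply: (measurable_comp (F := (`[0%R, 1%R]%classic `*` setT : set (R * T)))
    (f := fun z : R * T => (v z) 0%R i)) mpair.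
  - exact: measurableX.
  - by move=> _ [z [z01 _] <-]; split => //; exact: rev01.
  - exact: (measurableT_comp (measurable_coord i) mv).
have enormN (u : 'rV[R]_N) : enorm (- u) = enorm u by rewrite -scaleN1r enormZ normrN1 mul1r.
exists rho', v'; split; first exact: nrho'.
- split; first exact: mv'.
  + rewrite [X in X < _](_ : _ = \int[leb]_(t in `[0%R, 1%R]) \int[rho t]_(x in Omega) (enorm (v (t, x)))%:E); first exact: fv.
    rewrite [RHS]integral_reverse; last first.
      apply: (inner_measurable (h := fun z => (enorm (v z))%:E)) => //.
      by apply/measurable_EFinP; apply: measurable_enorm_comp; exact: measurable_field_cyl.
    by apply: eq_integral => t _; apply: eq_integral => x _; rewrite enormN.
  + move=> phi tphi; have [sphi _] := tphi.
    have C1 := sphi 1%N.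
    (* The opposite sign in [phir] gives the time derivative back unchanged and turns [v] into [v'].
       The boundary formula applies to [phir] with both endpoint values equal to 0, which avoids
       transporting the compact support through the reversal. *)
    pose phi1 (z : V) := phi (- 1 * z.1 + 1, z.2)%R.
    have sphi1 : smooth_on setT phi1 by exact: smooth_time_affine.
    pose phir (z : V) := (-1 * phi1 z)%R.
    have sphir : smooth_on setT phir by move=> m; exact: CkZ (sphi1 m).
    have iT := integrable_tgrad oO OB nrho mv fv (sphir 1%N).
    have mT : measurable_fun cylO (fun z => (tgrad phir v z)%:E) by exact: measurable_int iT.
    have kphir : xcompact phir.
      by have [b Hb] := test_xcompact tphi; exists b => t x xb; rewrite /phir /phi1 Hb ?mulr0.
    have BF := boundary_formula oO OB nrho mv fv cev sphir kphir.
    rewrite (_ : (timefun Omega rho phir 1 - timefun Omega rho phir 0)%:E = 0) in BF; last first.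
      rewrite /timefun !integral0_eq ?subrr// => x _; have [h0 h1] := test_endpoints x tphi.
        by rewrite /phir /phi1/= mulr0 add0r h1 mulr0.
      rewrite /phir /phi1/= (_ : -1 * 1 + 1 = 0)%R ?h0 ?mulr0//; ring.
    rewrite integral_reverse in BF; last exact: (inner_measurable (h := fun z => (tgrad phir v z)%:E)).
    have E t x : (tgrad phir v (1 - t, x) = 'D_((1, 0) : V) phi (t, x) +
        \sum_(i < N) v' (t, x) 0 i * 'D_((0, delta_mx 0 i) : V) phi (t, x))%R.
      rewrite tgradZ; last exact: sphi1.
      rewrite tgrad_time_affine// (_ : (- 1 * (1 - t) + 1 = t)%R); last by ring.
      rewrite mulrDr mulrA mulN1r opprK mul1r; congr (_ + _)%R.
      rewrite mulN1r -sumrN; apply: eq_bigr => i _.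
      by rewrite /v' mxE mulNr.
    by rewrite -[RHS]BF; apply: eq_integral => t _; apply: eq_integral => x _; rewrite E.
- by move=> A mA; rewrite /rho' subr0 r1.
- by move=> A mA; rewrite /rho' subrr r0.
- rewrite /modular [X in X <= _](_ : _ = modular Omega p lam rho v); first exact: mod1.
  rewrite /modular.
  rewrite [RHS]integral_reverse; last first.
    apply: (inner_measurable (h := fun z => (enorm (lam^-1 *: v z) `^ p z.2)%:E)) => //.
    by apply/measurable_EFinP; exact: measurable_modular.
  by apply: eq_integral => t _; apply: eq_integral => x _; rewrite /v' scalerN enormN.
Qed.

End reversal.

(** * Concatenation of curves *)

Section glue.
Context {R : realType} {N : nat}.
Local Notation T := (borelRn R N).
Local Notation V := (R * 'rV[R]_N)%type.
Variables (Omega : set 'rV[R]_N) (p : 'rV[R]_N -> R) (B : R).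
Hypotheses (oO : open Omega) (OB : forall x, Omega x -> `|x| <= B).
Hypothesis mp : measurable_fun (Omega : set T) (p : T -> R).
Hypothesis p1 : forall x, Omega x -> 1 <= p x.
Local Open Scope ereal_scope.
Local Notation leb := (@lebesgue_measure R).

Let mO : measurable (Omega : set T). Proof. exact: open_measurable_Rn. Qed.
Local Notation cylO := (@cyl R N Omega).

Lemma narrow_cvg_eq (S : set R) (t : R) (rho rho' : R -> probability T R) (m m' : probability T R) :
  (forall s, S s -> measure_eq (rho s) (rho' s)) -> measure_eq m m' ->
  narrow_cvg Omega (within S (nbhs t)) rho m -> narrow_cvg Omega (within S (nbhs t)) rho' m'.
Proof.
move=> E Em nc f cf bf.
rewrite (_ : \int[m']_(x in Omega) (f x)%:E = \int[m]_(x in Omega) (f x)%:E); last first.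
  by apply: eq_measure_integral => A mA _; rewrite Em.
move=> A /(nc f cf bf) /= HA; change (nbhs t (fun s => S s -> A (\int[rho' s]_(x in Omega) (f x)%:E))).
apply: (@filterS _ (nbhs t) _ _ _ _ HA) => s As Ss.
rewrite (_ : \int[rho' s]_(x in Omega) (f x)%:E = \int[rho s]_(x in Omega) (f x)%:E); first exact: As.
by apply: eq_measure_integral => C mC _; rewrite E.
Qed.

(** Conditional hypotheses let one statement cover the junction and both sides of it: away from
    [tau], one of the two intervals does not meet a neighbourhood of [t]. *)
Lemma narrow_cvg_glue (rho : R -> probability T R) (m : probability T R) (t tau : R) :
  ((t <= tau)%R -> narrow_cvg Omega (within `[0%R, tau]%classic (nbhs t)) rho m) ->
  ((tau <= t)%R -> narrow_cvg Omega (within `[tau, 1%R]%classic (nbhs t)) rho m) ->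
  narrow_cvg Omega (within `[0%R, 1%R]%classic (nbhs t)) rho m.
Proof.
move=> h1 h2 f cf bf A HA.
change (nbhs t (fun s => `[0%R, 1%R]%classic s -> A (\int[rho s]_(x in Omega) (f x)%:E))).
have K1 : nbhs t (fun s => `[0%R, tau]%classic s -> A (\int[rho s]_(x in Omega) (f x)%:E)).
  have [tt|tt] := leP t tau; first exact: (h1 tt f cf bf A HA).
  apply: (@filterS _ (nbhs t) _ _ _ _ (lt_nbhsr tt)) => s ts /=.
  by rewrite in_itv/= (leNgt _ tau) ts andbF.
have K2 : nbhs t (fun s => `[tau, 1%R]%classic s -> A (\int[rho s]_(x in Omega) (f x)%:E)).
  have [tt|tt] := leP tau t; first exact: (h2 tt f cf bf A HA).
  apply: (@filterS _ (nbhs t) _ _ _ _ (lt_nbhsl tt)) => s ts /=.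
  by rewrite in_itv/= (leNgt tau) ts.
apply: (@filterS2 _ (nbhs t) _ _ _ _ _ K1 K2) => s A1 A2.
rewrite /= in_itv/= => /andP[s0 s1].
by have [st|st] := leP s tau; [apply: A1|apply: A2]; rewrite /= in_itv/= ?s0 ?s1 ?st ?(ltW st).
Qed.

(** The time [tau] belongs to the second half. The [+ 0] gives both halves the shape of the same
    affine substitution. *)
Lemma integral_split01 (tau : R) (F F1 F2 : R -> \bar R) : (0 < tau < 1)%R ->
  measurable_fun (`[0%R, 1%R]%classic : set R) F1 ->
  measurable_fun (`[0%R, 1%R]%classic : set R) F2 ->
  (forall t, (0 <= t < tau)%R -> F t = F1 (tau^-1 * t + 0)%R) ->
  (forall t, (tau <= t <= 1)%R -> F t = F2 ((1 - tau)^-1 * t + - (tau / (1 - tau)))%R) ->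
  \int[leb]_(t in `[0%R, 1%R]) F t =
    tau%:E * \int[leb]_(t in `[0%R, 1%R]) F1 t + (1 - tau)%:E * \int[leb]_(t in `[0%R, 1%R]) F2 t.
Proof.
move=> /andP[t0 t1] m1 m2 E1 E2; have s0 : (0 < 1 - tau)%R by rewrite subr_gt0.
have E01 : (`[0%R, 1%R]%classic : set R) = `[0%R, tau[%classic `|` `[tau, 1%R]%classic.
  apply/seteqP; split => t /=; rewrite !in_itv/=.
    by move=> /andP[a b]; have [c|c] := ltP t tau; [left|right]; rewrite ?a ?b.
  by move=> [/andP[a b]|/andP[a b]]; apply/andP; split => //; [rewrite ltW// (lt_trans b)|rewrite (le_trans _ a)// ltW].
have P1 : [set s : R | `[0%R, 1%R]%classic (tau^-1 * s + 0)%R] = `[0%R, tau]%classic.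
  apply/seteqP; split => s /=; rewrite !in_itv/= addr0 mulrC ler_pdivrMr// mul1r.
    by rewrite pmulr_lge0// invr_gt0.
  by rewrite pmulr_lge0// invr_gt0.
have P2 : [set s : R | `[0%R, 1%R]%classic ((1 - tau)^-1 * s + - (tau / (1 - tau)))%R] = `[tau, 1%R]%classic.
  apply/seteqP; split => s /=; rewrite !in_itv/= (_ : (_ * s - _ = (s - tau) / (1 - tau))%R);
    rewrite ?ler_pdivrMr// ?mul1r ?lerD2r ?pmulr_lge0 ?invr_gt0// ?subr_ge0//; ring.
have mE1 : measurable_fun (`[0%R, tau]%classic : set R) (fun s => F1 (tau^-1 * s + 0)%R).
  rewrite -P1.
  apply: (@measurable_comp _ _ _ R R _ (`[0%R, 1%R]%classic : set R) F1) => //.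
    by move=> _ [s /= Ds <-].
  by apply: measurable_funTS; exact: measurable_affine.
have mE2 : measurable_fun (`[tau, 1%R]%classic : set R) (fun s => F2 ((1 - tau)^-1 * s + - (tau / (1 - tau)))%R).
  rewrite -P2.
  apply: (@measurable_comp _ _ _ R R _ (`[0%R, 1%R]%classic : set R) F2) => //.
    by move=> _ [s /= Ds <-].
  by apply: measurable_funTS; exact: measurable_affine.
have mE1' : measurable_fun (`[0%R, tau[%classic : set R) (fun s => F1 (tau^-1 * s + 0)%R).
  apply: measurable_funS mE1 => //.
  by move=> s /=; rewrite !in_itv/= => /andP[-> /ltW ->].
rewrite [in LHS]E01 integral_setU//; last 2 first.
- apply/measurable_funU => //; split.
    apply: eq_measurable_fun mE1' => s; rewrite inE/= in_itv/= => hs; exact/esym/E1.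
  apply: eq_measurable_fun mE2 => s; rewrite inE/= in_itv/= => hs; exact/esym/E2.
- apply/disj_setPS => s [/=]; rewrite !in_itv/= => /andP[_ a] /andP[b _].
  by move: (lt_le_trans a b); rewrite ltxx.
rewrite (@integral_affine _ tau^-1 0%R _ F1)// ?invr_gt0//.
rewrite (@integral_affine _ (1 - tau)^-1%R (- (tau / (1 - tau)))%R _ F2)// ?invr_gt0//.
rewrite P1 P2 !muleA -!EFinM !divff ?gt_eqF// !mul1e; congr (_ + _).
  rewrite -integral_itv_bndo_bndc//.
  by apply: eq_integral => s; rewrite inE/= in_itv/= => hs; exact: E1.
by apply: eq_integral => s; rewrite inE/= in_itv/= => hs; exact: E2.
Qed.

Lemma measurable_field_affine (c a b : R) (S : set R) (v : V -> 'rV[R]_N) : measurable S ->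
  measurable_fun (`[0%R, 1%R]%classic `*` setT : set (R * T)) (v : R * T -> T) ->
  (forall t, S t -> `[0%R, 1%R]%classic (a * t + b)%R) ->
  measurable_fun (S `*` setT : set (R * T)) (fun z : R * T => c *: v (a * z.1 + b, z.2)%R : T).
Proof.
move=> mS mv S01.
have mpair : measurable_fun (S `*` setT : set (R * T)) (fun z : R * T => (a * z.1 + b, z.2)%R : R * T).
  apply: measurable_funTS; apply/measurable_fun_pairP; split => /=; last exact: measurable_snd.
  exact: (measurableT_comp (measurable_affine a b) measurable_fst).
apply: measurable_fun_Rn => [|i]; first exact: measurableX.
rewrite (_ : (fun _ => _) = (fun z : R * T => c * (v (a * z.1 + b, z.2) 0 i))%R); last first.
  by apply/funext => z; rewrite mxE.
apply: measurable_funM; first exact: measurable_cst.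
apply: (measurable_comp (F := (`[0%R, 1%R]%classic `*` setT : set (R * T)))
  (f := fun z : R * T => (v z) 0%R i)) mpair.
- exact: measurableX.
- by move=> _ [z [z01 _] <-]; split => //; exact: S01.
- exact: (measurableT_comp (measurable_coord i) mv).
Qed.

(* Running the first curve during a fraction l1 / (l1 + l2) of the time makes both
   rescaled velocities have the same modular at l1 + l2. *)
Lemma adm_trans l1 l2 mu nu xi : (0 < l1)%R -> (0 < l2)%R ->
  adm Omega p l1 mu nu -> adm Omega p l2 nu xi -> adm Omega p (l1 + l2) mu xi.
Proof.
move=> l10 l20 [rho1 [v1 [nrho1 [mv1 fv1 cev1] r10 r11 mod1]]]
  [rho2 [v2 [nrho2 [mv2 fv2 cev2] r20 r21 mod2]]].
have l0 : (0 < l1 + l2)%R by rewrite addr_gt0.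
pose tau := (l1 / (l1 + l2))%R; pose a1 := tau^-1%R.
pose a2 := ((1 - tau)^-1)%R; pose b2 := (- (tau / (1 - tau)))%R.
have t0 : (0 < tau)%R by rewrite divr_gt0.
have t1 : (tau < 1)%R by rewrite ltr_pdivrMr// mul1r ltrDl.
have tau01 : (0 < tau < 1)%R by rewrite t0.
have s0 : (0 < 1 - tau)%R by rewrite subr_gt0.
have a10 : (0 < a1)%R by rewrite invr_gt0.
have a20 : (0 < a2)%R by rewrite invr_gt0.
have b2E t : (a2 * t + b2 = (t - tau) / (1 - tau))%R by rewrite /a2 /b2; ring.
have S1 t : `[0%R, tau]%classic t -> `[0%R, 1%R]%classic (a1 * t + 0)%R.
  by rewrite /= !in_itv/= addr0 mulrC ler_pdivrMr// mul1r pmulr_lge0// invr_gt0.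
have S2 t : `[tau, 1%R]%classic t -> `[0%R, 1%R]%classic (a2 * t + b2)%R.
  rewrite /= !in_itv/= b2E => /andP[h1 h2].
  by rewrite pmulr_lge0 ?invr_gt0// subr_ge0 h1 ler_pdivrMr// mul1r lerD2r.
pose rho t := if (t < tau)%R then rho1 (a1 * t + 0)%R else rho2 (a2 * t + b2)%R.
pose v (z : V) := if (z.1 < tau)%R then a1 *: v1 (a1 * z.1 + 0, z.2)%R else a2 *: v2 (a2 * z.1 + b2, z.2)%R.
have a1t : (a1 * tau + 0 = 1)%R by rewrite addr0 mulVf ?gt_eqF.
have a2t : (a2 * tau + b2 = 0)%R by rewrite b2E subrr mul0r.
have a21 : (a2 * 1 + b2 = 1)%R by rewrite b2E divff ?gt_eqF.
(* At [tau] the curve takes the initial value of the second curve; it agrees with the final value of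
   the first one up to [measure_eq] only. *)
have E1 s : `[0%R, tau]%classic s -> measure_eq (rho1 (a1 * s + 0)%R) (rho s).
  rewrite /= in_itv/= => /andP[_]; rewrite le_eqVlt => /orP[/eqP->|st]; last by rewrite /rho st.
  by move=> A mA; rewrite /rho ltxx a1t a2t r11// r20.
have E2 s : `[tau, 1%R]%classic s -> measure_eq (rho2 (a2 * s + b2)%R) (rho s).
  by rewrite /= in_itv/= /rho leNgt => /andP[/negbTE -> _].
have cont (a b : R) : continuous (fun t : R => a * t + b)%R.
  by move=> y; apply: cvgD; [apply: cvgM; [exact: cvg_cst|exact: cvg_id]|exact: cvg_cst].
have nrho : narrow_curve Omega rho.
  move=> t t01; split.
    rewrite /rho; move: t01; rewrite /= in_itv/= => /andP[h0 h1].
    case: ltP => tt; [apply: (nrho1 _ _).1; apply: S1|apply: (nrho2 _ _).1; apply: S2].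
      by rewrite /= in_itv/= h0 ltW.
    by rewrite /= in_itv/= tt.
  move: t01; rewrite /= in_itv/= => /andP[h0 h1].
  apply: (narrow_cvg_glue (tau := tau)) => tt.
    have ts : `[0%R, tau]%classic t by rewrite /= in_itv/= h0.
    apply: (narrow_cvg_eq E1 (E1 _ ts)).
    exact: (@narrow_cvg_comp _ _ Omega rho1 _ (fun t => a1 * t + 0)%R t _ _ (cont _ _) S1 (nrho1 _ (S1 _ ts)).2).
  have ts : `[tau, 1%R]%classic t by rewrite /= in_itv/= tt.
  apply: (narrow_cvg_eq E2 (E2 _ ts)).
  exact: (@narrow_cvg_comp _ _ Omega rho2 _ (fun t => a2 * t + b2)%R t _ _ (cont _ _) S2 (nrho2 _ (S2 _ ts)).2).
have mv : measurable_fun (`[0%R, 1%R]%classic `*` setT : set (R * T)) (v : R * T -> T).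
  have -> : (`[0%R, 1%R]%classic `*` setT : set (R * T)) =
      (`[0%R, tau[%classic `*` setT) `|` (`[tau, 1%R]%classic `*` setT).
    apply/seteqP; split => -[t x] /=; rewrite !in_itv/=.
      move=> [/andP[h0 h1] _]; have [tt|tt] := ltP t tau; [left|right]; rewrite ?h0 ?h1//.
    by move=> [[/andP[h0 h1] _]|[/andP[h0 h1] _]]; split => //; apply/andP; split => //;
      [rewrite ltW// (lt_trans h1)|rewrite (le_trans _ h0)// ltW].
  have mA : measurable (`[0%R, tau[%classic `*` setT : set (R * T)) by exact: measurableX.
  have mB : measurable (`[tau, 1%R]%classic `*` setT : set (R * T)) by exact: measurableX.
  apply/(measurable_funU _ mA mB); split.
    have S1' t : `[0%R, tau[%classic t -> `[0%R, 1%R]%classic (a1 * t + 0)%R.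
      by move=> hs; apply: S1; move: hs; rewrite /= !in_itv/= => /andP[-> /ltW].
    apply: (eq_measurable_fun _ _ (@measurable_field_affine a1 a1 0%R (`[0%R, tau[%classic) v1 _ mv1 S1')) => //.
    by move=> z; rewrite inE => -[/=]; rewrite in_itv/= /v => /andP[_ ->].
  apply: (eq_measurable_fun _ _ (@measurable_field_affine a2 a2 b2 (`[tau, 1%R]%classic) v2 _ mv2 S2)) => //.
  by move=> z; rewrite inE => -[/=]; rewrite in_itv/= /v leNgt => /andP[/negbTE ->].
have mod12 : modular Omega p (l1 + l2) rho v <= 1.
  pose F1 s := \int[rho1 s]_(x in Omega) (enorm (l1^-1 *: v1 (s, x)) `^ p x)%:E.
  pose F2 s := \int[rho2 s]_(x in Omega) (enorm (l2^-1 *: v2 (s, x)) `^ p x)%:E.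
  have mF1 : measurable_fun (`[0%R, 1%R]%classic : set R) F1.
    apply: (@inner_measurable _ _ Omega oO _ (fun z => (enorm (l1^-1 *: v1 z) `^ p z.2)%:E)) => //.
    by apply/measurable_EFinP; exact: measurable_modular.
  have mF2 : measurable_fun (`[0%R, 1%R]%classic : set R) F2.
    apply: (@inner_measurable _ _ Omega oO _ (fun z => (enorm (l2^-1 *: v2 z) `^ p z.2)%:E)) => //.
    by apply/measurable_EFinP; exact: measurable_modular.
  rewrite /modular (@integral_split01 tau _ F1 F2 tau01 mF1 mF2); last 2 first.
  - move=> t /andP[_ tt]; rewrite /rho /F1 /v tt; apply: eq_integral => x _ /=.
    rewrite scalerA (_ : (l1 + l2)^-1 * a1 = l1^-1)%R// /a1 /tau; field.
    by rewrite !gt_eqF.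
  - move=> t /andP[tt _]; rewrite /rho /F2 /v ltNge tt; apply: eq_integral => x _ /=.
    rewrite scalerA (_ : (l1 + l2)^-1 * a2 = l2^-1)%R// /a2 /tau; field.
    by rewrite !gt_eqF//= addrC addKr gt_eqF.
  apply: (@le_trans _ _ (tau%:E * 1 + (1 - tau)%:E * 1)); last by rewrite !mule1 -EFinD addrC subrK.
  have w1 : 0 <= tau%:E by rewrite lee_fin ltW.
  have w2 : 0 <= (1 - tau)%:E by rewrite lee_fin ltW.
  exact: (leeD (lee_wpmul2l w1 mod1) (lee_wpmul2l w2 mod2)).
exists rho, v; split; first exact: nrho.
- split; first exact: mv.
  + apply: (le_lt_trans (enorm_integral_le oO mp p1 nrho mv l0 mod12)).
    by rewrite ltry.
  + move=> phi tphi; have [sphi _] := tphi; have C1 := sphi 1%N.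
    (* [phi] in the clock of each half. Neither function has to vanish at the junction, so each half
       leaves a boundary term there. The factors [a1] and [a2] restore the time derivative and make
       these two terms, weighted by [tau] and [1 - tau], cancel. *)
    pose q1 (z : V) := phi (tau * z.1 + 0, z.2)%R.
    pose q2 (z : V) := phi ((1 - tau) * z.1 + tau, z.2)%R.
    have sq1 : smooth_on setT q1 by exact: smooth_time_affine.
    have sq2 : smooth_on setT q2 by exact: smooth_time_affine.
    pose r1 (z : V) := (a1 * q1 z)%R; pose r2 (z : V) := (a2 * q2 z)%R.
    have sr1 : smooth_on setT r1 by move=> m; exact: CkZ (sq1 m).
    have sr2 : smooth_on setT r2 by move=> m; exact: CkZ (sq2 m).
    have kr1 : xcompact r1.
      by have [b Hb] := test_xcompact tphi; exists b => t x xb; rewrite /r1 /q1 Hb ?mulr0.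
    have kr2 : xcompact r2.
      by have [b Hb] := test_xcompact tphi; exists b => t x xb; rewrite /r2 /q2 Hb ?mulr0.
    have BF1 := boundary_formula oO OB nrho1 mv1 fv1 cev1 sr1 kr1.
    have BF2 := boundary_formula oO OB nrho2 mv2 fv2 cev2 sr2 kr2.
    have iT1 := integrable_tgrad oO OB nrho1 mv1 fv1 (sr1 1%N).
    have iT2 := integrable_tgrad oO OB nrho2 mv2 fv2 (sr2 1%N).
    rewrite (@integral_split01 tau _ (fun t => \int[rho1 t]_(x in Omega) (tgrad r1 v1 (t, x))%:E)
      (fun t => \int[rho2 t]_(x in Omega) (tgrad r2 v2 (t, x))%:E) tau01); last 4 first.
    * by apply: (@inner_measurable _ _ Omega oO _ (fun z => (tgrad r1 v1 z)%:E)) => //; exact: measurable_int iT1.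
    * by apply: (@inner_measurable _ _ Omega oO _ (fun z => (tgrad r2 v2 z)%:E)) => //; exact: measurable_int iT2.
    * move=> t /andP[_ tt]; rewrite /rho /v tt; apply: eq_integral => x _ /=; congr EFin.
      rewrite tgradZ; last exact: sq1.
      rewrite tgrad_time_affine//.
      rewrite (_ : tau * (a1 * t + 0) + 0 = t)%R; last by rewrite !addr0 mulrA divff ?mul1r// gt_eqF.
      rewrite mulrDr mulrA mulVf ?gt_eqF// mul1r mulr_sumr; congr (_ + _)%R.
      by apply: eq_bigr => i _; rewrite mxE mulrA.
    * move=> t /andP[tt _]; rewrite /rho /v ltNge tt; apply: eq_integral => x _ /=; congr EFin.
      rewrite tgradZ; last exact: sq2.
      rewrite tgrad_time_affine//.
      rewrite (_ : (1 - tau) * (a2 * t + b2) + tau = t)%R; last first.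
        by rewrite b2E mulrC divfK ?gt_eqF// subrK.
      rewrite mulrDr mulrA mulVf ?gt_eqF// mul1r mulr_sumr; congr (_ + _)%R.
      by apply: eq_bigr => i _; rewrite mxE mulrA.
    rewrite BF1 BF2.
    have T10 : timefun Omega rho1 r1 0 = 0%R.
      rewrite /timefun integral0_eq// => x _; have [h0 h1] := test_endpoints x tphi.
      by rewrite /r1 /q1/= mulr0 addr0 h0 mulr0.
    have T21 : timefun Omega rho2 r2 1 = 0%R.
      rewrite /timefun integral0_eq// => x _; have [h0 h1] := test_endpoints x tphi.
      by rewrite /r2 /q2/= mulr1 subrK h1 mulr0.
    have cphi := Ck_continuous C1.
    have Itau : (`[0%R, 1%R]%classic : set R) tau by rewrite /= in_itv/= !ltW.
    have I1 : (`[0%R, 1%R]%classic : set R) 1%R by rewrite /= in_itv/= ler01 lexx.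
    have I0 : (`[0%R, 1%R]%classic : set R) 0%R by rewrite /= in_itv/= ler01 lexx.
    have T11 : timefun Omega rho1 r1 1 = (a1 * timefun Omega rho phi tau)%R.
      apply: EFin_inj; rewrite EFinM (@timefunE _ _ Omega rho1 B oO OB r1 1%R (Ck_continuous (sr1 1%N)) I1) (@timefunE _ _ Omega rho B oO OB phi tau cphi Itau).
      rewrite -integralZl//; last exact: (@fin_inner _ _ Omega rho B oO OB phi tau cphi Itau).
      transitivity (\int[rho tau]_(x in Omega) (r1 (1, x))%:E).
        by apply: eq_measure_integral => A mA _; rewrite /rho ltxx a2t r11// r20.
      by apply: eq_integral => x _; rewrite /r1 /q1/= mulr1 addr0 EFinM.
    have T20 : timefun Omega rho2 r2 0 = (a2 * timefun Omega rho phi tau)%R.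
      apply: EFin_inj; rewrite EFinM (@timefunE _ _ Omega rho2 B oO OB r2 0%R (Ck_continuous (sr2 1%N)) I0) (@timefunE _ _ Omega rho B oO OB phi tau cphi Itau).
      rewrite -integralZl//; last exact: (@fin_inner _ _ Omega rho B oO OB phi tau cphi Itau).
      transitivity (\int[rho tau]_(x in Omega) (r2 (0, x))%:E).
        by apply: eq_measure_integral => A mA _; rewrite /rho ltxx a2t.
      by apply: eq_integral => x _; rewrite /r2 /q2/= mulr0 add0r EFinM.
    rewrite T10 T21 T11 T20 -!EFinM -EFinD; congr EFin.
    by rewrite subr0 sub0r mulrN !mulrA !divff ?gt_eqF// subrr.
- have I0 : (0 < tau)%R by [].
  by move=> A mA; rewrite /rho t0 mulr0 addr0 r10.
- by move=> A mA; rewrite /rho ltNge ltW//= a21 r21.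
- exact: mod12.
Qed.

End glue.

(** * From Wp to narrow convergence *)

Section portmanteau.
Context {R : realType} {N : nat}.
Local Notation T := (borelRn R N).
Variables (Omega : set 'rV[R]_N).
Hypotheses (oO : open Omega).
Local Open Scope ereal_scope.

Let mO : measurable (Omega : set T). Proof. exact: open_measurable_Rn. Qed.

Lemma count_layers (m : nat) (y : R) : (0 <= y <= m%:R)%R ->
  (\sum_(k < m) (k.+1%:R < y)%R%:R <= y <= \sum_(k < m) (k.+1%:R < y)%R%:R + 1)%R.
Proof.
move=> /andP[y0 ym].
suff: ((m%:R < y)%R -> \sum_(k < m) (k.+1%:R < y)%R%:R = m%:R :> R)%R /\
    ((y <= m%:R)%R -> \sum_(k < m) (k.+1%:R < y)%R%:R <= y <= \sum_(k < m) (k.+1%:R < y)%R%:R + 1)%R.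
  by case=> _; apply.
elim: m {ym} => [|m [IH1 IH2]].
  by rewrite !big_ord0 add0r; split => // yle; rewrite y0 (le_trans yle).
rewrite !big_ord_recr/=; split => h.
  rewrite h IH1; first by rewrite natr1.
  by apply: lt_trans h; rewrite ltr_nat.
rewrite ltNge h/= addr0; have [my|my] := leP y m%:R; first exact: IH2.
by rewrite IH1// ltW//= natr1.
Qed.

Section layers.
Variables (h : 'rV[R]_N -> R).
Hypotheses (ch : {within Omega, continuous h}) (h01 : forall x, Omega x -> (0 <= h x <= 1)%R).

Let G (m k : nat) : set 'rV[R]_N := [set x | Omega x /\ (k.+1%:R < m%:R * h x)%R].

Let mh : measurable_fun (Omega : set T) (h : T -> R).
Proof. exact: within_continuous_measurable_Rn. Qed.

Lemma open_layer m k : open (G m k).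
Proof.
rewrite openE => x [Ox hx]; rewrite /interior.
have cx : (m%:R * h y)%R @[y --> x] --> (m%:R * h x)%R.
  apply: (@cvgM R _ (nbhs x) _ (fun=> m%:R)%R h); first exact: cvg_cst.
  by move: ch; rewrite continuous_open_subspace// => /(_ x); rewrite inE; exact.
have H := cx _ (lt_nbhsr hx).
near=> y; split; first by near: y; exact: open_nbhs_nbhs.
by near: y; exact: H.
Unshelve. all: by end_near. Qed.

(** Up to an error 1, [m * h x] is the number of layers [G m k] that contain [x]. The layers being
    open, lower bounds on open sets pass to integrals with an error of order [1 / m]. *)
Lemma layer_bounds (mu : probability T R) (m : nat) : prob_on Omega mu ->
  (\sum_(k < m) fine (mu (G m k)) <= m%:R * fine (\int[mu]_(x in Omega) (h x)%:E)
    <= \sum_(k < m) fine (mu (G m k)) + 1)%R.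
Proof.
move=> muO; have muOT : mu (Omega : set T) < +oo by exact: prob_lty.
have mG k : measurable (G m k : set T) by apply: open_measurable_Rn; exact: open_layer.
have ih : mu.-integrable (Omega : set T) (EFin \o h).
  apply: (@integrable_bounded _ _ _ mu (Omega : set T) h 1%R) => // x Ox.
  by have /andP[a b] := h01 Ox; rewrite ger0_norm.
have fh : \int[mu]_(x in Omega) (h x)%:E \is a fin_num by apply: integrable_fin_num => //; exact: ih.
have SE : (\sum_(k < m) fine (mu (G m k)))%:E = \int[mu]_(x in Omega) (\sum_(k < m) ((k.+1%:R < m%:R * h x)%R%:R : R))%:E.
  rewrite -sumEFin; under [RHS]eq_integral do rewrite -sumEFin.
  rewrite [RHS](ge0_integral_sum _ mO (f := fun (k : 'I_m) x => ((k.+1%:R < m%:R * h x)%R%:R : R)%:E))//.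
    apply: eq_bigr => k _; rewrite fineK ?fin_num_measure//.
    transitivity (\int[mu]_(x in Omega) (\1_(G m k) x)%:E).
      rewrite integral_indic//; congr (mu _); apply/seteqP.
      by split => [x [Ox hx]|x []//]; split.
    apply: eq_integral => x; rewrite inE => Ox; rewrite indicE; congr EFin.
    have [hx|hx] := boolP (_ < _)%R; first by rewrite mem_set.
    by rewrite memNset// => -[_]; apply/negP.
  move=> k; apply/measurable_EFinP.
  apply: (@eq_measurable_fun _ _ _ _ _ (\1_(G m k) : T -> R)).
    move=> x; rewrite inE => Ox; rewrite indicE.
    have [hx|hx] := boolP (_ < _)%R; first by rewrite mem_set.
    by rewrite memNset// => -[_]; apply/negP.
  exact: measurable_indic.
have mS : measurable_fun (Omega : set T) (fun x : T => (\sum_(k < m) ((k.+1%:R < m%:R * h x)%R%:R : R))%R).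
  apply: measurable_sum => k.
  apply: (@eq_measurable_fun _ _ _ _ _ (\1_(G m k) : T -> R)).
    move=> x; rewrite inE => Ox; rewrite indicE.
    have [hx|hx] := boolP (_ < _)%R; first by rewrite mem_set.
    by rewrite memNset// => -[_]; apply/negP.
  exact: measurable_indic.
have hE : (m%:R * fine (\int[mu]_(x in Omega) (h x)%:E))%:E = \int[mu]_(x in Omega) (m%:R * h x)%:E.
  by rewrite EFinM fineK// -integralZl.
have S0 (x : 'rV[R]_N) : (0 <= \sum_(k < m) ((k.+1%:R < m%:R * h x)%R%:R : R))%R.
  by apply: sumr_ge0.
have mhm x : Omega x -> (0 <= m%:R * h x <= m%:R)%R.
  by move=> /h01/andP[a b]; rewrite mulr_ge0//= ler_piMr.
have mmh : measurable_fun (Omega : set T) (fun x : T => (m%:R * h x)%R) by apply: measurable_funM.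
rewrite -!lee_fin hE EFinD SE; apply/andP; split.
  apply: ge0_le_integral => //.
  - by move=> x _; rewrite lee_fin.
  - exact/measurable_EFinP.
  - exact/measurable_EFinP.
  - by move=> x /mhm/count_layers/andP[a _]; rewrite lee_fin.
have -> : 1 = \int[mu]_(x in Omega) 1 :> \bar R.
  by rewrite integral_cst// mul1e; exact/esym/muO.
rewrite -ge0_integralD//; last 2 first.
- by move=> x _; rewrite lee_fin.
- exact/measurable_EFinP.
apply: ge0_le_integral => //.
- by move=> x /mhm/andP[a _]; rewrite lee_fin.
- exact/measurable_EFinP.
- by apply: emeasurable_funD => //; exact/measurable_EFinP.
- by move=> x /mhm/count_layers/andP[_ b]; rewrite -EFinD lee_fin.
Qed.

Lemma liminf_integral (mu_ : nat -> probability T R) (mu : probability T R) (e : R) :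
  (forall n, prob_on Omega (mu_ n)) -> prob_on Omega mu ->
  (forall (U : set 'rV[R]_N) (d : R), open U -> (0 < d)%R ->
    \forall n \near \oo, fine (mu U) - d <= fine (mu_ n U))%R ->
  (0 < e)%R ->
  (\forall n \near \oo, fine (\int[mu]_(x in Omega) (h x)%:E) - e <= fine (\int[mu_ n]_(x in Omega) (h x)%:E))%R.
Proof.
move=> mu_O muO H e0.
(* With this [m], half of [e] absorbs the layer error [1 / m] and the other half the loss [e / 2]
   allowed on each layer. *)
have [m me] : exists m : nat, (1 < m%:R * (e / 2))%R.
  have e2 : (0 < e / 2)%R by lra.
  exists (Num.bound (e / 2)^-1)%R; rewrite -ltr_pdivrMr// mul1r archi_boundP//.
  by rewrite invr_ge0 ltW.
have e20 : (0 < e / 2)%R by lra.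
have H2 := @filter_forall _ 'I_m (fun k n => fine (mu (G m k)) - e / 2 <= fine (mu_ n (G m k)))%R \oo _
  (fun k => H _ _ (open_layer (m := m) (k := k)) e20).
apply: filterS (H2 _) => n Hn.
have m0 : (0 < m%:R :> R)%R.
  by case: m me {H2 Hn} => [|m _]; [rewrite mul0r ltr10|rewrite ltr0n].
rewrite -(ler_pM2l m0) mulrBr.
have /andP[a1 _] := layer_bounds m (mu_O n); apply: le_trans a1.
have /andP[_ a2] := layer_bounds m muO.
have a3 : (\sum_(k < m) fine (mu (G m k)) - m%:R * (e / 2) <= \sum_(k < m) fine (mu_ n (G m k)))%R.
  have -> : (m%:R * (e / 2) = \sum_(k < m) (e / 2))%R by rewrite sumr_const card_ord mulr_natl.
  by rewrite -sumrB; apply: ler_sum => k _; exact: Hn.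
apply: le_trans a3; rewrite lerBlDr; apply: (le_trans a2).
have -> : (m%:R * e = m%:R * (e / 2) + m%:R * (e / 2))%R by rewrite -mulrDr -splitr.
by rewrite addrA subrK lerD2l ltW.
Qed.

End layers.

(** The one-sided bound is applied to [(1 + f / K) / 2] and to [(1 - f / K) / 2], both with values
    in [0, 1]. As all masses are 1, this gives the two inequalities for [f]. *)
Lemma narrow_of_opens (mu_ : nat -> probability T R) (mu : probability T R) :
  (forall n, prob_on Omega (mu_ n)) -> prob_on Omega mu ->
  (forall (U : set 'rV[R]_N) (d : R), open U -> (0 < d)%R ->
    \forall n \near \oo, fine (mu U) - d <= fine (mu_ n U))%R ->
  narrow_cvg Omega \oo mu_ mu.
Proof.
move=> mu_O muO H f cf [M fM].
pose K := (`|M| + 1)%R; have K0 : (0 < K)%R by rewrite ltr_wpDl.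
have fK x : Omega x -> (- K <= f x <= K)%R.
  by move=> Ox; rewrite -ler_norml (le_trans (fM _ Ox))// (le_trans (ler_norm M))// lerDl.
have mf : measurable_fun (Omega : set T) (f : T -> R) by exact: within_continuous_measurable_Rn.
pose h (s : R) x := ((1 + s * (f x / K)) / 2)%R.
have ch s : {within Omega, continuous (h s)}.
  move=> x; apply: cvgM; last exact: cvg_cst.
  apply: cvgD; first exact: cvg_cst.
  apply: cvgM; first exact: cvg_cst.
  by apply: cvgM; [exact: cf|exact: cvg_cst].
have fK1 x : Omega x -> (- 1 <= f x / K <= 1)%R.
  by move=> /fK; rewrite ler_pdivrMr// ler_pdivlMr// mulN1r mul1r.
have h1 x : Omega x -> (0 <= h 1%R x <= 1)%R by move=> /fK1; rewrite /h; lra.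
have h2 x : Omega x -> (0 <= h (-1)%R x <= 1)%R by move=> /fK1; rewrite /h; lra.
have iF (m : probability T R) : m.-integrable (Omega : set T) (EFin \o f).
  apply: (@integrable_bounded _ _ _ m (Omega : set T) f K) => //; first exact: prob_lty.
  by move=> x /fK; rewrite ler_norml.
have fF (m : probability T R) : \int[m]_(x in Omega) (f x)%:E \is a fin_num.
  by apply: integrable_fin_num => //; exact: iF.
have hE (s : R) (m : probability T R) : prob_on Omega m ->
    fine (\int[m]_(x in Omega) (h s x)%:E) =
    ((1 + s * (fine (\int[m]_(x in Omega) (f x)%:E) / K)) / 2)%R.
  move=> mO1; apply: EFin_inj; rewrite fineK; last first.
    apply: integrable_fin_num => //.
    apply: (@integrable_bounded _ _ _ m (Omega : set T) (h s) ((1 + `|s|) / 2)%R) => //.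
    - exact: prob_lty.
    - exact: within_continuous_measurable_Rn.
    - move=> x Ox; rewrite normrM (@ger0_norm _ 2^-1%R)// ler_pM2r//.
      apply: (le_trans (ler_normD _ _)); rewrite normr1 lerD2l normrM ler_piMr// ler_norml.
      exact: fK1.
  transitivity (\int[m]_(x in Omega) (cst (2^-1)%:E x + ((s / K / 2)%:E * (f x)%:E))).
    by apply: eq_integral => x _; rewrite -EFinM -EFinD; congr EFin; rewrite /h; ring.
  rewrite integralD//; last 2 first.
  - by apply: finite_measure_integrable_cst.
  - exact: integrableZl (iF m).
  rewrite integral_cst// [X in _ * X]mO1 mule1 integralZl//; last exact: iF.
  rewrite -(fineK (fF m)) -EFinM -EFinD; congr EFin; ring.
rewrite -(fineK (fF mu)).
rewrite (_ : (fun n => _) = (fun n => (fine (\int[mu_ n]_(x in Omega) (f x)%:E))%:E)); last first.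
  by apply/funext => n; rewrite fineK.
apply: cvg_EFin; first by near=> n.
apply/cvgrPdist_le => e e0; rewrite /=.
have d0 : (0 < e / K / 2)%R by rewrite !divr_gt0.
have L1 := liminf_integral (ch 1%R) h1 mu_O muO H d0.
have L2 := liminf_integral (ch (-1)%R) h2 mu_O muO H d0.
apply: filterS2 L1 L2 => n; rewrite !hE//.
set a := fine (\int[mu]_(x in Omega) _); set b := fine _.
rewrite !mul1r !mulN1r => l1 l2.
have l3 : (a / K - e / K <= b / K)%R by lra.
have l4 : (b / K - e / K <= a / K)%R by lra.
rewrite -mulrBl ler_pM2r ?invr_gt0// in l3; rewrite -mulrBl ler_pM2r ?invr_gt0// in l4.
by rewrite ler_norml; apply/andP; split; lra.
Unshelve. all: by end_near. Qed.

End portmanteau.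

(** * Small costs and masses of open sets *)

Section lower_semicontinuity.
Context {R : realType} {N : nat}.
Local Notation T := (borelRn R N).
Variables (Omega : set 'rV[R]_N) (p : 'rV[R]_N -> R) (B : R).
Hypotheses (oO : open Omega) (OB : forall x, Omega x -> `|x| <= B).
Hypothesis mp : measurable_fun (Omega : set T) (p : T -> R).
Hypothesis p1 : forall x, Omega x -> 1 <= p x.
Local Open Scope ereal_scope.

Let mO : measurable (Omega : set T). Proof. exact: open_measurable_Rn. Qed.

(** [psi] lies below the indicator of [U] and is adapted to [mu] alone; its last property holds for
    every [nu]. *)
Lemma open_inner_test (mu : probability T R) (U : set 'rV[R]_N) (e : R) : prob_on Omega mu ->
  open U -> (0 < e)%R ->
  exists psi : 'rV[R]_N -> R, [/\ smooth_on setT psi, (exists b, forall x, b < `|x| -> psi x = 0)%R,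
    (forall x, 0 <= psi x <= 1)%R,
    (fine (mu U) - e <= fine (\int[mu]_(x in Omega) (psi x)%:E))%R &
    forall nu : probability T R, prob_on Omega nu ->
      (fine (\int[nu]_(x in Omega) (psi x)%:E) <= fine (nu U))%R].
Proof.
move=> muO oU e0.
have mU : measurable (U : set T) by exact: open_measurable_Rn.
have [psi [spsi kpsi psi01 psi0 psi1]] := open_smooth_approx oU.
have mpsi n : measurable_fun setT (psi n : T -> R).
  by apply: continuous_measurable_Rn; exact: (Ck_continuous (spsi n 0%N)).
have bpsi n x : (`|psi n x| <= 1)%R by have /andP[p0 p2] := psi01 n x; rewrite ger0_norm.
have ipsi n (m : probability T R) : m.-integrable (Omega : set T) (EFin \o psi n).
  apply: (@integrable_bounded _ _ _ m (Omega : set T) (psi n) 1%R) => //.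
  - exact: prob_lty.
  - exact: measurable_funS (mpsi n).
have fpsi n (m : probability T R) : \int[m]_(x in Omega) (psi n x)%:E \is a fin_num.
  by apply: integrable_fin_num => //; exact: ipsi.
have Uint (m : probability T R) : prob_on Omega m -> m U = \int[m]_(x in Omega) (\1_U x : R)%:E.
  by move=> mO1; rewrite integral_indic// (measure_setI1 mO mU (prob_setC0 mO mO1)).
have C : \int[mu]_(x in Omega) (psi n x)%:E @[n --> \oo] --> \int[mu]_(x in Omega) (\1_U x : R)%:E.
  apply: (@bounded_convergence _ _ _ mu (Omega : set T) psi (\1_U : T -> R) 1%R) => //.
  - exact: prob_lty.
  - by move=> n; exact: measurable_funS (mpsi n).
  - move=> x _; rewrite indicE; have [xU|xU] := pselect (U x).
      rewrite mem_set//; apply: cvg_near_cst; exact: psi1.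
    rewrite memNset//; apply: cvg_near_cst; near=> n; exact: psi0.
have [n hn] : exists n, (fine (mu U) - e <= fine (\int[mu]_(x in Omega) (psi n x)%:E))%R.
  rewrite -Uint// in C; rewrite -(fineK (fin_num_measure mu _ mU)) in C.
  have /fine_cvgP[_ /cvgrPdist_le/(_ _ e0)[k _ /(_ k)/=]] := C.
  by move=> /(_ (leqnn k)); rewrite ler_norml => /andP[_ h]; exists k; lra.
exists (psi n); split => // nu nuO.
rewrite fine_le//; first exact: fin_num_measure.
rewrite Uint//; apply: ge0_le_integral => //.
- by move=> x _; rewrite lee_fin; have /andP[] := psi01 n x.
- by apply/measurable_EFinP; exact: measurable_funS (mpsi n).
- by apply/measurable_EFinP; exact: measurable_indic.
- move=> x _; rewrite lee_fin indicE; have [xU|xU] := pselect (U x).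
    by rewrite mem_set//; have /andP[] := psi01 n x.
  by rewrite memNset// psi0.
Unshelve. all: by end_near. Qed.

Lemma narrow_liminf_open (mu_ : nat -> probability T R) (mu : probability T R) :
  (forall n, prob_on Omega (mu_ n)) -> prob_on Omega mu -> narrow_cvg Omega \oo mu_ mu ->
  forall (U : set 'rV[R]_N) (e : R), open U -> (0 < e)%R ->
    (\forall n \near \oo, fine (mu U) - e <= fine (mu_ n U))%R.
Proof.
move=> mu_O muO nc U e oU e0; have e2 : (0 < e / 2)%R by lra.
have [psi [spsi _ psi01 muU nuU]] := open_inner_test muO oU e2.
have bpsi x : (`|psi x| <= 1)%R by have /andP[a b] := psi01 x; rewrite ger0_norm.
have cpsi : continuous psi by exact: (Ck_continuous (spsi 0%N)).
have fpsi (m : probability T R) : \int[m]_(x in Omega) (psi x)%:E \is a fin_num.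
  apply: integrable_fin_num => //.
  apply: (@integrable_bounded _ _ _ m (Omega : set T) psi 1%R) => //; first exact: prob_lty.
  by apply: measurable_funTS; exact: continuous_measurable_Rn.
have bO : exists M : R, forall x, Omega x -> (`|psi x| <= M)%R by exists 1%R => x _; exact: bpsi.
have /= C := nc psi (continuous_subspaceT cpsi) bO.
rewrite -(fineK (fpsi mu)) in C.
have /fine_cvgP[_ /cvgrPdist_le/(_ _ e2)] := C.
apply: filterS => n; rewrite ler_norml => /andP[_ h].
have := nuU _ (mu_O n); rewrite /= in h; lra.
Qed.

(** The threshold [d] is fixed before [nu], so that it serves a whole sequence. The bound goes from
    the first measure to the second; symmetry of [adm] gives the other direction. *)
Lemma adm_open (mu : probability T R) (U : set 'rV[R]_N) (e : R) : prob_on Omega mu ->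
  open U -> (0 < e)%R ->
  exists2 d : R, (0 < d)%R & forall lam nu, (0 < lam < d)%R -> prob_on Omega nu ->
    adm Omega p lam mu nu -> (fine (mu U) - e <= fine (nu U))%R.
Proof.
move=> muO oU e0; have e2 : (0 < e / 2)%R by lra.
have [psi [spsi kpsi psi01 muU nuU]] := open_inner_test muO oU e2.
have [C0 C00 HC] := adm_test oO OB mp p1 spsi kpsi.
(* The 1 guards against [C0 = 0]. *)
exists (e / 2 / (C0 + 1))%R; first by rewrite !divr_gt0// ltr_wpDl.
move=> lam nu /andP[l0 l1] nuO ad; have := HC _ _ _ l0 muO nuO ad.
rewrite ler_norml => /andP[_ h1]; have h2 := nuU _ nuO.
have h3 : (C0 * lam <= e / 2)%R.
  move: l1; rewrite ltr_pdivlMr ?ltr_wpDl// => l1; apply: le_trans (ltW l1).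
  by rewrite mulrDr mulr1 mulrC lerDl ltW.
lra.
Qed.

Lemma Wp_eq0 (mu nu : probability T R) : prob_on Omega mu -> prob_on Omega nu ->
  Wp Omega p mu nu = 0 -> measure_eq mu nu.
Proof.
move=> muO nuO W0; apply: prob_eq_open => U oU.
have mU : measurable (U : set T) by exact: open_measurable_Rn.
have small (d : R) : (0 < d)%R -> exists2 l : R, (0 < l < d)%R & adm Omega p l mu nu.
  move=> d0; have [l [l0 ld ad]] : exists l, [/\ (0 < l)%R, (l < d)%R & adm Omega p l mu nu].
    by apply: Wp_lt_adm; rewrite W0 lte_fin.
  by exists l; rewrite ?l0.
have key (m1 m2 : probability T R) : prob_on Omega m1 -> prob_on Omega m2 ->
    (forall d, (0 < d)%R -> exists2 l : R, (0 < l < d)%R & adm Omega p l m1 m2) -> m1 U <= m2 U.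
  move=> m1O m2O sm; rewrite -(fineK (fin_num_measure m1 _ mU)) -(fineK (fin_num_measure m2 _ mU)) lee_fin.
  apply/ler_addgt0Pr => e e0; have [d d0 Hd] := adm_open m1O oU e0.
  have [l ld ad] := sm _ d0; have := Hd _ _ ld m2O ad; lra.
apply/eqP; rewrite eq_le key//= key// => d d0.
have [l ld ad] := small _ d0; exists l => //; exact: (adm_sym oO OB mp).
Qed.

Lemma narrow_of_Wp (mu_ : nat -> probability T R) (mu : probability T R) :
  (forall n, prob_on Omega (mu_ n)) -> prob_on Omega mu ->
  Wp Omega p (mu_ n) mu @[n --> \oo] --> 0 -> narrow_cvg Omega \oo mu_ mu.
Proof.
move=> mu_O muO W0; apply: narrow_of_opens => // U e oU e0.
have [d d0 Hd] := adm_open muO oU e0.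
have : \forall n \near \oo, Wp Omega p (mu_ n) mu < d%:E.
  have nb : nbhs (0 : \bar R) [set y | y < d%:E].
    by apply: open_nbhs_nbhs; split; [exact: open_ereal_lt_ereal|rewrite /= lte_fin].
  exact: (W0 _ nb).
apply: filterS => n /(@Wp_lt_adm _ _ Omega p)[l [l0 ld ad]].
by apply: (Hd l) => //; [rewrite l0|exact: (adm_sym oO OB mp)].
Qed.

End lower_semicontinuity.

(** * Curves given by flows *)

Section law.
Context {d d'} {L : measurableType d} {T' : measurableType d'} {R : realType}.
Variables (P : probability L R) (f : L -> T') (mf : measurable_fun setT f).
Local Open Scope ereal_scope.

Definition law : probability T' R := distribution P (mfun_Sub (mem_set mf)).

Lemma lawE A : law A = P (f @^-1` A). Proof. by []. Qed.

Lemma integral_law (D : set T') (h : T' -> \bar R) : measurable D ->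
  measurable_fun D h -> (forall l, D (f l)) ->
  \int[law]_(x in D) h x = \int[P]_l h (f l).
Proof.
move=> mD mh Df.
have fD : f @^-1` D = setT by apply/seteqP; split => // l _; exact: Df.
have pos (g : T' -> \bar R) : measurable_fun D g -> (forall x, 0 <= g x) ->
    \int[law]_(x in D) g x = \int[P]_l g (f l).
  move=> mg g0; rewrite -[in RHS]fD.
  by rewrite -(ge0_integral_pushforward mf P mD mg)// => x _.
rewrite [LHS]integralE [RHS]integralE.
rewrite (pos _ (measurable_funepos mh))// (pos _ (measurable_funeneg mh))//.
by congr (_ - _); apply: eq_integral => l _; rewrite ?(funeposE, funenegE).
Qed.

End law.

(** * Exchange of time and labels *)

Section fubini01.
Context {d} {L : measurableType d} {R : realType}.
Variables (P : probability L R) (h : R * L -> \bar R).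
Local Open Scope ereal_scope.
Local Notation leb := (@lebesgue_measure R).
Local Notation I01 := (`[0%R, 1%R]%classic : set R).
Hypothesis mh : measurable_fun (I01 `*` setT : set (R * L)) h.

Let g := h \_ (I01 `*` setT).

Let mI : measurable (I01 `*` setT : set (R * L)). Proof. exact: measurableX. Qed.

Let mg : measurable_fun setT g.
Proof. exact/(measurable_restrictT _ mI). Qed.

Let gE t l : I01 t -> g (t, l) = h (t, l).
Proof. by move=> t01; rewrite /g patchE mem_set. Qed.

Let g0 t l : ~ I01 t -> g (t, l) = 0.
Proof. by move=> t01; rewrite /g patchE memNset// => -[]. Qed.

Let inner1 (F : \bar R -> \bar R) : F 0 = 0 ->
  \int[leb]_(t in `[0%R, 1%R]) \int[P]_l F (h (t, l)) = \int[leb]_t \int[P]_l F (g (t, l)).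
Proof.
move=> F0; rewrite integral_mkcond; apply: eq_integral => t _; rewrite patchE.
have [t01|t01] := pselect (I01 t).
  by rewrite mem_set//; apply: eq_integral => l _; rewrite gE.
by rewrite memNset// integral0_eq// => l _; rewrite g0.
Qed.

Let inner2 : \int[P]_l \int[leb]_(t in `[0%R, 1%R]) h (t, l) = \int[P]_l \int[leb]_t g (t, l).
Proof.
apply: eq_integral => l _; rewrite integral_mkcond; apply: eq_integral => t _; rewrite patchE.
have [t01|t01] := pselect (I01 t); first by rewrite mem_set// gE.
by rewrite memNset// g0.
Qed.

Lemma tonelli01 : (forall z, 0 <= h z) ->
  \int[leb]_(t in `[0%R, 1%R]) \int[P]_l h (t, l) = \int[P]_l \int[leb]_(t in `[0%R, 1%R]) h (t, l).
Proof.
move=> h0; rewrite (inner1 (F := id) erefl) inner2.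
apply: (@fubini_tonelli _ _ _ _ _ leb P g mg) => -[t l].
by rewrite /g patchE; case: ifP.
Qed.

Lemma fubini01 : \int[leb]_(t in `[0%R, 1%R]) \int[P]_l `|h (t, l)| < +oo ->
  \int[leb]_(t in `[0%R, 1%R]) \int[P]_l h (t, l) = \int[P]_l \int[leb]_(t in `[0%R, 1%R]) h (t, l).
Proof.
rewrite (inner1 (F := abse) abse0) => H; rewrite (inner1 (F := id) erefl) inner2.
apply: (@Fubini _ _ _ _ _ leb P g).
apply: (proj2 (@integrable12ltyP _ _ (measurableTypeR R) L R leb P g mg)); exact: H.
Qed.

End fubini01.

(** * Curves carried by particles *)

Section flow.
Context {R : realType} {N : nat}.
Local Notation T := (borelRn R N).
Local Notation V := (R * 'rV[R]_N)%type.
Variables (Omega : set 'rV[R]_N) (p : 'rV[R]_N -> R) (B : R).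
Hypotheses (oO : open Omega) (OB : forall x, Omega x -> `|x| <= B).
Hypothesis mp : measurable_fun (Omega : set T) (p : T -> R).
Hypothesis p1 : forall x, Omega x -> 1 <= p x.
Local Open Scope ereal_scope.
Local Notation leb := (@lebesgue_measure R).
Local Notation I01 := (`[0%R, 1%R]%classic : set R).

Let mO : measurable (Omega : set T). Proof. exact: open_measurable_Rn. Qed.
Local Notation cylO := (@cyl R N Omega).

Context {d} {L : measurableType d} (P : probability L R).
Variables (X : R -> L -> 'rV[R]_N) (v : V -> 'rV[R]_N) (lam : R) (C : L -> \bar R).
Hypothesis l0 : (0 < lam)%R.
Hypothesis mX : measurable_fun setT (fun z : R * L => X z.1 z.2 : T).
Hypothesis cX : forall l, continuous (X^~ l).
Hypothesis XO : forall t l, I01 t -> Omega (X t l).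
Hypothesis mv : measurable_fun (I01 `*` setT : set (R * T)) (v : R * T -> T).
Hypothesis ce : forall l phi, test_function phi ->
  \int[leb]_(t in `[0%R, 1%R]) (tgrad phi v (t, X t l))%:E = 0.
Hypotheses (mC : measurable_fun setT C) (C1 : \int[P]_l C l <= 1).
Hypothesis modl : forall l,
  \int[leb]_(t in `[0%R, 1%R]) (enorm (lam^-1 *: v (t, X t l)) `^ p (X t l))%:E <= C l.

Let mXt t : measurable_fun setT (X t : L -> T).
Proof. exact: (measurableT_comp mX (pair1_measurable t)). Qed.

Let rho (t : R) : probability T R := law P (mXt t).

Let mgraph : measurable_fun (I01 `*` setT : set (R * L)) (fun z : R * L => (z.1, X z.1 z.2) : R * T).
Proof.
apply: measurable_funTS; apply/measurable_fun_pairP; split => /=; first exact: measurable_fst.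
exact: mX.
Qed.

Let mcomp (h : R * T -> \bar R) : measurable_fun cylO h ->
  measurable_fun (I01 `*` setT : set (R * L)) (fun z : R * L => h (z.1, X z.1 z.2)).
Proof.
move=> mh; apply: (measurable_comp (F := cylO) (f := h)) mgraph => //.
- exact: measurable_cyl.
- by move=> _ [z [z01 _] <-]; split => //; exact: XO.
Qed.

Let inner (h : R * T -> \bar R) t : measurable_fun cylO h -> I01 t ->
  \int[rho t]_(x in Omega) h (t, x) = \int[P]_l h (t, X t l).
Proof.
move=> mh t01.
apply: (@integral_law _ _ L T R P (X t) (mXt t) (Omega : set T) (fun x => h (t, x))) => //.
  apply: (measurable_comp (F := cylO) (f := h)) => //.
  - exact: measurable_cyl.
  - by move=> _ [x Ox <-]; split.
  - exact: measurable_funTS (pair1_measurable t).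
by move=> l; exact: XO.
Qed.

Let narrow_rho : narrow_curve Omega rho.
Proof.
move=> t0 t01; split; first by rewrite /prob_on/= lawE (_ : _ @^-1` _ = setT) ?probability_setT//;
  apply/seteqP; split => // l _; exact: XO.
move=> f cf [M fM].
have mf : measurable_fun (Omega : set T) (f : T -> R) by exact: within_continuous_measurable_Rn.
pose F t := \int[P]_l (f (X (clamp t) l))%:E.
have EF t : I01 t -> \int[rho t]_(x in Omega) (f x)%:E = F t.
  move=> h01; rewrite /F clamp_id//.
  apply: (@integral_law _ _ L T R P (X t) (mXt t) (Omega : set T) (fun x => (f x)%:E)) => //.
    exact/measurable_EFinP.
  by move=> l; exact: XO.
have mfX s : measurable_fun setT (fun l => f (X (clamp s) l)).
  apply: (@measurable_comp _ _ _ L T R (Omega : set T) f setT (X (clamp s))) => //.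
  by move=> _ [l _ <-]; apply: XO; exact: clamp_itv.
have iF s : P.-integrable setT (EFin \o (fun l => f (X (clamp s) l))).
  apply: (@integrable_bounded _ _ _ P setT (fun l => f (X (clamp s) l)) M) => //.
    exact: prob_lty.
  by move=> l _; apply: fM; apply: XO; exact: clamp_itv.
have fF s : F s \is a fin_num by apply: integrable_fin_num => //; exact: iF.
have cclamp : continuous (@clamp R).
  move=> s; apply: (@continuous_max R R^o (fun=> 0%R) (fun t : R^o => Num.min t 1%R)); first exact: cvg_cst.
  by apply: (@continuous_min R R^o id (fun=> 1%R)); [exact: cvg_id|exact: cvg_cst].
have cF : continuous (fine \o F).
  (* Continuity on the line is sequential, which brings it within reach of bounded convergence over
     the labels. *)
  move=> s; apply/(@cvg_nbhsP _ R^o) => u us.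
  have cc : F (u n) @[n --> \oo] --> F s.
    apply: (@bounded_convergence _ _ _ P setT (fun n l => f (X (clamp (u n)) l)) (fun l => f (X (clamp s) l)) M) => //.
    - exact: prob_lty.
    - by move=> n l _; apply: fM; apply: XO; exact: clamp_itv.
    - move=> l _.
      have h1 : clamp (u n) @[n --> \oo] --> clamp s by exact: (cvg_comp _ _ us (cclamp s)).
      have h2 : X (clamp (u n)) l @[n --> \oo] --> X (clamp s) l.
        exact: (cvg_comp _ _ h1 (@cX l (clamp s))).
      apply: (cvg_comp _ _ h2).
      move: cf; rewrite continuous_open_subspace// => /(_ (X (clamp s) l)); rewrite inE; apply.
      by apply: XO; exact: clamp_itv.
  by rewrite -(fineK (fF s)) in cc; exact: fine_cvg cc.
have cFE : F s @[s --> t0] --> F t0.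
  rewrite -(fineK (fF t0)) (_ : F = EFin \o (fine \o F)); last by apply/funext => s; rewrite /= fineK.
  by apply: cvg_EFin; [near=> s; rewrite /=|exact: cF].
rewrite EF// => A /cFE/= HA.
change (nbhs t0 (fun s => I01 s -> A (\int[rho s]_(x in Omega) (f x)%:E))).
by apply: (@filterS _ (nbhs t0) _ _ _ _ HA) => s As s01; rewrite EF.
Unshelve. all: by end_near. Qed.

(** Labels distributed by [P] follow the paths [X^~ l]. The weak equation holds path by path and is
    summed by Fubini; so is the modular, whose bound [C l] varies with the label so that rare labels
    may be costly. *)
Lemma adm_flow (mu nu : probability T R) :
  (forall A : set T, measurable A -> P (X 0%R @^-1` A) = mu A) ->
  (forall A : set T, measurable A -> P (X 1%R @^-1` A) = nu A) ->
  adm Omega p lam mu nu.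
Proof.
move=> r0 r1.
have mod1 : modular Omega p lam rho v <= 1.
  have mm : measurable_fun cylO (fun z => (enorm (lam^-1 *: v z) `^ p z.2)%:E).
    by apply/measurable_EFinP; exact: measurable_modular.
  rewrite /modular.
  rewrite [X in X <= _](_ : _ = \int[leb]_(t in `[0%R, 1%R]) \int[P]_l
    (enorm (lam^-1 *: v (t, X t l)) `^ p (X t l))%:E); last first.
    by apply: eq_integral => t; rewrite inE => t01; rewrite (inner mm t01).
  have mmX := mcomp mm.
  rewrite (tonelli01 P mmX); last by move=> z; rewrite lee_fin powR_ge0.
  apply: le_trans C1; apply: ge0_le_integral => //.
  - by move=> l _; apply: integral_ge0 => t _; rewrite lee_fin powR_ge0.
  - rewrite (_ : (fun _ => _) = (fun l => \int[leb]_t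
      ((fun z : R * L => (enorm (lam^-1 *: v (z.1, X z.1 z.2)) `^ p (X z.1 z.2))%:E) \_ (I01 `*` setT)) (t, l))); last first.
      apply/funext => l; rewrite integral_mkcond; apply: eq_integral => t _; rewrite !patchE.
      have [t01|t01] := pselect (I01 t); first by rewrite !mem_set.
      by rewrite !memNset// => -[].
    apply: (@measurable_fun_fubini_tonelli_G _ _ _ _ _ leb).
      have mI : measurable (I01 `*` setT : set (R * L)) by exact: measurableX.
      exact: ((measurable_restrictT _ mI).1 mmX).
    by move=> z; rewrite patchE; case: ifP => // _; rewrite lee_fin powR_ge0.
  - by move=> l _; exact: modl.
have fv := enorm_integral_le oO mp p1 narrow_rho mv l0 mod1.
have fv' : \int[leb]_(t in `[0%R, 1%R]) \int[rho t]_(x in Omega) (enorm (v (t, x)))%:E < +oo.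
  by apply: (le_lt_trans fv); rewrite ltry.
exists rho, v; split; [exact: narrow_rho| | | |exact: mod1].
- split; [exact: mv|exact: fv'|] => phi tphi; have [sphi _] := tphi.
  have iT := integrable_tgrad oO OB narrow_rho mv fv' (sphi 1%N).
  have mT : measurable_fun cylO (fun z => (tgrad phi v z)%:E) by exact: measurable_int iT.
  have mTX := mcomp mT.
  transitivity (\int[leb]_(t in `[0%R, 1%R]) \int[P]_l (tgrad phi v (t, X t l))%:E).
    by apply: eq_integral => t; rewrite inE => t01; exact: (inner mT t01).
  rewrite (fubini01 mTX).
    by rewrite integral0_eq// => l _; exact: ce.
  have mA : measurable_fun cylO (fun z => `|(tgrad phi v z)%:E|) by exact: measurableT_comp.
  rewrite [X in X < _](_ : _ = \int[leb]_(t in `[0%R, 1%R]) \int[rho t]_(x in Omega) `|(tgrad phi v (t, x))%:E|).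
    have mrho := narrow_curve_measurable oO narrow_rho.
    rewrite (@spacetime_cyl_ge0 _ _ _ _ mO mrho (fun z => `|(tgrad phi v z)%:E|))//.
    by have /integrableP[_] := iT.
  by apply: eq_integral => t; rewrite inE => t01; rewrite (inner mA t01).
- exact: r0.
- exact: r1.
Qed.

End flow.

Lemma measurable_fun_mem d (X : measurableType d) (D : set X) : measurable D ->
  measurable_fun setT (fun x => x \in D).
Proof.
move=> mD; apply: (measurable_fun_bool true); rewrite setTI.
rewrite (_ : _ @^-1` _ = D)//; apply/seteqP; split => x /=; first by move/set_mem.
exact: mem_set.
Qed.

(** * Test functions along a path *)

Section paths.
Context {R : realType} {N : nat}.
Local Notation T := (borelRn R N).
Local Notation V := (R * 'rV[R]_N)%type.
Local Notation leb := (@lebesgue_measure R).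
Local Notation I01 := (`[0%R, 1%R]%classic : set R).
Variables (Omega : set 'rV[R]_N).

Lemma integral_cst01 (k : R) : (\int[leb]_(t in `[0%R, 1%R]) k%:E = k%:E)%E.
Proof.
rewrite integral_cst// [X in (_ * X)%E](lebesgue_measure_itv `[0%R, 1%R])/= lte_fin ltr01.
by rewrite oppr0 adde0 mule1.
Qed.

Lemma convex_line : convex_set (Omega : set (convex_lmodType 'rV[R]_N)) ->
  forall x y t, Omega x -> Omega y -> (0 <= t <= 1)%R -> Omega ((1 - t) *: x + t *: y)%R.
Proof.
move=> cO x y t Ox Oy /andP[t0 t1].
have := cO y x (Itv01 t0 t1); rewrite !inE => /(_ Oy Ox).
by rewrite addrC.
Qed.

Lemma continuous_coord (X : topologicalType) (g : X -> 'rV[R]_N) i :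
  continuous g -> continuous (fun t => g t 0 i).
Proof. by move=> cg t; exact: (cvg_comp _ _ (cg t) (@coord_continuous _ _ _ 0 i (g t))). Qed.

Lemma measurable_along (h : R * T -> \bar R) (gam : R -> 'rV[R]_N) :
  measurable (Omega : set T) ->
  measurable_fun (cyl Omega) h -> continuous gam -> (forall t, I01 t -> Omega (gam t)) ->
  measurable_fun I01 (fun t => h (t, gam t)).
Proof.
move=> mO mh cg gO.
apply: (measurable_comp (F := cyl Omega) (f := h) (g := fun t : R => (t, gam t))) => //.
- exact: measurable_cyl.
- by move=> _ [t t01 <-]; split => //; exact: gO.
- apply: measurable_funTS; apply/measurable_fun_pairP; split; first exact: measurable_id.
  apply: measurable_fun_Rn => // i; apply: continuous_measurable_fun.
  exact: (@continuous_coord R gam i cg).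
Qed.

(** Where the field is the velocity of the path, the integrand is the derivative of
    [phi (t, gam t)], which vanishes at both ends. The time 1 is set apart because a field that
    steers to a target is singular there. *)
Lemma integral_tgrad_along phi v (gam w : R -> 'rV[R]_N) :
  test_function phi -> continuous gam -> continuous w ->
  (forall t, (0 <= t < 1)%R -> v (t, gam t) = w t) ->
  (forall t : R, is_derive t (1%R : R) (fun t => phi (t, gam t)) ('D_((1, w t) : V) phi (t, gam t))) ->
  (\int[leb]_(t in `[0%R, 1%R]) (tgrad phi v (t, gam t))%:E = 0)%E.
Proof.
move=> tphi cg cw vE dphi; have [sphi _] := tphi; have C1 := sphi 1%N.
pose F t := ('D_((1, w t) : V) phi (t, gam t))%R.
have FE t : F t = ('D_((1, 0) : V) phi (t, gam t) +
    \sum_(i < N) w t 0 i * 'D_((0, delta_mx 0 i) : V) phi (t, gam t))%R.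
  by rewrite /F derive_spacetime// mul1r.
have cpair : continuous (fun t : R => (t, gam t) : V).
  by move=> t; apply: (@cvg_pair _ _ _ _ (nbhs t) (nbhs (gam t))); [exact: cvg_id|exact: cg].
have cD (u : V) : continuous (fun t => 'D_u phi (t, gam t)).
  move=> t; have cdp := Ck_continuous (Ck_derive u C1).
  exact: (cvg_comp _ _ (cpair t) (cdp (t, gam t))).
have cF : continuous F.
  rewrite (_ : F = fun t => ('D_((1, 0) : V) phi (t, gam t) +
      \sum_(i < N) w t 0 i * 'D_((0, delta_mx 0 i) : V) phi (t, gam t))%R); last exact/funext.
  move=> t; apply: cvgD; first exact: cD.
  apply: (@continuous_bigsum _ _ _ _ (fun i (t : R^o) => w t 0 i * 'D_((0, delta_mx 0 i) : V) phi (t, gam t))%R).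
  move=> i s; apply: cvgM; last exact: cD.
  exact: (@continuous_coord R w i cw s).
have mF : measurable_fun setT F by exact: continuous_measurable_fun.
have E t : (0 <= t < 1)%R -> tgrad phi v (t, gam t) = F t.
  by move=> t01; rewrite FE /tgrad vE.
rewrite -integral_itv_bndo_bndc; last first.
  apply: (@eq_measurable_fun _ _ _ _ _ (EFin \o F)).
    by move=> t; rewrite inE/= in_itv/= => t01; rewrite E.
  by apply/measurable_EFinP; exact: measurable_funTS.
transitivity (\int[leb]_(t in `[0%R, 1%R[) (F t)%:E)%E.
  by apply: eq_integral => t; rewrite inE/= in_itv/= => t01; rewrite E.
rewrite integral_itv_bndo_bndc; last by apply/measurable_EFinP; exact: measurable_funTS.
rewrite (FTC2_derive (F := fun t => phi (t, gam t)))//.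
by rewrite (test_endpoints _ tphi).1 (test_endpoints _ tphi).2 subrr.
Qed.

End paths.

(** * Collapsing along segments *)

Section contraction.
Context {R : realType} {N : nat}.
Local Notation T := (borelRn R N).
Local Notation V := (R * 'rV[R]_N)%type.
Variables (Omega : set 'rV[R]_N) (p : 'rV[R]_N -> R) (B : R).
Hypotheses (oO : open Omega) (OB : forall x, Omega x -> `|x| <= B).
Hypothesis mp : measurable_fun (Omega : set T) (p : T -> R).
Hypothesis p1 : forall x, Omega x -> 1 <= p x.
Hypothesis cvO : convex_set (Omega : set (convex_lmodType 'rV[R]_N)).
Local Open Scope ereal_scope.
Local Notation leb := (@lebesgue_measure R).
Local Notation I01 := (`[0%R, 1%R]%classic : set R).

Let mO : measurable (Omega : set T). Proof. exact: open_measurable_Rn. Qed.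

Variables (c : 'rV[R]_N -> 'rV[R]_N) (lam : R).
Hypotheses (l0 : (0 < lam)%R) (mc : measurable_fun setT (c : T -> T)).
Hypothesis cO : forall x, Omega x -> Omega (c x).
Hypothesis cc : forall x t, Omega x -> (0 <= t < 1)%R -> c ((1 - t) *: x + t *: c x)%R = c x.
Hypothesis clam : forall x, Omega x -> (enorm (c x - x) <= lam)%R.

(* A particle started at x stays in the part of space where [c] equals [c x], so its
   position determines its target, hence its velocity. *)
Let v (z : V) : 'rV[R]_N := ((1 - z.1)^-1 *: (c z.2 - z.2))%R.

Let mv : measurable_fun (I01 `*` setT : set (R * T)) (v : R * T -> T).
Proof.
have mI : measurable (I01 `*` setT : set (R * T)) by exact: measurableX.
apply: measurable_fun_Rn => // i.
(* The power with exponent -1 is known to be measurable and equals the inverse on nonnegative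
   numbers, 0 included. *)
apply: (@eq_measurable_fun _ _ _ _ _ (fun z : R * T => (1 - z.1) `^ (-1) * (c z.2 0 i - z.2 0 i))%R).
  move=> z; rewrite inE => -[/=]; rewrite in_itv/= => /andP[_ z1] _.
  by rewrite !mxE powR_inv1// subr_ge0.
apply: measurable_funTS; apply: measurable_funM.
  apply: measurable_fun_powR2 => //.
  by apply: measurable_funB; [exact: measurable_cst|exact: measurable_fst].
apply: measurable_funB.
  exact: (measurableT_comp (measurable_coord i) (measurableT_comp mc measurable_snd)).
exact: (measurableT_comp (measurable_coord i) measurable_snd).
Qed.

Lemma adm_contraction (mu nu : probability T R) : prob_on Omega mu ->
  (forall A : set T, measurable A -> mu (c @^-1` A) = nu A) -> adm Omega p lam mu nu.
Proof.
move=> muO nuE.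
have [y0 Oy0] : exists y, Omega y.
  apply/(@set0P _ Omega); apply/eqP => O0; move: muO; rewrite /prob_on/= O0 measure0 => /eqP.
  by rewrite lt_eqF// lte_fin.
(* Starting points outside [Omega], which [mu] does not charge, are replaced by [y0] so that every
   path stays in [Omega]. *)
pose r (x : 'rV[R]_N) := if x \in Omega then x else y0.
have rO x : Omega (r x) by rewrite /r; case: ifPn => //; rewrite inE.
have mr : measurable_fun setT (r : T -> T).
  apply: measurable_fun_ifT => //.
  exact: measurable_fun_mem.
pose X t x := ((1 - t) *: r x + t *: c (r x))%R.
have X01 x t : I01 t -> Omega (X t x).
  by rewrite /= in_itv/= => t01; apply: convex_line => //; exact: cO.
have cX x : continuous (X^~ x).
  move=> t; apply: cvgD; apply: cvgZr_tmp; last exact: cvg_id.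
  by apply: cvgB; [exact: cvg_cst|exact: cvg_id].
have mX : measurable_fun setT (fun z : R * T => X z.1 z.2 : T).
  apply: measurable_fun_Rn => // i.
  rewrite (_ : (fun _ => _) = (fun z : R * T => (1 - z.1) * r z.2 0 i + z.1 * c (r z.2) 0 i)%R); last first.
    by apply/funext => z; rewrite !mxE.
  have mrs : measurable_fun setT (fun z : R * T => r z.2 : T) by exact: (measurableT_comp mr measurable_snd).
  apply: measurable_funD; apply: measurable_funM.
  - by apply: measurable_funB; [exact: measurable_cst|exact: measurable_fst].
  - exact: (measurableT_comp (measurable_coord i) mrs).
  - exact: measurable_fst.
  - exact: (measurableT_comp (measurable_coord i) (measurableT_comp mc mrs)).
have vX x t : (0 <= t < 1)%R -> v (t, X t x) = (c (r x) - r x)%R.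
  move=> t01; rewrite /v/= cc//.
  have -> : (c (r x) - X t x = (1 - t) *: (c (r x) - r x))%R.
    by apply/rowP => i; rewrite !mxE; ring.
  rewrite scalerA mulVf ?scale1r// subr_eq0 gt_eqF//.
  by have /andP[] := t01.
have rae (A : set T) : measurable A -> mu (r @^-1` A) = mu A.
  move=> mA; have OC := prob_setC0 mO muO.
  have mrA : measurable (r @^-1` A : set T) by rewrite -[X in measurable X]setTI; exact: mr.
  rewrite -(measure_setI1 mO mrA OC) -(measure_setI1 mO mA OC).
  congr (mu _); apply/seteqP; split => x [/= h Ox]; split => //.
    by move: h; rewrite /r mem_set.
  by rewrite /r mem_set.
have XE : X = fun t x => (r x + t *: (c (r x) - r x))%R.
  by apply/funext => t; apply/funext => x; apply/rowP => i; rewrite !mxE; ring.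
apply: (@adm_flow _ _ _ _ _ oO OB mp p1 _ T mu X v lam (fun=> 1)) => //.
- by move=> t x; exact: X01.
- move=> x phi tphi; apply: (@integral_tgrad_along _ _ phi v (X^~ x) (fun=> c (r x) - r x)%R) => //.
  + by move=> t; exact: cvg_cst.
  + by move=> t t01; exact: vX.
  + move=> t; have [sphi _] := tphi.
    have := @is_derive_line R V phi (sphi 1%N) (0%R, r x) (1%R, (c (r x) - r x)%R) t.
    have E s : ((0%R, r x) + s *: (1%R, (c (r x) - r x)) = (s, X s x) :> V)%R.
      by rewrite XE; congr (_, _); rewrite /= /GRing.scale/=; ring.
    rewrite E (_ : (fun h : R => _) = fun h => phi (h, X h x))//.
    by apply/funext => h; rewrite E.
- by rewrite integral_cst// mul1e; exact: probability_le1.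
- move=> x.
  rewrite (_ : 1 = \int[leb]_(t in `[0%R, 1%R]) 1%:E); last first.
    by rewrite integral_cst01.
  apply: ge0_le_integral => //.
  + by move=> t _; rewrite lee_fin powR_ge0.
  + apply: (@measurable_along _ _ Omega (fun z => (enorm (lam^-1 *: v z) `^ p z.2)%:E) (X^~ x)) => //.
      by apply/measurable_EFinP; exact: measurable_modular.
    by move=> t t01; exact: X01.
  + move=> t; rewrite /= in_itv/= => /andP[t0 t1]; rewrite lee_fin.
    have pX : (1 <= p (X t x))%R by apply: p1; apply: X01; rewrite /= in_itv/= t0.
    have eX : (enorm (lam^-1 *: v (t, X t x)) <= 1)%R.
      move: t1; rewrite le_eqVlt => /orP[/eqP->|t1].
        (* At time 1 the inverse of 0 is 0 by convention, so the velocity vanishes. *)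
        by rewrite /v/= subrr invr0 scale0r scaler0 enorm0.
      rewrite vX ?t0// enormZ ger0_norm ?invr_ge0 ?(ltW l0)// ler_pdivrMl// mulr1.
      exact: clam.
    have e0 := enorm_ge0 (lam^-1 *: v (t, X t x)).
    move: e0; rewrite le_eqVlt => /orP[/eqP<-|e0].
      by rewrite powR0// gt_eqF// (lt_le_trans ltr01).
    by apply: (le_trans (ge1r_powR _ pX)) => //; rewrite e0.
- move=> A mA; rewrite -(rae A mA); congr (mu _); apply/seteqP.
  by split => x /=; rewrite /X subr0 scale1r scale0r addr0.
- move=> A mA; rewrite -(nuE _ mA).
  have mcA : measurable (c @^-1` A : set T) by rewrite -[X in measurable X]setTI; exact: mc.
  rewrite -(rae _ mcA); congr (mu _); apply/seteqP.
  by split => x /=; rewrite /X subrr scale0r scale1r add0r.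
Qed.

End contraction.

(** A zero derivative, asked for in the form that a first order expansion yields, and on both sides
    even at [a] and [b]. *)
Lemma derive0_segment {R : realType} (W : R -> R) (a b : R) : a < b ->
  (forall s e, a <= s <= b -> 0 < e -> exists2 d, 0 < d &
    forall h, `|h| < d -> `|W (s + h) - W s| <= e * `|h|) ->
  W a = W b.
Proof.
move=> ab H.
have dW s : a <= s <= b -> is_derive s 1 W 0.
  move=> sab.
  have cW : (fun h : R => h^-1 *: ((W \o shift s) (h *: (1 : R)) - W s)) @ (0 : R)^' --> (0 : R).
    apply/cvgrPdist_le => e e0; have [d d0 Hd] := H s e sab e0.
    near=> h; rewrite sub0r normrN normrZ /= [h *: 1]mulr1 (addrC h).
    have h0 : h != 0 by near: h; exact: nbhs_dnbhs_neq.
    have hd : `|h| < d.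
      near: h; apply: dnbhs0_lt => //.
    rewrite normrV ?unitfE// ler_pdivrMl ?normr_gt0// mulrC.
    exact: Hd.
  by split; [apply/cvg_ex; exists 0|apply: cvg_lim].
have [||c cab] := @MVT R W (fun=> 0) a b ab.
- by move=> x; rewrite in_itv/= => /andP[ax xb]; apply: dW; rewrite !ltW.
- apply/subspace_continuousP => x; rewrite /= in_itv/= => xab.
  apply: cvg_within_filter.
  apply: differentiable_continuous; apply/derivable1_diffP.
  by have := dW x xab; case.
by rewrite mul0r => /eqP; rewrite subr_eq0 => /eqP.
Unshelve. all: by end_near. Qed.

(** * Moving mass along a segment *)

Section time_scale.
Context {R : realType}.
Local Notation leb := (@lebesgue_measure R).
Local Notation I01 := (`[0%R, 1%R]%classic : set R).
Variables (A : set R) (al be : R).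
Hypotheses (mA : measurable A) (AI : A `<=` `[0, 1]%classic).
Hypotheses (al0 : 0 < al) (be0 : 0 <= be) (ab1 : al + be * fine (leb A) = 1).

(** [clock s] is the time at which the traveller reaches the position [s]. Its speed there is the
    inverse of [rate s]: slow on [A], where the rate is [al + be], and faster elsewhere. The
    relation [ab1] makes the journey last one unit of time, and [al > 0] makes the clock a
    bi-Lipschitz bijection of the line. *)
Definition tau (s : R) : R := fine (leb (A `&` `]-oo, s]%classic)).
Definition clock (s : R) : R := al * s + be * tau s.
Definition rate (s : R) : R := al + be * \1_A s.

Let Afin (B : set R) : measurable B -> leb (A `&` B) \is a fin_num.
Proof.
move=> mB; rewrite ge0_fin_numE//; apply: (@le_lt_trans _ _ (leb `[0%R, 1%R])).
  by apply: le_measure; rewrite ?inE//; [exact: measurableI|move=> s [/AI]].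
by rewrite (lebesgue_measure_itv `[0%R, 1%R])/= lte_fin ltr01 oppr0 adde0 ltry.
Qed.

Lemma tauB a b : a <= b -> tau b - tau a = fine (leb (A `&` `]a, b]%classic)).
Proof.
move=> ab; apply/eqP; rewrite subr_eq; apply/eqP.
rewrite /tau -fineD ?Afin//; congr fine.
rewrite -measureU//; last 3 first.
- exact: measurableI.
- exact: measurableI.
- apply/seteqP; split => // s [[_ /=]]; rewrite in_itv/= => /andP[h _] [_ /=].
  by rewrite in_itv/= leNgt h.
congr (leb _); rewrite -setIUr; congr (A `&` _); apply/seteqP; split => s /=; rewrite !in_itv/=.
  by move=> sb; have [h|h] := leP s a; [right|left; rewrite sb].
by move=> [/andP[]//|h]; exact: le_trans ab.
Qed.

Lemma tauB_itv a b : a <= b -> 0 <= tau b - tau a <= b - a.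
Proof.
move=> ab; rewrite tauB// fine_ge0//= -lee_fin fineK ?Afin//.
apply: (@le_trans _ _ (leb `]a, b]%classic)).
  by apply: le_measure; rewrite ?inE//; exact: measurableI.
rewrite (lebesgue_measure_itv `]a, b])/= lte_fin.
by case: ltgtP ab => [h _|//|-> _]; rewrite ?subrr// -EFinB.
Qed.

Lemma clockB a b : clock b - clock a = al * (b - a) + be * (tau b - tau a).
Proof. by rewrite /clock; ring. Qed.

Lemma clock_lower a b : a <= b -> al * (b - a) <= clock b - clock a.
Proof.
move=> ab; rewrite clockB lerDl mulr_ge0//.
by have /andP[] := tauB_itv ab.
Qed.

Lemma clock_upper a b : a <= b -> clock b - clock a <= (al + be) * (b - a).
Proof.
by move=> ab; rewrite clockB mulrDl lerD2l ler_wpM2l//; have /andP[] := tauB_itv ab.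
Qed.

Lemma clock_dist a b : `|clock b - clock a| <= (al + be) * `|b - a|.
Proof.
wlog ab : a b / a <= b.
  by move=> H; have [|/ltW] := leP a b; [exact: H|move=> h; rewrite distrC [in leRHS]distrC; exact: H].
have h := clock_lower ab; have h0 : 0 <= al * (b - a) by rewrite mulr_ge0// ?subr_ge0// ltW.
rewrite !ger0_norm ?subr_ge0//; first exact: clock_upper.
by rewrite -subr_ge0; exact: le_trans h.
Qed.

Lemma clock0 : clock 0 = 0.
Proof.
rewrite /clock mulr0 add0r /tau (_ : leb _ = 0%E) ?mulr0//.
apply/eqP; rewrite eq_le measure_ge0 andbT -(@lebesgue_measure_set1 R 0).
apply: le_measure; rewrite ?inE//; first exact: measurableI.
by move=> s [/AI/=]; rewrite !in_itv/= => /andP[s0 _] s1; apply/eqP; rewrite eq_le s0 s1.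
Qed.

Lemma clock1 : clock 1 = 1.
Proof.
rewrite /clock mulr1 /tau -[RHS]ab1; congr (_ + _ * fine (leb _)).
by apply: setIidl => s /AI/=; rewrite !in_itv/= => /andP[].
Qed.

Lemma clock_lt a b : a < b -> clock a < clock b.
Proof.
move=> ab; rewrite -subr_gt0; apply: lt_le_trans (clock_lower (ltW ab)).
by rewrite mulr_gt0// subr_gt0.
Qed.

Lemma clock_le a b : (clock a <= clock b) = (a <= b).
Proof.
have [|ba] := leP a b; last by apply/negbTE; rewrite -ltNge; exact: clock_lt.
by rewrite le_eqVlt => /orP[/eqP->|/clock_lt/ltW]; rewrite ?lexx.
Qed.

Lemma clock_inj : injective clock.
Proof.
by move=> a b ab; apply/eqP; rewrite eq_le -(clock_le a b) -(clock_le b a) ab lexx.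
Qed.

Lemma clock_continuous : continuous clock.
Proof.
move=> s; apply/cvgrPdist_le => e e0.
have c0 : 0 < al + be by rewrite ltr_pwDl.
near=> r; apply: (le_trans (clock_dist _ _)).
rewrite -ler_pdivlMl// mulrC.
by near: r; apply: cvgr_dist_le; [exact: cvg_id|rewrite divr_gt0].
Unshelve. all: by end_near. Qed.

Lemma clock_surj t : exists s, clock s = t.
Proof.
pose X := `|t| / al; have X0 : 0 <= X by rewrite divr_ge0// ltW.
have aX : al * X = `|t| by rewrite mulrC divfK// gt_eqF.
have hX : clock X >= `|t|.
  by have := clock_lower X0; rewrite clock0 !subr0 aX.
have hN : clock (- X) <= - `|t|.
  have : - X <= 0 by rewrite oppr_le0.
  by move=> /clock_lower; rewrite clock0 !sub0r opprK aX lerNr.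
have NX : - X <= X by rewrite (@le_trans _ _ 0)// oppr_le0.
have [||s _ <-] := @IVT R clock (- X) X t NX; last by exists s.
  by apply: continuous_subspaceT => s; exact: clock_continuous.
rewrite ge_min le_max; apply/andP; split; apply/orP.
  by left; apply: (le_trans hN); rewrite lerNl -normrN ler_norm.
by right; apply: le_trans hX; exact: ler_norm.
Qed.

(** The inverse of [clock]; surjectivity of [clock] means that the default 0 is never resorted
    to. *)
Definition position (t : R) : R := xget 0 [set s | clock s = t].

Lemma positionK : cancel position clock.
Proof. by move=> t; exact: (@xgetPex _ 0 [set s | clock s = t] (clock_surj t)). Qed.

Lemma clockK : cancel clock position.
Proof.
by move=> s; apply: clock_inj; rewrite positionK.
Qed.

Lemma position_dist a b : `|position b - position a| <= al^-1 * `|b - a|.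
Proof.
wlog ab : a b / a <= b.
  by move=> H; have [|/ltW] := leP a b; [exact: H|move=> h; rewrite distrC [in leRHS]distrC; exact: H].
have pab : position a <= position b by rewrite -clock_le !positionK.
rewrite !ger0_norm ?subr_ge0// ler_pdivlMl//.
by have := clock_lower pab; rewrite !positionK.
Qed.

Lemma position_continuous : continuous position.
Proof.
move=> s; apply/cvgrPdist_le => e e0; near=> r; apply: (le_trans (position_dist _ _)).
rewrite ler_pdivrMl//.
by near: r; apply: cvgr_dist_le; [exact: cvg_id|rewrite mulr_gt0].
Unshelve. all: by end_near. Qed.

Lemma position0 : position 0 = 0. Proof. by rewrite -[in LHS]clock0 clockK. Qed.
Lemma position1 : position 1 = 1. Proof. by rewrite -[in LHS]clock1 clockK. Qed.

Lemma position01 t : `[0, 1]%classic t -> `[0, 1]%classic (position t).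
Proof.
rewrite /= !in_itv/= => /andP[t0 t1].
by rewrite -(clock_le 0) -(clock_le (position t)) clock0 clock1 positionK t0.
Qed.

Lemma rate_itv s : al <= rate s <= al + be.
Proof. by rewrite /rate indicE; case: (_ \in _); rewrite ?mulr1 ?mulr0 ?addr0 !lexx ?lerDl be0. Qed.

Lemma measurable_rate : measurable_fun setT rate.
Proof.
apply: measurable_funD; first exact: measurable_cst.
by apply: measurable_funM; [exact: measurable_cst|exact: measurable_indic].
Qed.

Local Open Scope ereal_scope.

Lemma integral_mrestr_lebesgue (D : set R) (f : R -> \bar R) : measurable D ->
  measurable_fun D f -> (forall x, D x -> 0 <= f x) ->
  \int[mrestr leb mA]_(x in D) f x = \int[leb]_(x in D `&` A) f x.
Proof.
move=> mD mf f0.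
have DE : D = (D `&` A) `|` (D `\` A) by rewrite setUIDK.
have mDA : measurable (D `&` A) by exact: measurableI.
have mDB : measurable (D `\` A) by exact: measurableD.
rewrite [in LHS]DE ge0_integral_setU//; last 3 first.
- by rewrite -DE.
- by rewrite -DE.
- by apply/disj_setPS => s [[_ ?] [_]].
rewrite [X in _ + X](_ : _ = 0) ?adde0; last first.
  apply: null_set_integral => //.
    by apply: measurable_funS mf => //; exact: subDsetl.
  by rewrite /= /mrestr setDKI measure0.
by apply: eq_measure_integral => C mC CD; rewrite /= /mrestr; congr (leb _); apply: setIidl => s /CD[].
Qed.

(** [clock] maps this measure to Lebesgue measure, so [dt] becomes [rate s ds] without
    differentiating [clock]. *)
Let m : measure (measurableTypeR R) R :=
  measure_add (mscale (NngNum (ltW al0)) leb) (mscale (NngNum be0) (mrestr leb mA)).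

Lemma integral_clock (F : R -> R) : measurable_fun I01 F ->
  \int[leb]_(t in `[0%R, 1%R]) (F t)%:E =
  \int[leb]_(s in `[0%R, 1%R]) (rate s * F (clock s))%:E.
Proof.
move=> mF; have mclock : measurable_fun setT clock.
  by apply: continuous_measurable_fun; exact: clock_continuous.
have pre : clock @^-1` I01 = I01.
  have e0 s : (0 <= clock s)%R = (0 <= s)%R by rewrite -[in LHS]clock0 clock_le.
  have e1 s : (clock s <= 1)%R = (s <= 1)%R by rewrite -[in LHS]clock1 clock_le.
  by apply/seteqP; split => s /=; rewrite !in_itv/= e0 e1.
have mE (B : set R) : measurable B -> m B = al%:E * leb B + be%:E * leb (B `&` A).
  by move=> _; exact: (measure_addE (mscale (NngNum (ltW al0)) leb) (mscale (NngNum be0) (mrestr leb mA)) B).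
rewrite (@integral_substitution _ _ (measurableTypeR R) m clock mclock); last 3 first.
- move=> x y xy.
  have -> : clock @^-1` `]x, y]%classic = `]position x, position y]%classic.
    have e1 s : (x < clock s)%R = (position x < s)%R.
      by rewrite -{1}(positionK x) ltNge clock_le -ltNge.
    have e2 s : (clock s <= y)%R = (s <= position y)%R by rewrite -{1}(positionK y) clock_le.
    by apply/seteqP; split => s /=; rewrite !in_itv/= e1 e2.
  have pxy : (position x <= position y)%R by rewrite -clock_le !positionK.
  rewrite mE// setIC -(fineK (Afin _))//.
  rewrite -tauB// (lebesgue_measure_itv `]position x, position y])/= lte_fin.
  rewrite -[in RHS](positionK x) -[in RHS](positionK y) clockB.
  case: ltgtP pxy => [h _|//|-> _]; last by rewrite !subrr !mulr0 !mule0 adde0 addr0.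
  by rewrite -EFinB -!EFinM -EFinD.
- by [].
- exact/measurable_EFinP.
have mFc : measurable_fun I01 (F \o clock).
  rewrite -pre; apply: (@measurable_comp _ _ _ R R R I01) => //.
    by move=> _ [s hs <-].
  exact: measurable_funTS.
have posneg (G : R -> \bar R) : measurable_fun I01 G -> (forall s, 0 <= G s) ->
    \int[m]_(s in I01) G s = \int[leb]_(s in I01) ((rate s)%:E * G s).
  move=> mG G0.
  rewrite ge0_integral_measure_add//.
  rewrite ge0_integral_mscale//.
  rewrite ge0_integral_mscale//.
  rewrite integral_mrestr_lebesgue//.
  rewrite integral_mkcondr/= -ge0_integralZl//; last by rewrite lee_fin ltW.
  have mGA : measurable_fun I01 (G \_ A).
    by apply/(measurable_restrict _ _ _).1 => //; apply: measurable_funS mG => //; exact: subIsetl.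
  have GA0 s : 0 <= (G \_ A) s by rewrite patchE; case: ifP.
  rewrite -ge0_integralZl// -ge0_integralD//; last 4 first.
  - by move=> s _; rewrite mule_ge0// lee_fin ltW.
  - exact: measurable_funeM.
  - by move=> s _; rewrite mule_ge0.
  - exact: measurable_funeM.
  apply: eq_integral => s _; rewrite /rate patchE indicE.
  case: (s \in A); rewrite ?mulr1 ?mulr0 ?mule0 ?adde0 ?addr0//.
  by rewrite EFinD ge0_muleDl// lee_fin ltW.
have rp s : (0 < rate s)%R by have /andP[h _] := rate_itv s; exact: lt_le_trans h.
rewrite pre [LHS]integralE [RHS]integralE !posneg//.
- congr (_ - _); apply: eq_integral => s _; rewrite ?(funeposE, funenegE) EFinM.
    by rewrite maxeMr ?lee_fin ?(ltW (rp s))// mule0.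
  by rewrite -muleN maxeMr ?lee_fin ?(ltW (rp s))// mule0.
- by apply: measurable_funeneg; exact/measurable_EFinP.
- by apply: measurable_funepos; exact/measurable_EFinP.
Qed.

End time_scale.

(** * Chain rule for a Lipschitz change of time *)

Section chain_rule.
Context {R : realType} {N : nat}.
Local Notation T := (borelRn R N).
Local Notation V := (R * 'rV[R]_N)%type.
Local Notation leb := (@lebesgue_measure R).
Local Notation I01 := (`[0%R, 1%R]%classic : set R).
Local Notation J12 := (`[(-1)%R, 2%R]%classic : set R).
Variables (A : set R) (al be : R).
Hypotheses (mA : measurable A) (AI : A `<=` `[0, 1]%classic).
Hypotheses (al0 : 0 < al) (be0 : 0 <= be) (ab1 : al + be * fine (leb A) = 1).
Local Notation clock := (clock A al be).
Local Notation rate := (rate A al be).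

Lemma continuous_bounded_itv (f : R -> R) : continuous f ->
  exists2 C, 0 <= C & forall s, J12 s -> `|f s| <= C.
Proof.
move=> cf; have cf' : continuous (f \o fst : V -> R).
  by move=> z; apply: (@continuous_comp _ _ _ fst f); [exact: cvg_fst|exact: cf].
have [C C0 HC] := continuous_bounded_box 0 cf'; exists C => // s.
rewrite /= in_itv/= => /andP[s1 s2]; apply: (HC s 0); rewrite ?normr0//.
by rewrite ler_norml s2 andbT (le_trans _ s1)// lerN2 ler1n.
Qed.

Lemma shift_itv (s h : R) : 0 <= s -> s <= 1 -> `|h| < 1 -> J12 s /\ J12 (s + h).
Proof.
move=> s0 s1; rewrite ltr_norml => /andP[? ?].
by rewrite /= !in_itv/=; split; apply/andP; split; lra.
Qed.

Lemma between_dist (h s r : R) : s < r <= s + h -> `|r - s| <= `|h|.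
Proof. by move=> /andP[? ?]; rewrite !ger0_norm; lra. Qed.

Lemma between_dist' (s h r : R) : s + h < r <= s -> `|r - s| <= `|h|.
Proof. by move=> /andP[? ?]; rewrite !ler0_norm; lra. Qed.

Lemma integrable_itv (f : R -> R) (C : R) (D : set R) : measurable_fun setT f ->
  (forall s, J12 s -> `|f s| <= C) -> measurable D -> D `<=` J12 ->
  leb.-integrable D (EFin \o f).
Proof.
move=> mf fC mD DJ.
apply: (@integrable_bounded _ _ _ leb D f C) => //.
- apply: (@le_lt_trans _ _ (leb J12)); first by apply: le_measure; rewrite ?inE//; exact: measurable_itv.
  by rewrite (lebesgue_measure_itv `[(-1)%R, 2%R])/= lte_fin; case: ifP => _; rewrite -?EFinB ltry.
- exact: measurable_funTS.
- by move=> s /DJ; exact: fC.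
Qed.

Lemma fine_lebesgue_itv (a b : R) : a <= b -> fine (leb `]a, b]%classic) = b - a.
Proof.
move=> ab; rewrite (lebesgue_measure_itv `]a, b])/= lte_fin.
by case: ltgtP ab => [h _|//|-> _]; rewrite ?subrr.
Qed.

Lemma Rintegral_rate (a b : R) : -1 <= a -> a <= b -> b <= 2 ->
  \int[leb]_(s in `]a, b]) rate s = clock b - clock a.
Proof.
move=> a1 ab b2.
have sub : `]a, b]%classic `<=` J12.
  move=> s /=; rewrite !in_itv/= => /andP[as_ sb]; apply/andP; split; first by rewrite ltW// (le_lt_trans a1).
  exact: le_trans b2.
rewrite clockB tauB// /rate RintegralD//; last 2 first.
- by apply: (@integrable_itv (fun=> al) `|al|) => //; exact: measurable_cst.
- apply: (@integrable_itv (fun s => be * \1_A s) be) => //.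
    by apply: measurable_funM; [exact: measurable_cst|exact: measurable_indic].
  by move=> s _; rewrite indicE; case: (_ \in _); rewrite ?mulr1 ?mulr0 ?normr0// ger0_norm.
congr (_ + _).
  by rewrite Rintegral_cst// fine_lebesgue_itv.
rewrite RintegralZl//; last first.
  apply: (@integrable_itv (\1_A) 1) => //.
  by move=> s _; rewrite indicE; case: (_ \in _); rewrite ?normr0 ?normr1.
by congr (_ * _); rewrite /Rintegral integral_indic//.
Qed.

Variables (phi : V -> R) (x w : 'rV[R]_N).
Hypothesis C1phi : Ck_on setT 1 phi.

Let g (s : R) : V := (clock s, x + s *: w).
Let q1 (s : R) : R := 'D_((1, 0) : V) phi (g s).
Let q2 (s : R) : R := 'D_((0, w) : V) phi (g s).
Let q (s : R) : R := rate s * q1 s + q2 s.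

Let cg : continuous g.
Proof.
move=> s; apply: (@cvg_pair _ _ _ _ (nbhs (clock s)) (nbhs (x + s *: w))).
  exact: clock_continuous.
by apply: cvgD; [exact: cvg_cst|apply: cvgZr_tmp; exact: cvg_id].
Qed.

Let cq1 : continuous q1.
Proof.
move=> s; have cdp := Ck_continuous (Ck_derive ((1, 0) : V) C1phi).
exact: (@cvg_comp R V R g (fun z => 'D_((1, 0) : V) phi z) _ _ _ (@cg s) (cdp (g s))).
Qed.

Let cq2 : continuous q2.
Proof.
move=> s; have cdp := Ck_continuous (Ck_derive ((0, w) : V) C1phi).
exact: (@cvg_comp R V R g (fun z => 'D_((0, w) : V) phi z) _ _ _ (@cg s) (cdp (g s))).
Qed.

Let rate_le s : `|rate s| <= al + be.
Proof.
have /andP[h1 h2] := rate_itv A al be0 s.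
by rewrite ger0_norm// (le_trans _ h1)// ltW.
Qed.

Let mq : measurable_fun setT q.
Proof.
apply: measurable_funD; last exact: continuous_measurable_fun.
by apply: measurable_funM; [exact: measurable_rate|exact: continuous_measurable_fun].
Qed.

Let iq (D : set R) : measurable D -> D `<=` J12 -> leb.-integrable D (EFin \o q).
Proof.
have [K1 K10 H1] := continuous_bounded_itv cq1; have [K2 K20 H2] := continuous_bounded_itv cq2.
apply: (@integrable_itv q ((al + be) * K1 + K2)) => // s sJ.
apply: (le_trans (ler_normD _ _)); rewrite lerD//; last exact: H2.
by rewrite normrM ler_pM//; exact: H1.
Qed.

Let near_q s0 e a b : J12 a -> J12 b -> a <= b ->
  (forall s, a < s <= b -> `|q1 s - q1 s0| <= e /\ `|q2 s - q2 s0| <= e) ->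
  `|\int[leb]_(s in `]a, b]) q s - (q1 s0 * (clock b - clock a) + q2 s0 * (b - a))|
    <= (al + be + 1) * e * (b - a).
Proof.
rewrite /= !in_itv/= => /andP[a1 _] /andP[_ b2] ab He.
have sub : `]a, b]%classic `<=` J12.
  move=> s /=; rewrite !in_itv/= => /andP[as_ sb]; apply/andP; split; first by rewrite ltW// (le_lt_trans a1).
  exact: le_trans b2.
have ir : leb.-integrable `]a, b]%classic (EFin \o rate).
  by apply: (@integrable_itv rate (al + be)) => //; exact: measurable_rate.
have ic (k : R) : leb.-integrable `]a, b]%classic (EFin \o (fun=> k)).
  by apply: (@integrable_itv (fun=> k) `|k|) => //; exact: measurable_cst.
have lab := fine_lebesgue_itv ab.
have E : q1 s0 * (clock b - clock a) + q2 s0 * (b - a) =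
    \int[leb]_(s in `]a, b]) (q1 s0 * rate s + q2 s0).
  rewrite RintegralD//; last exact: (integrableZl _ _ ir).
  by rewrite RintegralZl// Rintegral_rate// Rintegral_cst// lab.
have i2 : leb.-integrable `]a, b]%classic (EFin \o (fun s => q1 s0 * rate s + q2 s0)).
  apply: (@integrable_itv _ (`|q1 s0| * (al + be) + `|q2 s0|)) => //.
    apply: measurable_funD; last exact: measurable_cst.
    by apply: measurable_funM; [exact: measurable_cst|exact: measurable_rate].
  by move=> s _; apply: (le_trans (ler_normD _ _)); rewrite lerD2r normrM ler_wpM2l.
have iq' := iq (measurable_itv `]a, b]) sub.
rewrite E -RintegralB//.
have i3 : leb.-integrable `]a, b]%classic (EFin \o (fun s => q s - (q1 s0 * rate s + q2 s0))).
  exact: (integrableB _ iq' i2).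
apply: (le_trans (le_normr_Rintegral _ i3)) => //.
rewrite -lab -Rintegral_cst//; apply: le_Rintegral => //.
  exact: (integrable_norm i3).
move=> s; rewrite /= in_itv/= => /He[h1 h2].
rewrite (_ : _ - _ = rate s * (q1 s - q1 s0) + (q2 s - q2 s0)); last by rewrite /q; ring.
apply: (le_trans (ler_normD _ _)); rewrite [leRHS]mulrDl mul1r normrM.
exact: (lerD (ler_pM (normr_ge0 _) (normr_ge0 _) (rate_le s) h1) h2).
Qed.

(** [clock] is merely Lipschitz, so [phi (g s)] may fail to have a derivative. Subtracting the
    integral of the expected derivative cures this: an increment of [clock] is exactly an integral
    of [rate], so once the continuous factors [q1] and [q2] are frozen the irregular parts cancel
    and [W] has derivative 0 everywhere. *)
Lemma chain_rule_clock :
  (\int[leb]_(s in `[0%R, 1%R]) (rate s * 'D_((1, 0) : V) phi (clock s, x + s *: w) +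
    'D_((0, w) : V) phi (clock s, x + s *: w))%R%:E = (phi (1, x + w) - phi (0, x))%R%:E)%E.
Proof.
(* The integral starts at -1, and bounds hold up to 2, to leave room for two-sided increments at 0
   and at 1. *)
pose W s := phi (g s) - \int[leb]_(r in `]-1, s]) q r.
have JB a b : -1 <= a -> a <= b -> b <= 2 ->
    \int[leb]_(r in `]-1, b]) q r - \int[leb]_(r in `]-1, a]) q r = \int[leb]_(r in `]a, b]) q r.
  move=> a1 ab b2; apply: Rintegral_itvB; rewrite ?bnd_simp//.
  apply: iq => // s /=; rewrite !in_itv/= => /andP[s1 sb].
  by rewrite (ltW s1) (le_trans sb).
have W01 : W 0 = W 1.
  apply: derive0_segment => // s e /andP[s0 s1] e0.
  pose M := al + be + 1; have M0 : 0 < M by rewrite addr_gt0// ltr_pwDl.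
  (* Half of [e] pays for the expansion of [phi], the other half for freezing [q1] and [q2]; each
     error is at most [M * e1 * |h|]. *)
  pose e1 := e / (M + M); have e10 : 0 < e1 by rewrite divr_gt0// addr_gt0.
  have [d0 d00 H0] := C1_twodir C1phi (g s) (1, 0) (0, w) e10.
  have /cvgrPdist_le/(_ _ e10)[d1 d10 H1] := @cq1 s.
  have /cvgrPdist_le/(_ _ e10)[d2 d20 H2] := @cq2 s.
  have dM : 0 < d0 / M by rewrite divr_gt0.
  exists (Num.min (Num.min 1 (d0 / M)) (Num.min d1 d2)).
    by rewrite !lt_min ltr01 dM d10 d20.
  move=> h; rewrite !lt_min => /andP[/andP[h1 hd0] /andP[hd1 hd2]].
  have hM : `|h| * M < d0 by rewrite -ltr_pdivlMr.
  have E0 : s + h - s = h by ring.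
  have cd := clock_dist mA AI al0 be0 s (s + h); rewrite E0 in cd.
  have T1 : `|clock (s + h) - clock s| <= M * `|h|.
    by apply: (le_trans cd); rewrite ler_wpM2r// lerDl.
  have T2 : `|clock (s + h) - clock s| < d0 by apply: le_lt_trans T1 _; rewrite mulrC.
  have T3 : `|h| < d0.
    by apply: le_lt_trans hM; rewrite ler_peMr// lerDr addr_ge0// ltW.
  have := H0 _ _ T2 T3.
  have -> : g s + (clock (s + h) - clock s) *: ((1, 0) : V) + h *: ((0, w) : V) = g (s + h).
    rewrite /g; congr (_, _); rewrite /= /GRing.scale/=; first by ring.
    by apply/rowP => i; rewrite !mxE; ring.
  rewrite -/(q1 s) -/(q2 s) => F1.
  have [Js Jsh] := shift_itv s0 s1 h1.
  have [/andP[s_ge s_le] /andP[sh_ge sh_le]] : -1 <= s <= 2 /\ -1 <= s + h <= 2.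
    by move: Js Jsh; rewrite /= !in_itv/= => -> ->.
  have H12 r : `|r - s| <= `|h| -> `|q1 r - q1 s| <= e1 /\ `|q2 r - q2 s| <= e1.
    move=> rs; split.
      by have := H1 r; rewrite /ball_/= (distrC s) (distrC (q1 s)); apply; exact: le_lt_trans rs _.
    by have := H2 r; rewrite /ball_/= (distrC s) (distrC (q2 s)); apply; exact: le_lt_trans rs _.
  have F2 : `|\int[leb]_(r in `]-1, s + h]) q r - \int[leb]_(r in `]-1, s]) q r -
      (q1 s * (clock (s + h) - clock s) + q2 s * h)| <= M * e1 * `|h|.
    have [h0|h0] := leP 0 h.
      have ssh : s <= s + h by rewrite lerDl.
      rewrite JB//; have := @near_q s e1 s (s + h) Js Jsh ssh; rewrite E0 (ger0_norm h0); apply.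
      by move=> r /between_dist; exact: H12.
    have ssh : s + h <= s by rewrite gerDl ltW.
    have -> : \int[leb]_(r in `]-1, s + h]) q r - \int[leb]_(r in `]-1, s]) q r = - \int[leb]_(r in `]s + h, s]) q r.
      by rewrite -opprB JB.
    have := @near_q s e1 (s + h) s Jsh Js ssh; rewrite (_ : s - (s + h) = - h); last by ring.
    rewrite (_ : - _ - _ = - (\int[leb]_(r in `]s + h, s]) q r - (q1 s * (clock s - clock (s + h)) + q2 s * - h))); last by ring.
    rewrite normrN (ltr0_norm h0); apply.
    by move=> r /between_dist'; exact: H12.
  rewrite (_ : W (s + h) - W s = (phi (g (s + h)) - phi (g s) - (clock (s + h) - clock s) * q1 s - h * q2 s) -
    (\int[leb]_(r in `]-1, s + h]) q r - \int[leb]_(r in `]-1, s]) q r -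
      (q1 s * (clock (s + h) - clock s) + q2 s * h))); last by rewrite /W; ring.
  apply: (le_trans (ler_normB _ _)); apply: (le_trans (lerD F1 F2)).
  have -> : e * `|h| = e1 * (M * `|h|) + M * e1 * `|h|.
    by rewrite /e1; field; rewrite gt_eqF// addr_gt0.
  rewrite lerD2r ler_wpM2l// ?(ltW e10)//.
  have : `|clock (s + h) - clock s| + `|h| <= (al + be) * `|h| + `|h| by rewrite lerD2r.
  by rewrite /M (mulrDl (al + be)) mul1r.
have i01 : leb.-integrable `[0, 1]%classic (EFin \o q).
  by apply: iq => // s /=; rewrite !in_itv/= => /andP[? ?]; apply/andP; split; lra.
have I01E : \int[leb]_(r in `]0, 1]) q r = \int[leb]_(s in `[0, 1]) q s.
  rewrite Rintegral_itv_obnd_cbnd//.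
  by apply: iq => // s /=; rewrite !in_itv/= => /andP[? ?]; apply/andP; split; lra.
have N10 : -1 <= (0 : R) by rewrite oppr_le0.
have one2 : (1 : R) <= 2 by rewrite ler1n.
have fin01 : (\int[leb]_(s in `[0%R, 1%R]) (q s)%:E)%E \is a fin_num.
  by apply: integrable_fin_num => //; exact: i01.
rewrite -[LHS]/(\int[leb]_(s in `[0%R, 1%R]) (q s)%:E)%E -(fineK fin01); congr EFin.
rewrite -[LHS]/(\int[leb]_(s in `[0, 1]) q s) -I01E -(JB 0 1 N10 ler01 one2).
move: W01; rewrite /W /g clock0// clock1// scale0r addr0 scale1r => W01.
have -> : phi (1, x + w) = phi (0, x) - \int[leb]_(r in `]-1, 0]) q r + \int[leb]_(r in `]-1, 1]) q r.
  by rewrite W01 subrK.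
by ring.
Qed.

End chain_rule.

(** * The travelling point and its field *)

Section slow_path.
Context {R : realType} {N : nat}.
Local Notation T := (borelRn R N).
Local Notation V := (R * 'rV[R]_N)%type.
Local Notation leb := (@lebesgue_measure R).
Local Notation I01 := (`[0%R, 1%R]%classic : set R).
Variables (A : set R) (al be : R).
Hypotheses (mA : measurable A) (AI : A `<=` `[0, 1]%classic).
Hypotheses (al0 : 0 < al) (be0 : 0 <= be) (ab1 : al + be * fine (leb A) = 1).
Variables (x w : 'rV[R]_N).
Hypothesis w0 : w != 0.
Local Notation clock := (clock A al be).
Local Notation rate := (rate A al be).
Local Notation pos := (position A al be).

Definition slow_path (t : R) : 'rV[R]_N := x + pos t *: w.

(** The field lives on the graph of the path alone. Mass at rest is thus left undisturbed: the path
    is injective, so it passes a given place at one instant at most. *)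
Definition slow_field (z : V) : 'rV[R]_N :=
  if z.2 == slow_path z.1 then (rate (pos z.1))^-1 *: w else 0.

Lemma slow_path_continuous : continuous slow_path.
Proof.
move=> t; apply: cvgD; first exact: cvg_cst.
by apply: cvgZr_tmp; exact: position_continuous.
Qed.

Lemma measurable_slow_path : measurable_fun setT (slow_path : R -> T).
Proof.
apply: measurable_fun_Rn => // i; apply: continuous_measurable_fun.
exact: (@continuous_coord _ _ R slow_path i slow_path_continuous).
Qed.

Lemma slow_path0 : slow_path 0 = x.
Proof. by rewrite /slow_path position0// scale0r addr0. Qed.

Lemma slow_path1 : slow_path 1 = x + w.
Proof. by rewrite /slow_path position1// scale1r. Qed.

Lemma slow_path_inj : injective slow_path.
Proof.
move=> s t /addrI /eqP; rewrite -subr_eq0 -scalerBl scaler_eq0 (negPf w0) orbF subr_eq0 => /eqP.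
by move=> /(congr1 clock); rewrite !positionK.
Qed.

Lemma slow_fieldE t : slow_field (t, slow_path t) = (rate (pos t))^-1 *: w.
Proof. by rewrite /slow_field /= eqxx. Qed.

Lemma slow_field_static (z : 'rV[R]_N) : exists t0, forall t, t != t0 -> slow_field (t, z) = 0.
Proof.
have [[t0 zt0]|nz] := pselect (exists t0, z = slow_path t0).
  exists t0 => t tt0; rewrite /slow_field/= ifF// zt0; apply/negbTE; apply: contra tt0.
  by move=> /eqP/slow_path_inj->.
exists 0 => t _; rewrite /slow_field/= ifF//; apply/negbTE/eqP => zt; apply: nz.
by exists t.
Qed.

Lemma rate_gt0 s : 0 < rate s.
Proof. by have /andP[h _] := rate_itv A al be0 s; exact: lt_le_trans h. Qed.

Lemma measurable_rate_pos : measurable_fun setT (fun t => rate (pos t)).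
Proof.
apply: (@measurableT_comp _ _ _ R R R rate _ pos); first exact: measurable_rate.
by apply: continuous_measurable_fun; exact: position_continuous.
Qed.

Lemma measurable_slow_field (D : set (R * T)) : measurable D -> measurable_fun D (slow_field : R * T -> T).
Proof.
move=> mD.
have mpath : measurable_fun setT (fun z : R * T => slow_path z.1 : T).
  exact: (measurableT_comp measurable_slow_path measurable_fst).
have mdist : measurable_fun setT (fun z : R * T => enorm (z.2 - slow_path z.1)).
  apply: measurable_enorm_comp; apply: measurable_fun_Rn => // i.
  rewrite (_ : (fun _ => _) = (fun z : R * T => z.2 0 i - slow_path z.1 0 i)); last first.
    by apply/funext => z; rewrite !mxE.
  apply: measurable_funB; first exact: (measurableT_comp (measurable_coord i) measurable_snd).
  exact: (measurableT_comp (measurable_coord i) mpath).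
have on_path (z : R * T) : (z.2 == slow_path z.1) = (enorm (z.2 - slow_path z.1) == 0).
  apply/eqP/eqP => [->|h]; first by rewrite subrr enorm0.
  apply/rowP => i; apply/eqP; rewrite -subr_eq0 -normr_le0 -h.
  by have := coord_le_enorm (z.2 - slow_path z.1) i; rewrite !mxE.
have mrate : measurable_fun setT (fun z : R * T => (rate (pos z.1))^-1).
  rewrite (_ : (fun _ => _) = (fun z : R * T => rate (pos z.1) `^ (-1))); last first.
    by apply/funext => z; rewrite powR_inv1// ltW// rate_gt0.
  apply: measurable_fun_powR2 => //.
  exact: (measurableT_comp measurable_rate_pos measurable_fst).
apply: measurable_fun_Rn => // i; apply: measurable_funTS.
rewrite (_ : (fun _ => _) = (fun z : R * T =>
    if enorm (z.2 - slow_path z.1) == 0 then (rate (pos z.1))^-1 * w 0 i else 0)); last first.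
  by apply/funext => z; rewrite /slow_field on_path; case: ifP; rewrite !mxE.
apply: measurable_fun_ifT => //.
  exact: measurable_fun_eqr.
by apply: measurable_funM => //; exact: measurable_cst.
Qed.

(** The substitution [t = clock s] brings a factor [rate s], which cancels the inverse rate in the
    field and leaves the integrand of the chain rule. *)
Lemma integral_tgrad_slow (phi : V -> R) : test_function phi ->
  (\int[leb]_(t in `[0%R, 1%R]) (tgrad phi slow_field (t, slow_path t))%:E = 0)%E.
Proof.
move=> tphi; have [sphi _] := tphi; have C1 := sphi 1%N.
pose F t := 'D_((1, 0) : V) phi (t, slow_path t) + (rate (pos t))^-1 * 'D_((0, w) : V) phi (t, slow_path t).
have TE t : tgrad phi slow_field (t, slow_path t) = F t.
  rewrite /tgrad slow_fieldE /F; congr (_ + _).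
  have := derive_spacetime C1 (t, slow_path t) 0 w; rewrite mul0r add0r => ->.
  by rewrite mulr_sumr; apply: eq_bigr => i _; rewrite mxE mulrA.
under eq_integral do rewrite TE.
have cpair : continuous (fun t : R => (t, slow_path t) : V).
  by move=> t; apply: (@cvg_pair _ _ _ _ (nbhs t) (nbhs (slow_path t))); [exact: cvg_id|exact: slow_path_continuous].
have mD (u : V) : measurable_fun setT (fun t : R => 'D_u phi (t, slow_path t)).
  apply: continuous_measurable_fun => t; have cdp := Ck_continuous (Ck_derive u C1).
  exact: (@cvg_comp R V R _ (fun z => 'D_u phi z) _ _ _ (cpair t) (cdp (t, slow_path t))).
have mF : measurable_fun I01 F.
  apply: measurable_funTS; apply: measurable_funD => //; apply: measurable_funM => //.
  rewrite (_ : (fun _ => _) = (fun t : R => rate (pos t) `^ (-1))); last first.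
    by apply/funext => z; rewrite powR_inv1// ltW// rate_gt0.
  by apply: measurable_fun_powR2 => //; exact: measurable_rate_pos.
rewrite (integral_clock mA AI al0 be0 ab1 mF).
transitivity (\int[leb]_(s in `[0%R, 1%R]) (rate s * 'D_((1, 0) : V) phi (clock s, x + s *: w) +
    'D_((0, w) : V) phi (clock s, x + s *: w))%R%:E)%E.
  apply: eq_integral => s _; congr EFin; rewrite /F /slow_path clockK// mulrDr; congr (_ + _).
  by rewrite mulrA divff ?mul1r// gt_eqF// rate_gt0.
rewrite (chain_rule_clock mA AI al0 be0 ab1 x w C1).
by rewrite (test_endpoints _ tphi).1 (test_endpoints _ tphi).2 subrr.
Qed.

End slow_path.

(** * Moving a small mass over a long distance *)

Section move.
Context {R : realType} {N : nat}.
Local Notation T := (borelRn R N).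
Local Notation V := (R * 'rV[R]_N)%type.
Variables (Omega : set 'rV[R]_N) (p : 'rV[R]_N -> R) (B : R).
Hypotheses (oO : open Omega) (OB : forall x, Omega x -> `|x| <= B).
Hypothesis mp : measurable_fun (Omega : set T) (p : T -> R).
Hypothesis p1 : forall x, Omega x -> 1 <= p x.
Hypothesis cvO : convex_set (Omega : set (convex_lmodType 'rV[R]_N)).
Local Notation leb := (@lebesgue_measure R).
Local Notation I01 := (`[0%R, 1%R]%classic : set R).

Let mO : measurable (Omega : set T). Proof. exact: open_measurable_Rn. Qed.

(* On the set of positions where p exceeds M, which has small length, the speed
   is kept below lam; elsewhere p <= M bounds the modular. *)
Lemma slow_parameters (x y : 'rV[R]_N) (lam : R) : Omega x -> Omega y -> 0 < lam ->
  exists (A : set R) (al be M : R),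
    [/\ measurable A, A `<=` `[0, 1]%classic, 1 <= M & [/\ 0 < al, 0 <= be, al + be * fine (leb A) = 1,
     enorm (y - x) <= lam * (al + be) &
     forall s, `[0, 1]%classic s -> ~ A s -> p (x + s *: (y - x)) <= M]].
Proof.
move=> Ox Oy l0.
have seg s : I01 s -> Omega (x + s *: (y - x)).
  rewrite /= in_itv/= => s01; have := convex_line cvO Ox Oy s01.
  by rewrite (_ : (1 - s) *: x + s *: y = x + s *: (y - x))//; apply/rowP => i; rewrite !mxE; ring.
pose A (n : nat) := I01 `&` [set s | n%:R < p (x + s *: (y - x))].
have mps : measurable_fun I01 (fun s => p (x + s *: (y - x))).
  apply: (@measurable_comp _ _ _ R T R (Omega : set T) p I01 (fun s => x + s *: (y - x))) => //.
    by move=> _ [s s01 <-]; exact: seg.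
  apply: measurable_funTS; apply: measurable_fun_Rn => // i; apply: continuous_measurable_fun.
  apply: (@continuous_coord _ _ R (fun s : R => x + s *: (y - x)) i).
  by move=> s; apply: cvgD; [exact: cvg_cst|apply: cvgZr_tmp; exact: cvg_id].
have mA n : measurable (A n).
  have := mps (measurable_itv _) `]n%:R, +oo[%classic (measurable_itv _).
  by congr (measurable (_ `&` _)); apply/seteqP; split => s /=; rewrite in_itv/= andbT.
have cA : leb (A n) @[n --> \oo] --> leb (\bigcap_n A n).
  apply: nonincreasing_cvg_mu => //.
  - apply: (@le_lt_trans _ _ (leb I01)); first by apply: le_measure; rewrite ?inE; [exact: mA|exact: measurable_itv|exact: subIsetl].
    by rewrite (lebesgue_measure_itv `[0%R, 1%R])/= lte_fin ltr01 oppr0 adde0 ltry.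
  - exact: bigcapT_measurable.
  - move=> m n mn; apply/subsetPset => s [s01 h]; split => //=.
    by apply: le_lt_trans h; rewrite ler_nat.
have A0 : \bigcap_n A n = set0.
  apply/seteqP; split => // s As.
  have [_ /=] := As (Num.bound `|p (x + s *: (y - x))|) I.
  by rewrite ltNge (le_trans (ler_norm _))// ltW// archi_boundP.
rewrite A0 measure0 in cA.
pose kap := enorm (y - x) / lam; have k0 : 0 <= kap by rewrite divr_ge0 ?enorm_ge0// ltW.
(* Below this length of [A] the product [(kap + 1) * |A|] is less than 1/2. So [be = kap + 1] leaves
   [al > 1 / 2], and [al + be >= kap] brings the speed on [A] down to [lam]. *)
have e0 : 0 < (2 * (kap + 1))^-1 by rewrite invr_gt0 mulr_gt0// ltr_wpDl.
have nb : nbhs (0 : \bar R) [set z | (z < ((2 * (kap + 1))^-1)%:E)%E].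
  by apply: open_nbhs_nbhs; split; [exact: open_ereal_lt_ereal|rewrite /= lte_fin].
(* The successor ensures that [M] is at least 1. *)
have [n0 _ Hn0] := cA _ nb; have /= An0 := Hn0 n0.+1 (leqnSn n0).
have An0f : leb (A n0.+1) = (fine (leb (A n0.+1)))%:E.
  by rewrite fineK// ge0_fin_numE// (lt_le_trans An0)// leey.
have l0A : 0 <= fine (leb (A n0.+1)) by rewrite fine_ge0.
rewrite An0f lte_fin in An0.
have half : (kap + 1) * fine (leb (A n0.+1)) < 2^-1.
  have k1 : 0 < kap + 1 by rewrite ltr_wpDl.
  have -> : 2^-1 = (kap + 1) * (2 * (kap + 1))^-1 :> R by field; rewrite gt_eqF.
  by rewrite ltr_pM2l.
exists (A n0.+1), (1 - (kap + 1) * fine (leb (A n0.+1))), (kap + 1), n0.+1%:R; split.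
- exact: mA.
- by move=> s [].
- by rewrite ler1n.
split.
- lra.
- lra.
- by rewrite subrK.
- rewrite mulrC -ler_pdivrMr// -/kap; lra.
- by move=> s s01 nA; rewrite leNgt; apply/negP => h; apply: nA; split.
Qed.

Local Open Scope ereal_scope.

Lemma integral_ae1 (F G : R -> \bar R) (t0 : R) : measurable_fun I01 F -> measurable_fun I01 G ->
  (forall t, I01 t -> t != t0 -> F t = G t) ->
  \int[leb]_(t in `[0%R, 1%R]) F t = \int[leb]_(t in `[0%R, 1%R]) G t.
Proof.
move=> mF mG E; apply: ae_eq_integral => //.
exists [set t0]; split => //; first exact: lebesgue_measure_set1.
move=> t /=; apply: contra_notP => tt0; move=> t01; apply: E => //; exact/eqP.
Qed.

(** [K] bounds the integrand of the modular along the path and is fixed before any mass is given;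
    the modular is then at most [P E * K]. The travellers form an event [E], contained in the set of
    labels at [x], so that part of an atom can leave while the rest stays. *)
Lemma adm_move (x y : 'rV[R]_N) (lam : R) : Omega x -> Omega y -> (0 < lam)%R ->
  exists2 K : R, (0 < K)%R &
  forall d (L : measurableType d) (P : probability L R) (Y Y' : L -> 'rV[R]_N) (E : set L)
    (mu nu : probability T R),
    measurable_fun setT (Y : L -> T) -> (forall l, Omega (Y l)) -> measurable E ->
    (forall l, E l -> Y l = x /\ Y' l = y) -> (forall l, ~ E l -> Y' l = Y l) ->
    P E * K%:E <= 1 ->
    (forall C : set T, measurable C -> P (Y @^-1` C) = mu C) ->
    (forall C : set T, measurable C -> P (Y' @^-1` C) = nu C) ->
    adm Omega p lam mu nu.
Proof.
move=> Ox Oy l0.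
have prob_law d (L : measurableType d) (P : probability L R) (Y : L -> 'rV[R]_N) (mu : probability T R) :
    (forall l, Omega (Y l)) -> (forall C : set T, measurable C -> P (Y @^-1` C) = mu C) -> prob_on Omega mu.
  move=> YO muE; rewrite /prob_on/= -muE// (_ : _ @^-1` _ = setT); first exact: probability_setT.
  by apply/seteqP; split => // l _; exact: YO.
(* The slow path is injective only between distinct points; otherwise nothing moves. *)
have [xy|xy] := eqVneq y x.
  exists 1%R => // d L P Y Y' E mu nu mY YO mE Eon Eoff _ muE nuE.
  have YY' : Y' = Y.
    by apply/funext => l; have [/Eon[-> ->]|/Eoff] := pselect (E l).
  apply: (@adm_contraction _ _ _ _ _ oO OB mp p1 cvO id lam l0) => //.
  - by move=> z t _ _; apply/rowP => i; rewrite !mxE; ring.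
  - by move=> z _; rewrite subrr enorm0 ltW.
  - exact: (prob_law _ _ _ _ _ YO muE).
  - by move=> C mC; rewrite -muE// -nuE// YY'.
have [A [al [be [M [mA AI M1 [al0 be0 ab1 slow pM]]]]]] := slow_parameters Ox Oy l0.
pose w := (y - x)%R; have w0 : w != 0%R by rewrite subr_eq0.
pose path := slow_path A al be x w; pose v := slow_field A al be x w.
have pathO t : I01 t -> Omega (path t).
  move=> /(position01 mA AI al0 be0 ab1); rewrite /= in_itv/= => s01.
  have := convex_line cvO Ox Oy s01; congr (Omega _).
  by apply/rowP => i; rewrite /path /slow_path !mxE; ring.
have mv : measurable_fun (I01 `*` setT : set (R * T)) (v : R * T -> T).
  by apply: measurable_slow_field => //; exact: measurableX.
(* Off [A] the speed divided by [lam] is at most [enorm w / (al * lam)]. Adding 1 gives a base at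
   least 1, so that [p <= M] bounds the power by [b] to the [M]. *)
pose b := (1 + enorm w / (al * lam))%R.
have b1 : (1 <= b)%R by rewrite lerDl divr_ge0 ?enorm_ge0// ltW// mulr_gt0.
pose K := (b `^ M)%R.
have K1 : (1 <= K)%R by rewrite -(powRr0 b) ler_powR// (le_trans ler01).
have bound t : I01 t -> (enorm (lam^-1 *: v (t, path t)) `^ p (path t) <= K)%R.
  move=> t01; have pt1 := p1 (pathO _ t01).
  have s01 := position01 mA AI al0 be0 ab1 t01; set s := position A al be t in s01.
  have r0 := rate_gt0 A al0 be0 s.
  have -> : v (t, path t) = ((rate A al be s)^-1 *: w)%R by exact: slow_fieldE.
  rewrite !enormZ !ger0_norm ?invr_ge0 ?(ltW l0) ?(ltW r0)//.
  set a := (_ * _)%R; have a0 : (0 <= a)%R by rewrite !mulr_ge0 ?invr_ge0 ?enorm_ge0 ?(ltW l0) ?(ltW r0).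
  have aE : a = (enorm w / (lam * rate A al be s))%R by rewrite /a invfM; ring.
  have mono c : (a <= c)%R -> (a `^ p (path t) <= c `^ p (path t))%R.
    move=> ac; apply: ge0_ler_powR => //; rewrite ?nnegrE//; last exact: le_trans ac.
    exact: le_trans pt1.
  have [sA|sA] := pselect (A s).
    have := mono 1%R; rewrite powR1 => le1; apply: (le_trans (le1 _)) => //.
    rewrite aE ler_pdivrMr ?mulr_gt0// mul1r (_ : rate A al be s = al + be)%R//.
    by rewrite /rate indicE mem_set// mulr1.
  apply: (@le_trans _ _ (b `^ p (path t))%R).
    apply: mono; rewrite aE /b; apply: (@le_trans _ _ (enorm w / (al * lam)))%R; last by rewrite lerDr.
    rewrite ler_wpM2l ?enorm_ge0// lef_pV2 ?posrE ?mulr_gt0// mulrC ler_pM2l//.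
    by have /andP[] := rate_itv A al be0 s.
  by apply: ler_powR => //; exact: pM.
exists K; first exact: lt_le_trans K1.
move=> d L P Y Y' E mu nu mY YO mE Eon Eoff PEK muE nuE.
have static z : exists t0 : R, forall t, t != t0 -> v (t, z) = 0%R.
  exact: slow_field_static.
pose X t l := if l \in E then path t else Y l.
pose C l := if l \in E then K%:E else 0.
have mE2 : measurable_fun setT (fun l => l \in E) by exact: measurable_fun_mem.
apply: (@adm_flow _ _ _ _ _ oO OB mp p1 _ L P X v lam C) => //.
- apply: measurable_fun_ifT.
  + exact: (measurableT_comp mE2 measurable_snd).
  + have mpath : measurable_fun setT (path : R -> T) by exact: measurable_slow_path.
    exact: (measurableT_comp mpath measurable_fst).
  + exact: (measurableT_comp mY measurable_snd).
- move=> l; rewrite /X; case: (l \in E); first exact: slow_path_continuous.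
  by move=> t; exact: cvg_cst.
- by move=> t l t01; rewrite /X; case: ifP => _; [exact: pathO|exact: YO].
- move=> l phi tphi; rewrite /X; case: (l \in E); first exact: integral_tgrad_slow.
  have [sphi _] := tphi; have C1 := sphi 1%N.
  have [t0 Ht0] := static (Y l).
  have mst (u : V -> 'rV[R]_N) : measurable_fun (I01 `*` setT : set (R * T)) (u : R * T -> T) ->
      measurable_fun I01 (fun t => (tgrad phi u (t, Y l))%:E).
    move=> mu'; apply: (@measurable_along _ _ Omega (fun z => (tgrad phi u z)%:E) (fun=> Y l)) => //.
    + apply/measurable_EFinP; apply: measurable_tgrad => //; first exact: measurable_cyl.
      by apply: measurable_funS mu' => //; [exact: measurableX|move=> z []].
    + by move=> t; exact: cvg_cst.
  (* A particle at rest meets the traveller at one instant at most, so along it the field may be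
     replaced by 0. *)
  rewrite (@integral_ae1 _ (fun t => (tgrad phi (fun=> 0%R) (t, Y l))%:E) t0).
  + apply: (@integral_tgrad_along _ _ phi (fun=> 0%R) (fun=> Y l) (fun=> 0%R)) => //.
    * by move=> t; exact: cvg_cst.
    * by move=> t; exact: cvg_cst.
    * move=> t; have := @is_derive_line R V phi C1 (0%R, Y l) (1%R, 0%R) t.
      have EE s : ((0%R, Y l) + s *: (1%R, 0) = (s, Y l) :> V)%R.
        by congr (_, _); rewrite /= /GRing.scale/= ?mulr1 ?add0r//; apply/rowP => i; rewrite !mxE; ring.
      rewrite EE (_ : (fun h : R => _) = fun h => phi (h, Y l))//.
      by apply/funext => h; rewrite EE.
  + exact: mst.
  + by apply: mst; exact: measurable_cst.
  + by move=> t t01 tt0; rewrite /tgrad/= Ht0.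
- by apply: measurable_fun_ifT => //; exact: measurable_cst.
- rewrite (_ : \int[P]_l C l = \int[P]_l (K%:E * (\1_E l)%:E)); last first.
    by apply: eq_integral => l _; rewrite /C indicE; case: (l \in E); rewrite ?mule1 ?mule0.
  rewrite ge0_integralZl//; last 2 first.
  + by apply/measurable_EFinP; exact: measurable_indic.
  + by rewrite lee_fin (le_trans _ K1).
  by rewrite integral_indic// setIT muleC.
- move=> l; rewrite /X /C; case: (l \in E).
    rewrite -(integral_cst01 K); apply: ge0_le_integral => //.
    + by move=> t _; rewrite lee_fin powR_ge0.
    + apply: (@measurable_along _ _ Omega (fun z => (enorm (lam^-1 *: v z) `^ p z.2)%:E) path) => //.
        by apply/measurable_EFinP; exact: measurable_modular.
      exact: slow_path_continuous.
  have [t0 Ht0] := static (Y l).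
  rewrite (@integral_ae1 _ (fun=> 0) t0) ?integral0//.
  + apply: (@measurable_along _ _ Omega (fun z => (enorm (lam^-1 *: v z) `^ p z.2)%:E) (fun=> Y l)) => //.
      by apply/measurable_EFinP; exact: measurable_modular.
    by move=> t; exact: cvg_cst.
  + move=> t t01 tt0; rewrite Ht0// scaler0 enorm0 powR0// gt_eqF//.
    by apply: lt_le_trans (p1 (YO l)).
- move=> D mD; rewrite -muE//; congr (P _); apply/seteqP; split => l /=; rewrite /X.
    by case: ifPn => // /set_mem/Eon[-> _]; rewrite /path slow_path0.
  by case: ifPn => // /set_mem/Eon[-> _]; rewrite /path slow_path0.
- move=> D mD; rewrite -nuE//; congr (P _); apply/seteqP; split => l /=; rewrite /X.
    case: ifPn => [/set_mem/Eon[_ ->]|/negP]; last by move=> nE; rewrite Eoff// => /mem_set.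
    by rewrite /path slow_path1// addrC subrK.
  case: ifPn => [/set_mem/Eon[_ ->]|/negP]; last by move=> nE; rewrite Eoff// => /mem_set.
  by rewrite /path slow_path1// addrC subrK.
Qed.

End move.

Lemma discrete_prob_exists d (X : measurableType d) (R : realType) (n : nat) (w : nat -> R) (g : nat -> X) :
  (forall k, 0 <= w k) -> \sum_(k < n) w k = 1 ->
  exists P : probability X R, forall A : set X, P A = (\sum_(k < n) w k * \1_A (g k))%:E.
Proof.
move=> w0 w1.
pose mu := msum (fun k => mscale (NngNum (w0 k)) (dirac (g k))) n.
have muE A : mu A = (\sum_(k < n) w k * \1_A (g k))%:E.
  by rewrite /mu /msum -sumEFin; apply: eq_bigr => k _; rewrite /mscale/= EFinM.
have muT : mu setT = 1%E.
  by rewrite muE -w1; congr EFin; apply: eq_bigr => k _; rewrite indicT mulr1.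
(* The total mass is already 1: normalising only produces a term of type [probability], with the
   Dirac mass as default for total masses 0 and infinity. *)
exists (mnormalize mu (dirac (g 0%N))) => A; rewrite -muE.
transitivity ((if (mu setT == 0%E) || (mu setT == +oo%E) then fun U => dirac (g 0%N) U
  else fun U => (mu U * (fine (mu setT))^-1%:E)%E) A); first by [].
by rewrite muT onee_eq0/= invr1 mule1.
Qed.

(** * Gathering parts of atoms at one point *)

Section discrete_move.
Context {R : realType} {N : nat}.
Local Notation T := (borelRn R N).
Variables (Omega : set 'rV[R]_N) (p : 'rV[R]_N -> R) (B : R).
Hypotheses (oO : open Omega) (OB : forall x, Omega x -> `|x| <= B).
Hypothesis mp : measurable_fun (Omega : set T) (p : T -> R).
Hypothesis p1 : forall x, Omega x -> 1 <= p x.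
Hypothesis cvO : convex_set (Omega : set (convex_lmodType 'rV[R]_N)).

(* Label j < m is the mass staying at [g j]; label m + j is the mass travelling
   from [g j] to [h], one j at a time. *)
Lemma adm_discrete (m : nat) (g : nat -> 'rV[R]_N) (h : 'rV[R]_N) (lam : R) :
  (forall j, Omega (g j)) -> Omega h -> 0 < lam ->
  exists2 th : R, 0 < th & forall (q s : nat -> R) (mu nu : probability T R),
    (forall j, 0 <= q j) -> (forall j, 0 <= s j) ->
    \sum_(j < m) (q j + s j) = 1 -> \sum_(j < m) s j <= th ->
    (forall C : set T, measurable C -> mu C = (\sum_(j < m) (q j + s j) * \1_C (g j))%:E) ->
    (forall C : set T, measurable C -> nu C = (\sum_(j < m) (q j * \1_C (g j) + s j * \1_C h))%:E) ->
    adm Omega p lam mu nu.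
Proof.
move=> gO hO l0.
(* The cost [lam] is shared by the [m] moves and by the initial passage from [mu] to the law of
   [Y 0]. *)
pose l' := lam / m.+1%:R; have l'0 : 0 < l' by rewrite divr_gt0// ltr0n.
have /choice[K HK] : forall j, exists K : R, 0 < K /\ _ :=
  fun j => let: ex_intro2 K K0 H := adm_move oO OB mp p1 cvO (gO j) hO l'0 in ex_intro _ K (conj K0 H).
(* A common bound of the [K j]: if the travelling masses sum to at most [Ks^-1], each of them meets
   the requirement of [adm_move]. The 1 keeps [Ks] positive when [m = 0]. *)
pose Ks := 1 + \sum_(j < m) K j.
have Ks0 : 0 < Ks by rewrite ltr_pwDl// sumr_ge0// => j _; have [/ltW] := HK j.
have KKs k : (k < m)%N -> K k <= Ks.
  move=> km; rewrite /Ks (bigD1 (Ordinal km))//= addrCA lerDl addr_ge0// sumr_ge0// => j _.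
  by have [/ltW] := HK j.
exists Ks^-1; first by rewrite invr_gt0.
move=> q s mu nu q0 s0 qs1 sth muE nuE.
pose w l := if (l < m)%N then q l else s (l - m)%N.
have w0 l : 0 <= w l by rewrite /w; case: ifP.
have wsum (F : nat -> R) : \sum_(l < m + m) w l * F l =
    \sum_(j < m) q j * F j + \sum_(j < m) s j * F (m + j)%N.
  rewrite big_split_ord/=; congr (_ + _); apply: eq_bigr => j _.
    by rewrite /w ltn_ord.
  by rewrite /w ltnNge leq_addr/= addKn.
have w1 : \sum_(l < m + m) w l = 1.
  have := wsum (fun=> 1); under eq_bigr do rewrite mulr1; move=> ->.
  by rewrite -[RHS]qs1 big_split/=; congr (_ + _); apply: eq_bigr => j _; rewrite mulr1.
have [P PE] := @discrete_prob_exists _ nat R (m + m) w id w0 w1.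
(* The place of the label [l] once the first [k] travelling labels have arrived. *)
pose Y k l := if (l < m)%N then g l else if (l - m < k)%N then h else g (l - m)%N.
have mY k : measurable_fun setT (Y k : nat -> T) by move=> _ C _.
have YO k l : Omega (Y k l) by rewrite /Y; do 2 case: ifP => // _.
have YE k (C : set T) : P (Y k @^-1` C) =
    (\sum_(j < m) q j * \1_C (g j) + \sum_(j < m) s j * \1_C (if (j < k)%N then h else g j))%:E.
  rewrite PE; congr EFin.
  rewrite (eq_bigr (fun l : 'I_(m + m) => w l * \1_C (Y k l))); last by move=> l _; rewrite !indicE.
  rewrite (wsum (fun l => \1_C (Y k l))); congr (_ + _); apply: eq_bigr => j _.
    by rewrite /Y ltn_ord.
  by rewrite /Y ltnNge leq_addr/= addKn.
have lawYE k (C : set T) : law P (mY k) C =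
    (\sum_(j < m) q j * \1_C (g j) + \sum_(j < m) s j * \1_C (if (j < k)%N then h else g j))%:E := YE k C.
have step k : (k <= m)%N -> adm Omega p (l' * k.+1%:R) mu (law P (mY k)).
  elim: k => [|k IH] km.
    rewrite mulr1; apply: (@adm_contraction _ _ _ _ _ oO OB mp p1 cvO id l' l'0) => //.
    - by move=> z t _ _; apply/rowP => i; rewrite !mxE; ring.
    - by move=> z _; rewrite subrr enorm0 ltW.
    - rewrite /prob_on/= muE; last exact: open_measurable_Rn.
      by rewrite -qs1; congr EFin; apply: eq_bigr => j _; rewrite indicE mem_set ?mulr1.
    - move=> C mC; rewrite lawYE muE//; congr EFin.
      by rewrite -big_split/=; apply: eq_bigr => j _; rewrite mulrDl.
  rewrite -natr1 mulrDr mulr1; apply: (adm_trans oO OB mp p1 _ l'0 (IH (ltnW km))).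
    by rewrite mulr_gt0// ltr0n.
  have [_ Hk] := HK k.
  apply: (Hk _ nat P (Y k) (Y k.+1) [set (m + k)%N]) => //.
  - move=> l ->; rewrite /Y ltnNge leq_addr/= addKn ltnn ltnSn; split => //.
  - move=> l /eqP lmk; rewrite /Y; case: ltnP => // ml.
    rewrite ltnS leq_eqVlt; case: eqP => //= lk; exfalso; move: lmk.
    by rewrite -lk subnKC// eqxx.
  - rewrite PE (wsum (fun l => \1_[set (m + k)%N] l)) big1 ?add0r; last first.
      move=> j _; rewrite indicE memNset ?mulr0//= => E.
      by have := ltn_ord j; rewrite E ltnNge leq_addr.
    rewrite (bigD1 (Ordinal km))//= indicE mem_set// mulr1 big1 ?addr0; last first.
      move=> j jk; rewrite indicE memNset ?mulr0//= => /addnI E.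
      by move/eqP: jk; apply; apply: val_inj.
    rewrite -EFinM lee_fin -(mulVf (lt0r_neq0 Ks0)).
    have sk : s k <= Ks^-1.
      apply: le_trans sth; rewrite (bigD1 (Ordinal km))//= lerDl sumr_ge0//.
    by rewrite ler_pM//; [have [/ltW] := HK k|exact: KKs].
have : adm Omega p (l' * m.+1%:R) mu (law P (mY m)) by exact: step.
rewrite divfK ?pnatr_eq0//; apply: adm_eq => // C mC.
apply: (eq_trans (lawYE m C)); apply: esym; apply: (eq_trans (nuE C mC)); congr EFin; apply: esym.
rewrite -big_split/=; apply: eq_bigr => j _.
by rewrite ltn_ord.
Qed.

End discrete_move.

(** * From narrow convergence to Wp *)

Section null_hyperplanes.
Context {R : realType} {N : nat}.
Local Notation T := (borelRn R N).
Local Notation leb := (@lebesgue_measure R).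
Local Notation RM := (measurableTypeR R).
Local Open Scope ereal_scope.

(** By Fubini, the integral over [r] of the mass of the hyperplane [x_i = r] is a mean of lengths of
    single points, which is 0. Summing over [i], almost every [r] suits all coordinates at once. *)
Lemma null_hyperplane (rho : probability T R) (u v : R) : (u < v)%R ->
  exists2 r : R, (u < r < v)%R & forall i : 'I_N, rho [set x : 'rV[R]_N | x ord0 i = r] = 0.
Proof.
move=> uv.
pose D (i : 'I_N) : set (RM * T) := [set z : RM * T | ((z.2 : 'rV[R]_N) ord0 i - z.1 = 0)%R].
have mD i : measurable (D i).
  have md : measurable_fun setT (fun z : RM * T => (z.2 : 'rV[R]_N) ord0 i - (z.1 : R))%R.
    apply: measurable_funB; last exact: measurable_fst.
    exact: (measurableT_comp (measurable_coord i) measurable_snd).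
  have := md measurableT [set 0%R] (measurable_set1 _); rewrite setTI.
  by congr measurable.
have DE i (r : RM) : \int[rho]_x (\1_(D i) (r, x) : R)%:E = rho [set x : 'rV[R]_N | x ord0 i = r].
  rewrite (_ : (fun x => _) = (fun x : T => (\1_[set x : 'rV[R]_N | x ord0 i = r] x)%:E)); last first.
    apply/funext => x; rewrite !indicE; congr (_%:R%:E); congr nat_of_bool.
    apply/idP/idP => /set_mem/= h; apply/mem_set => /=; first exact: subr0_eq.
    by rewrite /D/= h subrr.
  rewrite integral_indic// ?setIT//.
  have := @measurable_coord R N i measurableT [set r] (measurable_set1 _).
  by rewrite setTI.
have mind i : measurable_fun setT (fun z : RM * T => (\1_(D i) z : R)%:E).
  by apply/measurable_EFinP; exact: measurable_indic.
pose F (r : RM) := \sum_(i < N) \int[rho]_x (\1_(D i) (r, x) : R)%:E.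
have mFi (i : 'I_N) : measurable_fun setT (fun r : RM => \int[rho]_x (\1_(D i) (r, x) : R)%:E).
  apply: (@measurable_fun_fubini_tonelli_F _ _ _ _ _ rho (fun z : RM * T => (\1_(D i) z : R)%:E)).
    exact: mind.
  by move=> z; rewrite lee_fin.
have Fi0 (i : 'I_N) (r : RM) : 0 <= \int[rho]_x (\1_(D i) (r, x) : R)%:E.
  by apply: integral_ge0 => x _; rewrite lee_fin.
have mF : measurable_fun setT F by exact: emeasurable_sum.
have F0 r : 0 <= F r by apply: sume_ge0.
have intF : \int[leb]_r F r = 0.
  rewrite /F ge0_integral_sum// big1// => i _.
  rewrite (@fubini_tonelli _ _ RM T R leb rho (fun z => (\1_(D i) z : R)%:E)) ?integral0_eq//.
  move=> x _; rewrite (_ : (fun r => _) = (fun r : RM => (\1_[set x ord0 i] r)%:E)); last first.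
    apply/funext => r; rewrite !indicE; congr (_%:R%:E); congr nat_of_bool.
    apply/idP/idP => /set_mem/= h; apply/mem_set => /=; first exact/esym/subr0_eq.
    by rewrite /D/= h subrr.
  by rewrite integral_indic// setIT; exact: lebesgue_measure_set1.
have aeF : ae_eq leb setT F (cst 0).
  apply/(ae_eq_integral_abs leb measurableT mF); rewrite -[RHS]intF.
  by apply: eq_integral => r _; rewrite gee0_abs.
have [r ruv Fr] : exists2 r : R, (u < r < v)%R & F r = 0.
  apply: contrapT => nex; have [S [mS S0 FS]] := aeF.
  have : leb `]u, v[%classic <= leb S.
    apply: le_measure; rewrite ?inE//; move=> r; rewrite /= in_itv/= => ruv; apply: FS => /= h.
    by apply: nex; exists r => //; exact: h.
  rewrite [X in X <= _](lebesgue_measure_itv `]u, v[)/= lte_fin uv S0 -EFinB lee_fin.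
  by rewrite subr_le0 leNgt uv.
exists r => // i; rewrite -DE; apply/eqP; rewrite eq_le Fi0 andbT -[X in _ <= X]Fr /F.
by rewrite (bigD1 i)//= leeDl// sume_ge0.
Qed.

End null_hyperplanes.

Section finite_cells.
Context d {X : measurableType d} {R : realType}.
Variables (m : nat) (rank : X -> nat).
Hypothesis rank_lt : forall x, (rank x < m)%N.
Hypothesis mrank : forall j, measurable [set x | rank x = j].
Local Open Scope ereal_scope.

Lemma measure_cells (mu : {measure set X -> \bar R}) (S : set X) : measurable S ->
  mu S = \sum_(j < m) mu (S `&` [set x | rank x = j]).
Proof.
move=> mS; rewrite (fsbig_ord _ _ (fun j => mu (S `&` [set x | rank x = j]))).
rewrite -measure_fin_bigcup//; last 2 first.
- by apply/trivIsetP => i j _ _ ij; apply/seteqP; split => // x [[_ /= xi] [_ /= xj]];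
    move/eqP: ij; apply; rewrite -xi -xj.
- by move=> j _; exact: measurableI.
congr (mu _); apply/seteqP; split => [x Sx|x [j _ []//]].
by exists (rank x) => //=; exact: rank_lt.
Qed.

Lemma measurable_cells d' (Y : measurableType d') (g : nat -> Y) :
  measurable_fun setT (fun x => g (rank x)).
Proof.
move=> _ C mC; rewrite setTI.
rewrite (_ : _ @^-1` _ = \bigcup_(j in [set j | C (g j)]) [set x | rank x = j]).
  by apply: bigcup_measurable => j _; exact: mrank.
apply/seteqP; split => [x /= Cx|x [j /= Cj xj]]; first by exists (rank x).
by rewrite /= xj.
Qed.

End finite_cells.

(** * Fine grids with negligible walls *)

Section grid.
Context {R : realType} {N : nat}.
Local Notation T := (borelRn R N).
Variables (Omega : set 'rV[R]_N) (p : 'rV[R]_N -> R) (B : R).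
Hypotheses (oO : open Omega) (OB : forall x, Omega x -> `|x| <= B).
Hypothesis mp : measurable_fun (Omega : set T) (p : T -> R).
Hypothesis p1 : forall x, Omega x -> 1 <= p x.
Hypothesis cvO : convex_set (Omega : set (convex_lmodType 'rV[R]_N)).

Let mO : measurable (Omega : set T). Proof. exact: open_measurable_Rn. Qed.

Section cells.
Variables (M : nat) (thr : nat -> R).
Local Notation I := {ffun 'I_N * 'I_M -> bool}.

(** A cell is coded by the comparisons of all coordinates with all thresholds. As an intersection of
    half-spaces it is convex, and the finite type of codes provides a numbering of the cells. *)
Definition cell_index (x : 'rV[R]_N) : I := [ffun im : 'I_N * 'I_M => thr im.2 <= x 0 im.1].

Lemma measurable_cell_index (k : I) : measurable ([set x | cell_index x = k] : set T).
Proof.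
rewrite (_ : [set x | _] = \bigcap_(im in [set: 'I_N * 'I_M]) [set x : 'rV[R]_N | (thr im.2 <= x 0 im.1) = k im]); last first.
  apply/seteqP; split => x /=; first by move=> <- im _ /=; rewrite ffunE.
  by move=> h; apply/ffunP => im; rewrite ffunE; exact: h.
apply: fin_bigcap_measurable => // im _.
have mc := @measurable_coord R N im.1 measurableT; case: (k im).
  have := mc `[thr im.2, +oo[%classic (measurable_itv _); rewrite setTI; congr measurable.
  by apply/seteqP; split => x /=; rewrite in_itv/= andbT.
have := mc `]-oo, thr im.2[%classic (measurable_itv _); rewrite setTI; congr measurable.
by apply/seteqP; split => x /=; rewrite in_itv/= ltNge; [move=> /negbTE|move=> ->].
Qed.

Lemma cell_index_convex (x y : 'rV[R]_N) (t : R) : cell_index x = cell_index y -> 0 <= t <= 1 ->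
  cell_index ((1 - t) *: x + t *: y) = cell_index x.
Proof.
move=> /ffunP xy /andP[t0 t1]; apply/ffunP => im; have := xy im; rewrite !ffunE !mxE.
set r := thr _; set a := x 0 _; set b := y 0 _ => rab.
have t1' : 0 <= 1 - t by rewrite subr_ge0.
have E : r = (1 - t) * r + t * r by rewrite -mulrDl subrK mul1r.
have [ra|ar] := leP r a.
  have rb : r <= b by rewrite -rab.
  by rewrite E lerD// ler_wpM2l.
have br : b < r by rewrite ltNge -rab -ltNge.
apply/negbTE; rewrite -ltNge [ltRHS]E.
have [->|tn0] := eqVneq t 0; first by rewrite subr0 !mul0r !addr0 !mul1r.
by apply: ler_ltD; [apply: ler_wpM2l => //; exact: ltW|rewrite ltr_pM2l// lt_neqAle eq_sym tn0].
Qed.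

Definition open_cell (k : I) : set 'rV[R]_N :=
  [set x | Omega x /\ forall im : 'I_N * 'I_M, if k im then thr im.2 < x 0 im.1 else x 0 im.1 < thr im.2].

Lemma open_open_cell k : open (open_cell k).
Proof.
rewrite openE => x [Ox h]; rewrite /interior.
have H : nbhs x [set y : 'rV[R]_N | forall im : 'I_N * 'I_M,
    if k im then thr im.2 < y 0 im.1 else y 0 im.1 < thr im.2].
  apply: (@filter_forall _ ('I_N * 'I_M)%type (fun im (y : 'rV[R]_N) =>
    if k im then thr im.2 < y 0 im.1 else y 0 im.1 < thr im.2) (nbhs x) _) => im.
  have cx := @coord_continuous R 1 N 0 im.1 x; have := h im.
  by case: (k im) => hx; [exact: cx _ (lt_nbhsr hx)|exact: cx _ (lt_nbhsl hx)].
exact: filterI (open_nbhs_nbhs (conj oO Ox)) H.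
Qed.

Lemma open_cell_sub k : open_cell k `<=` [set x | cell_index x = k].
Proof.
move=> x [_ h]; apply/ffunP => im; rewrite ffunE; have := h im.
by case: (k im) => [/ltW//|]; rewrite ltNge => /negbTE.
Qed.

Lemma open_cell_full (rho : probability T R) k : prob_on Omega rho ->
  (forall (i : 'I_N) (j : 'I_M), rho [set x : 'rV[R]_N | x 0 i = thr j] = 0%E) ->
  rho (open_cell k) = rho [set x | cell_index x = k].
Proof.
move=> rhoO rho0; have mG : measurable (open_cell k : set T).
  by apply: open_measurable_Rn; exact: open_open_cell.
have mQ := measurable_cell_index k.
apply/eqP; rewrite eq_le; apply/andP; split.
  by apply: le_measure; rewrite ?inE//; exact: open_cell_sub.
pose H : set T := \big[setU/set0]_(im : 'I_N * 'I_M) [set x : 'rV[R]_N | x 0 im.1 = thr im.2].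
have mHi (i : 'I_N) (r : R) : measurable ([set x : 'rV[R]_N | x 0 i = r] : set T).
  by have := @measurable_coord R N i measurableT [set r] (measurable_set1 _); rewrite setTI.
have [mH H0] : measurable H /\ rho H = 0%E.
  rewrite /H; elim/big_rec : _ => [|im S _ [mS S0]]; first by rewrite measure0.
  split; first exact: measurableU.
  have := measureU0 (mu := rho) (mHi im.1 (thr im.2)) mS S0.
  by move=> E; apply: (eq_trans E); exact: rho0.
have OC := prob_setC0 mO rhoO; have mOC : measurable (~` (Omega : set T)) by exact: measurableC.
apply: (@le_trans _ _ (rho ((open_cell k `|` H) `|` ~` (Omega : set T)))).
  apply: le_measure; rewrite ?inE//; first by do 2 apply: measurableU => //.
  move=> x /= xk; have [Ox|nOx] := pselect (Omega x); [left|by right].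
  have [[im xim]|nH] := pselect (exists im : 'I_N * 'I_M, x 0 im.1 = thr im.2).
    by right; rewrite /H (bigD1 im)//=; left.
  left; split => // im; rewrite -xk ffunE.
  have ne : x 0 im.1 != thr im.2 by apply/eqP => e; apply: nH; exists im.
  by case: ltgtP ne.
rewrite (measureU0 (mu := rho) _ mOC OC); last exact: measurableU.
by rewrite (measureU0 (mu := rho) mG mH H0).
Qed.

End cells.

(* If the thresholds of the grid are met by no atom of rho, the interiors of the
   cells, which are open, carry all the mass of rho. *)
Lemma grid_contraction (rho : probability T R) (lam : R) : prob_on Omega rho -> 0 < lam ->
  exists (m : nat) (g : nat -> 'rV[R]_N) (Q G : nat -> set 'rV[R]_N),
    [/\ (0 < m)%N, forall j, Omega (g j),
      forall j, [/\ measurable (Q j : set T), open (G j), G j `<=` Q j & rho (G j) = rho (Q j)],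
      forall mu : probability T R, \sum_(j < m) fine (mu (Q j)) = 1 &
      forall mu nu : probability T R, prob_on Omega mu ->
        (forall C : set T, measurable C -> nu C = (\sum_(j < m) fine (mu (Q j)) * \1_C (g j))%:E) ->
        adm Omega p lam mu nu].
Proof.
move=> rhoO l0.
have [x0 Ox0] : exists x, Omega x.
  apply/(@set0P _ Omega); apply/eqP => O0; move: rhoO; rewrite /prob_on/= O0 measure0 => /eqP.
  by rewrite lt_eqF// lte_fin.
(* Points of [Omega] in one cell will differ by less than [2 * dl] in each coordinate, and the
   Euclidean norm is at most [N] times the sup norm; here [N * (2 * dl) <= lam]. *)
pose dl := lam / (2 * (N%:R + 1)).
have N10 : 0 < N%:R + 1 :> R by rewrite ltr_wpDl.
have dl0 : 0 < dl by rewrite divr_gt0// mulr_gt0.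
pose a := - B.
(* One threshold inside each of consecutive intervals of length [dl], so that neighbours are less
   than [2 * dl] apart. *)
have /choice[thr thrP] : forall j : nat, exists r : R,
    a + j%:R * dl < r < a + j%:R * dl + dl /\ forall i : 'I_N, rho [set x : 'rV[R]_N | x ord0 i = r] = 0%E.
  move=> j; have [r r1 r2] := @null_hyperplane R N rho (a + j%:R * dl) (a + j%:R * dl + dl) (ltac:(by rewrite ltrDl)).
  by exists r.
(* Enough thresholds for one of them to follow every point of [Omega] in every coordinate. *)
pose M := (Num.bound ((B - a) / dl)).+2.
pose I := {ffun 'I_N * 'I_M -> bool}.
pose idx := cell_index M thr.
pose rank x : nat := enum_rank (idx x).
pose Q j : set 'rV[R]_N := [set x | rank x = j].
(* Cells that miss [Omega] receive the default [x0], so that [g j] lies in [Omega] for every [j]. *)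
pose g j := xget x0 [set y | Omega y /\ rank y = j].
have gP x : Omega x -> Omega (g (rank x)) /\ rank (g (rank x)) = rank x.
  by move=> Ox; apply: (@xgetPex _ x0 [set y | Omega y /\ rank y = rank x]); exists x.
have gO j : Omega (g j).
  have [y ey|_] := xgetP x0 [set y | Omega y /\ rank y = j]; last by rewrite /g; case: xgetP => [? -> []|].
  by rewrite /g; case: xgetP => [? -> []|].
have rankE x y : rank x = rank y -> idx x = idx y by move=> /val_inj/enum_rank_inj.
have Qcase j : (exists k : I, Q j = [set x | idx x = k]) \/ Q j = set0.
  have [[k kj]|nk] := pselect (exists k : I, enum_rank k = j :> nat).
    left; exists k; apply/seteqP; split => x /=; last by move=> xk; rewrite /Q/= /rank xk.
    by rewrite /Q/= -kj => /val_inj/enum_rank_inj.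
  right; apply/seteqP; split => // x xj; apply: nk; exists (idx x); exact: xj.
have mQ j : measurable (Q j : set T).
  by case: (Qcase j) => [[k ->]|->]; [exact: measurable_cell_index|exact: measurable0].
have /choice[G GP] : forall j, exists G : set 'rV[R]_N, [/\ open G, G `<=` Q j & rho G = rho (Q j)].
  move=> j; case: (Qcase j) => [[k ->]|->].
    exists (open_cell thr k); split; [exact: open_open_cell|exact: open_cell_sub|].
    by apply: open_cell_full => // i l; have [_ ->] := thrP l.
  by exists set0; split => //; exact: open0.
have rlt x : (rank x < #|I|)%N by exact: ltn_ord.
have cells (mu : probability T R) (S : set T) (mS : measurable S) := @measure_cells _ T R #|I| rank rlt mQ mu S mS.
exists #|I|, g, Q, G; split.
- by apply: leq_ltn_trans (rlt x0).
- exact: gO.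
- by move=> j; have [h1 h2 h3] := GP j; split.
- move=> mu; apply: EFin_inj; rewrite -sumEFin.
  rewrite -(@probability_setT _ _ _ mu) (cells mu setT measurableT).
  by apply: eq_bigr => j _; rewrite setTI fineK// fin_num_measure.
move=> mu nu muO nuE.
have mc : measurable_fun setT (fun x : T => g (rank x) : T) by exact: measurable_cells.
have close x y i : Omega x -> Omega y -> idx x = idx y -> y 0 i - x 0 i < 2 * dl.
  move=> Ox Oy xy; rewrite ltNge; apply/negP => far.
  have xa : 0 <= (x 0 i - a) / dl.
    rewrite divr_ge0 ?(ltW dl0)// subr_ge0 /a lerNl (le_trans _ (OB Ox))//.
    by rewrite (le_trans (ler_norm _))// normrN coord_le_norm.
  (* [thr n] exceeds [x 0 i] by less than [2 * dl], so it would separate two coordinates that are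
     [2 * dl] apart. *)
  pose n := (Num.truncn ((x 0 i - a) / dl)).+1.
  have [n1 n2] : (n.-1)%:R <= (x 0 i - a) / dl /\ (x 0 i - a) / dl < n%:R.
    by have /andP[] := truncn_itv xa.
  have nM : (n < M)%N.
    have xB : (x 0 i - a) / dl <= (B - a) / dl.
      rewrite ler_pM2r ?invr_gt0// lerD2r (le_trans (ler_norm _))// (le_trans _ (OB Ox))//.
      exact: coord_le_norm.
    rewrite ltnS -(ltr_nat R); apply: le_lt_trans n1 _; apply: (le_lt_trans xB).
    by rewrite -natr1 (lt_trans (archi_boundP (le_trans xa xB)))// ltrDl.
  have /ffunP/(_ (i, Ordinal nM)) := xy; rewrite !ffunE/=.
  have [/andP[t1 t2] _] := thrP n.
  move: n1 n2; rewrite ler_pdivlMr// ltr_pdivrMr// => n1 n2.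
  have e1 : n%:R * dl = (n.-1)%:R * dl + dl by rewrite -[in LHS](@prednK n)// -natr1 mulrDl mul1r.
  have -> : (thr n <= x 0 i) = false by apply/negbTE; rewrite -ltNge; lra.
  have -> // : (thr n <= y 0 i) = true by apply/idP; lra.
have cd x : Omega x -> enorm (g (rank x) - x) <= lam.
  move=> Ox; have [Og rg] := gP _ Ox; have ig := rankE _ _ rg.
  apply: (le_trans (enorm_le_norm _)).
  have : `|g (rank x) - x| < 2 * dl.
    apply: mx_norm_lt => [|i]; first by rewrite mulr_gt0.
    rewrite !mxE ltr_norml ltrNl opprB (close _ _ _ Ox Og (esym ig)) andbT.
    exact: close Og Ox ig.
  move=> /ltW h; apply: (@le_trans _ _ (N%:R * (2 * dl))); first by rewrite ler_wpM2l.
  rewrite /dl (_ : N%:R * _ = lam * (N%:R / (N%:R + 1))); last by field; rewrite gt_eqF.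
  by rewrite ler_piMr ?(ltW l0)// ler_pdivrMr// mul1r lerDl.
apply: (@adm_contraction _ _ _ _ _ oO OB mp p1 cvO (fun x => g (rank x)) lam l0 mc) => //.
(* The segment from [x] to its target stays in their common cell, which is convex and has a single
   target. *)
- move=> x t Ox t01; congr g; have [Og rg] := gP _ Ox.
  rewrite /rank; congr (nat_of_ord (enum_rank _)); apply: cell_index_convex.
    by apply/esym/rankE.
  by move: t01 => /andP[-> /ltW ->].
- move=> C mC; rewrite nuE//.
  have mpre : measurable ((fun x => g (rank x)) @^-1` C : set T) by rewrite -[X in measurable X]setTI; exact: mc.
  apply: (eq_trans (cells mu _ mpre)); rewrite -sumEFin; apply: eq_bigr => j _.
  rewrite indicE; have [Cg|Cg] := pselect (C (g j)).
    rewrite mem_set// mulr1 fineK ?fin_num_measure//; congr (mu _).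
    by apply/seteqP; split => [x []//|x xj]; split => //=; rewrite xj.
  rewrite memNset// mulr0 (_ : _ `&` _ = set0) ?measure0//.
  by apply/seteqP; split => // x [/= Cx xj]; apply: Cg; rewrite -xj.
Qed.

End grid.

(** * Narrow convergence makes the cost small *)

Section Wp_narrow.
Context {R : realType} {N : nat}.
Local Notation T := (borelRn R N).
Variables (Omega : set 'rV[R]_N) (p : 'rV[R]_N -> R) (B : R).
Hypotheses (oO : open Omega) (OB : forall x, Omega x -> `|x| <= B).
Hypothesis mp : measurable_fun (Omega : set T) (p : T -> R).
Hypothesis p1 : forall x, Omega x -> 1 <= p x.
Hypothesis cvO : convex_set (Omega : set (convex_lmodType 'rV[R]_N)).

(** Both [mu_n] and [mu] reach the same [nu] in two steps of cost [lam]: collapse on the grid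
    points, then gather the excess over [q] at [g 0]. The weights [q] are slightly below the masses
    of [mu], so lower bounds on open cells make them lie below those of [mu_n]; total masses being
    1, the excess is at most [th] on both sides. *)
Lemma adm_of_narrow (mu_ : nat -> probability T R) (mu : probability T R) (lam : R) :
  (forall n, prob_on Omega (mu_ n)) -> prob_on Omega mu -> narrow_cvg Omega \oo mu_ mu ->
  0 < lam -> \forall n \near \oo, adm Omega p (lam + lam + (lam + lam)) (mu_ n) mu.
Proof.
move=> mu_O muO nc l0.
have [m [g [Q [G [m0 gO QG sumQ cell]]]]] := grid_contraction oO OB mp p1 cvO muO l0.
have [th th0 disc] := adm_discrete oO OB mp p1 cvO m gO (gO 0%N) l0.
have mR : 0 < m%:R :> R by rewrite ltr0n.
have thm : 0 < th / m%:R by rewrite divr_gt0.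
pose w (xi : probability T R) j := fine (xi (Q j)).
have w0 xi j : 0 <= w xi j by exact: fine_ge0.
(* Lowering [m] masses by [th / m] loses at most [th] in total. The lowering is also the margin that
   the liminf inequality consumes. *)
pose q j := Num.max 0 (w mu j - th / m%:R).
have q0 j : 0 <= q j by rewrite le_max lexx.
have sumq : 1 - th <= \sum_(j < m) q j.
  apply: (@le_trans _ _ (\sum_(j < m) (w mu j - th / m%:R))); last first.
    by apply: ler_sum => j _; rewrite le_max lexx orbT.
  by rewrite sumrB sumQ sumr_const card_ord -[X in _ <= _ - X]mulr_natr divfK ?gt_eqF.
have qmu j : q j <= w mu j by rewrite ge_max w0 lerBlDr lerDl ltW.
have sumq1 : \sum_(j < m) q j <= 1 by rewrite -(sumQ mu); apply: ler_sum => j _; exact: qmu.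
(* The index [m] holds the remaining mass, to be placed at [g 0]. *)
pose W k := if (k < m)%N then q k else 1 - \sum_(j < m) q j.
pose gg k := if (k < m)%N then g k else g 0%N.
have W0 k : 0 <= W k by rewrite /W; case: ifP => // _; rewrite subr_ge0.
have Wm (F : nat -> R) : \sum_(k < m.+1) W k * F k = \sum_(k < m) q k * F k + (1 - \sum_(j < m) q j) * F m.
  rewrite big_ord_recr/= {2}/W ltnn; congr (_ + _).
  by apply: eq_bigr => k _; rewrite /W ltn_ord.
have [nu nuE] : exists nu : probability T R, forall A : set T, 
    nu A = (\sum_(k < m) q k * \1_A (g k) + (1 - \sum_(j < m) q j) * \1_A (g 0%N))%:E.
  have sW : \sum_(k < m.+1) W k = 1.
    by have := Wm (fun=> 1); rewrite -!mulr_suml !mulr1 => ->; rewrite addrC subrK.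
  have [nu nuE] := discrete_prob_exists (gg : nat -> T) W0 sW.
  exists nu => A; rewrite nuE (Wm (fun k => \1_A (gg k))) {2}/gg ltnn; congr (_ + _)%:E.
  by apply: eq_bigr => k _; rewrite /gg ltn_ord.
have common (xi : probability T R) : prob_on Omega xi -> (forall j : 'I_m, q j <= w xi j) ->
    adm Omega p (lam + lam) xi nu.
  move=> xiO qxi.
  have [zeta zetaE] := discrete_prob_exists (g : nat -> T) (w0 xi) (sumQ xi).
  have xiz := cell xi zeta xiO (fun C _ => zetaE C).
  apply: (adm_trans oO OB mp p1 l0 l0 xiz).
  (* The maximum keeps [s] nonnegative at the indices from [m] on, where [q] is not compared with
     the masses of [xi]. *)
  pose s j := Num.max 0 (w xi j - q j).
  have sE (j : 'I_m) : s j = w xi j - q j by apply/max_idPr; rewrite subr_ge0.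
  have qs (j : 'I_m) : q j + s j = w xi j by rewrite sE addrC subrK.
  have ss : \sum_(j < m) s j = 1 - \sum_(j < m) q j.
    by rewrite -(sumQ xi) -sumrB; apply: eq_bigr => j _; exact: sE.
  apply: (disc q s) => //.
  - by move=> j; rewrite le_max lexx.
  - by rewrite -(sumQ xi); apply: eq_bigr => j _; exact: qs.
  - by rewrite ss lerBlDr -lerBlDl.
  - by move=> C _; rewrite zetaE; congr _%:E; apply: eq_bigr => j _; rewrite qs.
  - by move=> C _; rewrite nuE -ss mulr_suml big_split.
have ev : \forall n \near \oo, forall j : 'I_m, fine (mu (G j)) - th / m%:R <= fine (mu_ n (G j)).
  apply: (@filter_forall _ 'I_m (fun j n => fine (mu (G j)) - th / m%:R <= fine (mu_ n (G j))) \oo _) => j.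
  by apply: (narrow_liminf_open oO mu_O muO nc) => //; have [] := QG j.
apply: filterS ev => n evn; apply: (@adm_trans _ _ _ _ _ oO OB mp p1 _ _ _ nu).
- by rewrite addr_gt0.
- by rewrite addr_gt0.
- apply: common => // j; have [mQ oG GQ muG] := QG j.
  rewrite ge_max w0/= /w -muG; apply: (le_trans (evn j)); apply: fine_le; rewrite ?fin_num_measure//.
    exact: open_measurable_Rn.
  by apply: le_measure; rewrite ?inE//; exact: open_measurable_Rn.
- exact: (adm_sym oO OB mp (common mu muO (fun j => qmu j))).
Qed.

Lemma Wp_of_narrow (mu_ : nat -> probability T R) (mu : probability T R) :
  (forall n, prob_on Omega (mu_ n)) -> prob_on Omega mu -> narrow_cvg Omega \oo mu_ mu ->
  (Wp Omega p (mu_ n) mu @[n --> \oo] --> 0)%E.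
Proof.
move=> mu_O muO nc; apply/fine_cvgP.
have ev (e : R) : 0 < e -> \forall n \near \oo, (Wp Omega p (mu_ n) mu <= e%:E)%E.
  move=> e0; have e4 : 0 < e / 4 by rewrite divr_gt0.
  apply: filterS (adm_of_narrow mu_O muO nc e4) => n ad.
  have E : e / 4 + e / 4 + (e / 4 + e / 4) = e by field.
  by rewrite -E; apply: Wp_le => //; rewrite E.
have fin (e : R) n : (Wp Omega p (mu_ n) mu <= e%:E)%E -> Wp Omega p (mu_ n) mu \is a fin_num.
  by move=> We; rewrite ge0_fin_numE ?Wp_ge0// (le_lt_trans We)// ltry.
split; first by apply: filterS (ev 1 ltr01) => n; exact: fin.
apply/cvgrPdist_le => e e0; apply: filterS (ev e e0) => n We.
rewrite sub0r normrN ger0_norm ?fine_ge0 ?Wp_ge0//.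
by rewrite -lee_fin fineK// (fin e).
Qed.

End Wp_narrow.

(** * The axioms of a distance *)

Section Wp_distance.
Context {R : realType} {N : nat}.
Local Notation T := (borelRn R N).
Variables (Omega : set 'rV[R]_N) (p : 'rV[R]_N -> R) (B : R).
Hypotheses (oO : open Omega) (OB : forall x, Omega x -> `|x| <= B).
Hypothesis mp : measurable_fun (Omega : set T) (p : T -> R).
Hypothesis p1 : forall x, Omega x -> 1 <= p x.
Hypothesis cvO : convex_set (Omega : set (convex_lmodType 'rV[R]_N)).
Implicit Types mu nu xi : probability T R.
Local Open Scope ereal_scope.

Lemma adm_refl lam mu : (0 < lam)%R -> prob_on Omega mu -> adm Omega p lam mu mu.
Proof.
move=> l0 muO.
apply: (@adm_contraction _ _ _ _ _ oO OB mp p1 cvO id lam l0 (@measurable_id _ T setT)) => //.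
- by move=> x t _ _; rewrite -scalerDl subrK scale1r.
- by move=> x _; rewrite subrr enorm0 ltW.
Qed.

(** Both measures collapse to the same point at a cost bounded by the size of [Omega]. *)
Lemma Wp_lty mu nu : prob_on Omega mu -> prob_on Omega nu -> Wp Omega p mu nu < +oo.
Proof.
move=> muO nuO.
have [y0 Oy0] : exists y, Omega y.
  apply/(@set0P _ Omega); apply/eqP => O0; move: muO; rewrite /prob_on/= O0 measure0 => /eqP.
  by rewrite lt_eqF// lte_fin.
(* [B + B] bounds the sup norm of a difference of points of [Omega], [N] passes to the Euclidean
   norm and 1 keeps [lam] positive. *)
pose lam : R := (N%:R * (B + B) + 1)%R.
have B0 : (0 <= B)%R by rewrite (le_trans _ (OB Oy0)).
have l0 : (0 < lam)%R by rewrite ltr_wpDl// mulr_ge0// addr_ge0.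
have [dl dlE] := @discrete_prob_exists _ T R 1 (fun=> 1%R) (fun=> y0) (fun=> ler01) (@big_ord1 _ _ _ _).
have toy xi : prob_on Omega xi -> adm Omega p lam xi dl.
  move=> xiO.
  apply: (@adm_contraction _ _ _ _ _ oO OB mp p1 cvO (fun=> y0) lam l0 (@measurable_cst _ _ T T setT y0)) => //.
  - move=> x Ox; apply: (le_trans (enorm_le_norm _)); rewrite ler_wpDr// ler_wpM2l//.
    by rewrite (le_trans (ler_normB _ _))// lerD ?OB.
  - move=> A mA; rewrite dlE big_ord1 mul1r indicE.
    have [Ay|Ay] := pselect (A y0).
      rewrite mem_set// (_ : _ @^-1` _ = setT) ?probability_setT//.
      by apply/seteqP; split.
    rewrite memNset// (_ : _ @^-1` _ = set0) ?measure0//.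
    by apply/seteqP; split.
apply: (@le_lt_trans _ _ (lam + lam)%:E); last exact: ltry.
apply: Wp_le; first by rewrite addr_gt0.
exact: (adm_trans oO OB mp p1 l0 l0 (toy _ muO) (adm_sym oO OB mp (toy _ nuO))).
Qed.

Lemma Wp_sym_le mu nu : Wp Omega p mu nu <= Wp Omega p nu mu.
Proof.
apply/lee_addgt0Pr => e e0.
have [Winf|] := eqVneq (Wp Omega p nu mu) +oo; first by rewrite Winf addye// leey.
move=> Wfin; have Wf : Wp Omega p nu mu \is a fin_num by rewrite ge0_fin_numE ?Wp_ge0// ltey.
have : Wp Omega p nu mu < (fine (Wp Omega p nu mu) + e)%:E.
  by rewrite EFinD fineK// lteDl// lte_fin.
move=> /Wp_lt_adm[l [l0 ll ad]].
apply: (@le_trans _ _ l%:E); first by apply: Wp_le => //; exact: (adm_sym oO OB mp ad).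
by rewrite -(fineK Wf) -EFinD lee_fin ltW.
Qed.

Lemma Wp_triangle mu nu xi : prob_on Omega mu -> prob_on Omega nu -> prob_on Omega xi ->
  Wp Omega p mu xi <= Wp Omega p mu nu + Wp Omega p nu xi.
Proof.
move=> muO nuO xiO.
have fin a b : prob_on Omega a -> prob_on Omega b -> Wp Omega p a b \is a fin_num.
  by move=> aO bO; rewrite ge0_fin_numE ?Wp_ge0// Wp_lty.
have short a b (e : R) : (0 < e)%R -> prob_on Omega a -> prob_on Omega b ->
    exists l, [/\ (0 < l)%R, (l < fine (Wp Omega p a b) + e)%R & adm Omega p l a b].
  move=> e0 aO bO; apply: Wp_lt_adm.
  by rewrite EFinD fineK ?fin// lteDl ?fin// lte_fin.
apply/lee_addgt0Pr => e e0; have e2 : (0 < e / 2)%R by rewrite divr_gt0.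
have [l1 [l10 l1W ad1]] := short _ _ _ e2 muO nuO.
have [l2 [l20 l2W ad2]] := short _ _ _ e2 nuO xiO.
apply: (@le_trans _ _ (l1 + l2)%:E).
  by apply: Wp_le; [rewrite addr_gt0|exact: (adm_trans oO OB mp p1 l10 l20 ad1 ad2)].
rewrite -(fineK (fin _ _ muO nuO)) -(fineK (fin _ _ nuO xiO)) -!EFinD lee_fin.
lra.
Qed.

Lemma Wp_refl mu nu : prob_on Omega mu -> measure_eq mu nu -> Wp Omega p mu nu = 0.
Proof.
move=> muO mn; apply/eqP; rewrite eq_le Wp_ge0 andbT; apply/lee_addgt0Pr => e e0; rewrite add0e.
by apply: Wp_le => //; exact: (adm_eq (fun _ _ => erefl) mn (adm_refl e0 muO)).
Qed.

End Wp_distance.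

Theorem theorem3p1 (R : realType) (N : nat) (hN : (1 <= N)%N)
    (Omega : set 'rV[R]_N)
    (Omega_neq0 : Omega !=set0) (Omega_open : open Omega)
    (Omega_bounded : bounded_set Omega)
    (Omega_convex : convex_set (Omega : set (convex_lmodType 'rV[R]_N)))
    (Omega_smooth : smooth_boundary Omega)
    (p : 'rV[R]_N -> R)
    (p_measurable : measurable_fun (Omega : set (borelRn R N)) (p : borelRn R N -> R))
    (p_ge1 : forall x, Omega x -> 1 <= p x) :
  is_distance_on (prob_on Omega) (fun mu nu => measure_eq mu nu) (Wp Omega p) /\
  (forall (rho_ : nat -> probability (borelRn R N) R)
          (rho : probability (borelRn R N) R),
     (forall n, prob_on Omega (rho_ n)) -> prob_on Omega rho ->
     (Wp Omega p (rho_ n) rho @[n --> \oo] --> 0%E) <->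
     narrow_cvg Omega \oo rho_ rho).
Proof.
have [B OB] := bounded_set_le Omega_bounded.
split; last first.
  move=> rho_ rho rho_O rhoO; split.
    exact: (narrow_of_Wp Omega_open OB p_measurable p_ge1 rho_O rhoO).
  exact: (Wp_of_narrow Omega_open OB p_measurable p_ge1 Omega_convex rho_O rhoO).
split.
- move=> mu nu muO nuO; rewrite Wp_ge0/=.
  exact: (Wp_lty Omega_open OB p_measurable p_ge1 Omega_convex muO nuO).
- move=> mu nu muO nuO; split.
    exact: (Wp_eq0 Omega_open OB p_measurable p_ge1 muO nuO).
  exact: (Wp_refl Omega_open OB p_measurable p_ge1 Omega_convex muO).
- move=> mu nu _ _; apply/eqP; rewrite eq_le; apply/andP; split;
    exact: (Wp_sym_le Omega_open OB p_measurable).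
- move=> mu nu xi; exact: (Wp_triangle Omega_open OB p_measurable p_ge1 Omega_convex).
Qed.
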